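(* Let $\{\rho^\varepsilon\}_{\varepsilon>0}\subset\mathcal{P}(\mathbb{T})$ with $\rho^\varepsilon\in C^1(\mathbb{T})\cap C^4_{loc}(\{\rho^\varepsilon>0\})$, $\rho^\varepsilon\to\rho_0$ in $\mathcal{W}^2(\mathbb{T})$ as $\varepsilon\to0^+$, and $\sup_\varepsilon E^\varepsilon[\rho^\varepsilon]<\infty$. Then $$\liminf_{\varepsilon\to0^+}\mathcal{G}^\varepsilon(\rho^\varepsilon)\ge|\nabla E^{**}|(\rho_0).$$
   Context: $\mathbb{T}=\mathbb{R}/\mathbb{Z}$. Elements of $\mathcal{P}(\mathbb{T})$ are taken absolutely continuous and identified with their densities. $\mathcal{W}^2(\mathbb{T})$ denotes $\mathcal{P}(\mathbb{T})$ with the $L^2$-Wasserstein distance $d_2$. Standing assumptions on $W$: $W\in C^2([0,\infty),[0,\infty))$, normalized with $W(0)=0$, $W'(0)=0$; $W^{**}$ is its convex envelope; $Q'(y):=yW'(y)-W(y)$. (H1) there is $C>0$ with $|Q'(y)|\le C(1+W(y))$ and $|W'(y)|\le C(1+W(y))$ for all $y\ge0$. (H2) $Q'(y)\to+\infty$ as $y\to+\infty$. (H3) the unstable set $\Sigma:=\overline{\{W>W^{**}\}\cup\{0\}}$ equals $\bigcup_{i=1}^p[a_i,b_i]$ with $p\in\mathbb{N}$ and $a_{i+1}>b_i$ (possibly $a_1=b_1=0$). (H4) $W''>0$ on $[0,\infty)\setminus\Sigma$, and $\inf_K W''>0$ for every compact $K\subset[0,\infty)\setminus\Sigma$. Functionals: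 $E^\varepsilon[\nu]=\int_{\mathbb T}\frac{\varepsilon^2}{2}|\nu_x|^2+W(\nu)\,dx$ if $\nu\in H^1(\mathbb{T})$, $+\infty$ otherwise. With $Q^{**\prime}(z):=zW^{**\prime}(z)-W^{**}(z)$, $|\nabla E^{**}|(\mu):=\big(\int_{\mathbb T}\mu|(W^{**\prime}(\mu))_x|^2dx\big)^{1/2}$ if $Q^{**\prime}(\mu)\in W^{1,1}(\mathbb{T})$, $+\infty$ otherwise. For $\mu\in H^1(\mathbb{T})$, $G^\varepsilon(\mu):=\mu W'(\mu)-W(\mu)+\frac{3\varepsilon^2}{2}|\mu_x|^2-\varepsilon^2(\mu\mu_x)_x$ (a distribution), $\mathcal{T}^\varepsilon(\mu):=\{g\in L^2(\mathbb{T}):G^\varepsilon(\mu)_x=\sqrt{\mu}\,g\text{ in }\mathcal{D}'(\mathbb{T})\}$, and $\mathcal{G}^\varepsilon(\mu):=\inf_{g\in\mathcal{T}^\varepsilon(\mu)}\|g\|_{L^2}$ if $\mathcal{T}^\varepsilon(\mu)\neq\emptyset$, $+\infty$ otherwise. *)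

(* Defs.v *)
(* R : realType; the torus T = R/Z is represented by
   1-periodic functions R -> R; integrals over T are integrals over [0,1]. *)
From HB Require Import structures.
From mathcomp Require Import all_boot all_order all_algebra.
From mathcomp Require Import all_classical all_reals all_analysis.
Set Implicit Arguments.
Unset Strict Implicit.
Unset Printing Implicit Defensive.
Import Order.TTheory GRing.Theory Num.Theory.
Import numFieldNormedType.Exports.
Local Open Scope classical_set_scope.
Local Open Scope ring_scope.

Section Defs.
Context {R : realType}.
Local Notation leb := (@lebesgue_measure R).

Definition intT (f : R -> R) : \bar R := (\int[leb]_(x in `[0%R, 1%R]) (f x)%:E)%E.

Definition periodic1 (f : R -> R) : Prop := forall x, f (x + 1) = f x.

Definition densityT (f : R -> R) : Prop :=
  periodic1 f /\ measurable_fun setT f /\ (forall x, 0 <= f x) /\ intT f = 1%E.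

Definition distT (x y : R) : R :=
  let d := x - y - (Num.floor (x - y))%:~R in Num.min d (1 - d).

(* couplings of mu dx and nu dx, as probability measures on R x R carried by
   [0,1) x [0,1) (a fundamental domain of T x T) *)
Definition couplingT (mu nu : R -> R)
  (g : probability (R * R)%type R) : Prop :=
  (forall A : set R, measurable A ->
     g (A `*` setT) = (\int[leb]_(x in A `&` `[0%R, 1%R[) (mu x)%:E)%E) /\
  (forall A : set R, measurable A ->
     g (setT `*` A) = (\int[leb]_(x in A `&` `[0%R, 1%R[) (nu x)%:E)%E).

Definition W2sq (mu nu : R -> R) : \bar R :=
  ereal_inf [set (\int[g]_(z in setT) ((distT z.1 z.2) ^+ 2)%:E)%E
            | g in couplingT mu nu].

Definition d2 (mu nu : R -> R) : R := Num.sqrt (fine (W2sq mu nu)).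

Definition C1T (f : R -> R) : Prop :=
  periodic1 f /\ (forall x, derivable f x 1) /\ continuous (derive1 f).

Definition C4loc_pos (f : R -> R) : Prop :=
  forall x, 0 < f x ->
    (forall k, (k < 4)%N -> derivable (iter k (fun h : R -> R => derive1 h) f) x 1) /\
    {for x, continuous (iter 4 (fun h : R -> R => derive1 h) f)}.

(* H^1(T), continuous representative: f(x) = f(0) + int_0^x g, g in L^2 *)
Definition H1T (f : R -> R) : Prop :=
  periodic1 f /\ exists g : R -> R, measurable_fun setT g /\
    (intT (fun x => (g x ^+ 2)%R) < +oo)%E /\
    forall x, 0 <= x <= 1 ->
      (f x)%:E = ((f 0)%:E + \int[leb]_(y in `[0%R, x]) (g y)%:E)%E.

(* W^{1,1}(T): f = c + int_0^x g  a.e. on [0,1], g in L^1 with zero mean;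
   g is then the weak derivative of f *)
Definition W11T_deriv (f g : R -> R) : Prop :=
  measurable_fun setT g /\ leb.-integrable `[0%R, 1%R] (fun x => (g x)%:E) /\
  intT g = 0%E /\
  exists c : R, {ae leb, forall x, (`[0%R, 1%R]%classic : set R) x ->
     (f x)%:E = (c%:E + \int[leb]_(y in `[0%R, x]) (g y)%:E)%E}.

Definition Eeps (W : R -> R) (eps : R) (nu : R -> R) : \bar R :=
  if `[< H1T nu >] then
    intT (fun x => eps ^+ 2 / 2 * (derive1 nu x) ^+ 2 + W (nu x))
  else +oo%E.

Definition convex_on_nonneg (phi : R -> R) : Prop :=
  forall x y t, 0 <= x -> 0 <= y -> 0 <= t <= 1 ->
    phi (t * x + (1 - t) * y) <= t * phi x + (1 - t) * phi y.

Definition Wss (W : R -> R) (z : R) : R :=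
  sup [set phi z | phi in [set phi | convex_on_nonneg phi /\
                                     forall y, 0 <= y -> phi y <= W y]].

Definition Qp (W : R -> R) (y : R) : R := y * derive1 W y - W y.

Definition Qssp (W : R -> R) (z : R) : R := z * derive1 (Wss W) z - Wss W z.

(* |grad E**|(mu): with q = Q**'(mu) in W^{1,1}(T), (W**'(mu))_x = q_x / mu
   on {mu > 0} (chain rule, since d/dz Q**'(z) = z W**''(z)), so the
   integrand mu |(W**'(mu))_x|^2 is  mu * (q_x / mu)^2  (0 where mu = 0). *)
Definition slopeEss (W : R -> R) (mu : R -> R) : \bar R :=
  ereal_inf [set poweR (intT (fun x => mu x * (g x / mu x) ^+ 2)) (2^-1)
            | g in W11T_deriv (fun x => Qssp W (mu x))].

Definition smooth_testT (phi : R -> R) : Prop :=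
  periodic1 phi /\ forall n x, derivable (iter n (fun h : R -> R => derive1 h) phi) x 1.

Definition Gpair (W : R -> R) (eps : R) (mu psi : R -> R) : \bar R :=
  (intT (fun x => ((mu x * derive1 W (mu x) - W (mu x)
                   + 3 * eps ^+ 2 / 2 * (derive1 mu x) ^+ 2) * psi x)%R)
   + intT (fun x => (eps ^+ 2 * (mu x * derive1 mu x) * derive1 psi x)%R))%E.

(* T^eps(mu) = { g in L^2 : G^eps(mu)_x = sqrt(mu) g in D'(T) } *)
Definition Teps (W : R -> R) (eps : R) (mu : R -> R) : set (R -> R) :=
  [set g : R -> R | measurable_fun setT g /\ (intT (fun x => (g x ^+ 2)%R) < +oo)%E /\
     forall phi, smooth_testT phi ->
       (- Gpair W eps mu (derive1 phi))%E =
       intT (fun x => (Num.sqrt (mu x) * g x * phi x)%R)].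

Definition calG (W : R -> R) (eps : R) (mu : R -> R) : \bar R :=
  ereal_inf [set poweR (intT (fun x => g x ^+ 2)) (2^-1) | g in Teps W eps mu].

(* W in C^2([0,oo)); stated for W : R -> R twice continuously differentiable
   (every C^2([0,oo)) function has such an extension; only values on [0,oo)
   enter any definition). *)
Definition standing_W (W : R -> R) : Prop :=
  (forall x, derivable W x 1) /\ (forall x, derivable (derive1 W) x 1) /\
  continuous (derive1 (derive1 W)) /\
  (forall y, 0 <= y -> 0 <= W y) /\ W 0 = 0 /\ derive1 W 0 = 0 /\
  (exists C : R, 0 < C /\ forall y, 0 <= y ->
     `|Qp W y| <= C * (1 + W y) /\ `|derive1 W y| <= C * (1 + W y)) /\
  (Qp W y @[y --> +oo] --> +oo%R) /\
  (exists (p : nat) (a b : nat -> R), (0 < p)%N /\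
     (forall i, (i < p)%N -> a i <= b i) /\
     (forall i, (i.+1 < p)%N -> b i < a i.+1) /\
     closure ([set y | 0 <= y /\ Wss W y < W y] `|` [set 0]) =
       [set y | exists i, (i < p)%N /\ a i <= y <= b i]) /\
  (let Sigma := closure ([set y | 0 <= y /\ Wss W y < W y] `|` [set 0]) in
   (forall y, 0 <= y -> ~ Sigma y -> 0 < derive1 (derive1 W) y) /\
   (forall K : set R, compact K -> K `<=` [set y | 0 <= y /\ ~ Sigma y] ->
      exists c : R, 0 < c /\ forall y, K y -> c <= derive1 (derive1 W) y)).

End Defs.

(* Main.v *)
(* Integrating G^eps(rho)_x = sqrt(rho) g once gives the profile equation
   eps^2 (rho rho_x)_x = Q'(rho) + (3 eps^2 / 2) rho_x^2 - F with a flux F whose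
   increments satisfy 2 t |dF| <= t^2 d(int rho) + d(int g^2) for every t > 0.
   Where rho takes a value at which W touches its convex envelope, the profile
   cannot stay away from equilibrium: if |F - Q'(rho)| were not small, the
   first integral of the equation would force rho to run monotonically past
   its bounds within a distance of order eps.  So there F = Q'(rho) = Q**'(rho)
   up to an error tending to 0 with eps, while Q**' is locally constant on the
   other values; hence Q**'(rho) inherits the increment inequality up to o(1).
   Along a sequence realizing the liminf, convergence in d_2 of the uniformly
   bounded rho^eps yields convergence of their primitives, hence
   Q**'(rho^eps) converges to a continuous function q, which equals
   Q**'(rho_0) almost everywhere by Lebesgue differentiation.  The increment
   inequality passes to the limit and bounds the dyadic difference quotients of
   q with respect to rho_0 dx in L^2(rho_0 dx); by martingale convergence q is a
   primitive of some q_x with int rho_0 (q_x / rho_0)^2 <= liminf |g|^2. *)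
Require Import Defs.
From HB Require Import structures.
From mathcomp Require Import all_boot all_order all_algebra.
From mathcomp Require Import all_classical all_reals all_analysis.
From mathcomp Require Import measurable_realfun ring lra.
Import Order.TTheory GRing.Theory Num.Theory.
Import numFieldNormedType.Exports.
Local Open Scope classical_set_scope.
Local Open Scope ring_scope.
Set Implicit Arguments.
Unset Strict Implicit.
Unset Printing Implicit Defensive.

(** The obstacle is oscillation: [rho] may jump between the phases on small scales, so it need not
    converge pointwise. Only [Qssp W (rho x)] is compact, because it does not see the values inside
    a phase gap; all limits are taken for this function. Cauchy-Schwarz is kept in AM-GM form with a
    free parameter [t]. It is then linear in the increments of the primitives of [rho] and [g ^+ 2],
    so it adds up over cells with a different [t] on each, survives a limit in which only the total
    of [g ^+ 2] is controlled, and loses no constant when [t] is the size of the difference quotient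
    itself. The uniform bound on [rho] is not assumed. The growth conditions and the energy bound
    control the mean flux, hence [F]; at a maximum of [rho] the equation gives Q'(rho) <= F, while
    Q' tends to infinity. The profile equation degenerates where [rho] vanishes. There nonnegativity
    forces both the slope and [F] to be 0, so a profile that keeps moving never meets a zero. *)

(** * Epsilon-delta forms of continuity and of the derivative *)

Lemma cts_eps (R : realType) (f : R -> R) (x : R) :
  {for x, continuous f} ->
  forall e : R, 0 < e -> exists2 h : R, 0 < h & forall u, `|u - x| < h -> `|f u - f x| <= e.
Proof.
move=> cf e e0.
have /cvgrPdist_le /(_ e e0) /nbhs_ballP [h /= h0 hh] := cf.
exists h => // u ux; rewrite distrC; apply: (hh u).
by rewrite /ball /= distrC.
Qed.

Lemma eps_cts (R : realType) (f : R -> R) (x : R) :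
  (forall e : R, 0 < e -> exists2 h : R, 0 < h & forall u, `|u - x| < h -> `|f u - f x| <= e) ->
  {for x, continuous f}.
Proof.
move=> H; apply/cvgrPdist_le => e e0; have [h h0 hh] := H e e0.
apply/nbhs_ballP; exists h => //= u; rewrite /ball /= => ux.
by rewrite distrC; apply: hh; rewrite distrC.
Qed.

Lemma is_derive_eps (R : realType) (f : R -> R) (x d : R) :
  is_derive x 1 f d ->
  forall e : R, 0 < e -> exists2 h : R, 0 < h &
    forall u, `|u - x| < h -> `|f u - f x - d * (u - x)| <= e * `|u - x|.
Proof.
move=> /is_derive1_caratheodory [g [fg cg gx]] e e0.
have [h h0 hh] := cts_eps cg e0.
exists h => // u ux; rewrite fg -gx -mulrBl normrM ler_wpM2r //.
exact: hh.
Qed.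

Lemma eps_is_derive (R : realType) (f : R -> R) (x d : R) :
  (forall e : R, 0 < e -> exists2 h : R, 0 < h &
    forall u, `|u - x| < h -> `|f u - f x - d * (u - x)| <= e * `|u - x|) ->
  is_derive x 1 f d.
Proof.
move=> H; apply/is_derive1_caratheodory.
exists (fun u => if u == x then d else (f u - f x) / (u - x)); split.
- move=> z; case: eqP => [->|/eqP zx]; first by rewrite !subrr mulr0.
  by rewrite divfK // subr_eq0.
- apply: eps_cts => e e0; have [h h0 hh] := H e e0; exists h => // u /hh.
  rewrite eqxx; case: eqP => [_|/eqP ux]; first by move=> _; rewrite subrr normr0 ltW.
  have ux0 : 0 < `|u - x| by rewrite normr_gt0 subr_eq0.
  move=> B; rewrite -(ler_pM2r ux0) -normrM mulrBl divfK ?subr_eq0 //.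
- by rewrite eqxx.
Qed.

Lemma is_derive_cts (R : realType) (f : R -> R) (x d : R) :
  is_derive x 1 f d -> {for x, continuous f}.
Proof. by move=> df; apply: differentiable_continuous; apply/derivable1_diffP; exact: ex_derive. Qed.

Lemma cts_within (R : realType) (f : R -> R) (a b : R) :
  (forall x, a <= x <= b -> {for x, continuous f}) -> {within `[a, b], continuous f}.
Proof.
move=> H; apply: continuous_in_subspaceT => x; rewrite inE /= in_itv /=; exact: H.
Qed.

(** These rules are restated for functions with an explicit argument, so that they chain by
    unification with the lambda terms met below. *)
Lemma deriveD_fun (R : realType) (f g : R -> R) (x df dg : R) :
  is_derive x 1 f df -> is_derive x 1 g dg ->
  is_derive x 1 (fun y => f y + g y) (df + dg).
Proof. exact: is_deriveD. Qed.

Lemma deriveN_fun (R : realType) (f : R -> R) (x df : R) :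
  is_derive x 1 f df -> is_derive x 1 (fun y => - f y) (- df).
Proof. exact: is_deriveN. Qed.

Lemma deriveB_fun (R : realType) (f g : R -> R) (x df dg : R) :
  is_derive x 1 f df -> is_derive x 1 g dg ->
  is_derive x 1 (fun y => f y - g y) (df - dg).
Proof. exact: is_deriveB. Qed.

Lemma deriveM_fun (R : realType) (f g : R -> R) (x df dg : R) :
  is_derive x 1 f df -> is_derive x 1 g dg ->
  is_derive x 1 (fun y => f y * g y) (df * g x + f x * dg).
Proof.
move=> Hf Hg; have := is_deriveM Hf Hg.
by rewrite addrC /GRing.scale /= [g x * df]mulrC.
Qed.

Lemma deriveZ_fun (R : realType) (k : R) (f : R -> R) (x df : R) :
  is_derive x 1 f df -> is_derive x 1 (fun y => k * f y) (k * df).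
Proof.
move=> Hf; have := deriveM_fun (is_derive_cst k x 1) Hf.
by rewrite mul0r add0r.
Qed.

Lemma deriveV_fun (R : realType) (f : R -> R) (x df : R) :
  f x != 0 -> is_derive x 1 f df ->
  is_derive x 1 (fun y => (f y)^-1) (- df / (f x) ^+ 2).
Proof.
move=> f0 /(is_deriveV f0) H; apply: is_derive_eq H _.
by rewrite /GRing.scale /= mulNr mulNr mulrC.
Qed.

Lemma derive_div_fun (R : realType) (f g : R -> R) (x df dg : R) :
  g x != 0 -> is_derive x 1 f df -> is_derive x 1 g dg ->
  is_derive x 1 (fun y => f y / g y) ((df * g x - f x * dg) / (g x) ^+ 2).
Proof.
move=> g0 Hf Hg; apply: is_derive_eq (deriveM_fun Hf (deriveV_fun g0 Hg)) _.
by field.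
Qed.

Lemma derive_comp_fun (R : realType) (f g : R -> R) (x df dg : R) :
  is_derive (g x) 1 f df -> is_derive x 1 g dg ->
  is_derive x 1 (fun y => f (g y)) (df * dg).
Proof. exact: is_derive1_comp. Qed.

Lemma mean_value (R : realType) (f df : R -> R) (a b : R) :
  a < b -> (forall x, a <= x <= b -> {for x, continuous f}) ->
  (forall x, a < x < b -> is_derive x 1 f (df x)) ->
  exists2 c : R, a < c < b & f b - f a = df c * (b - a).
Proof.
move=> ab cf fd.
have H x : x \in `]a, b[ -> is_derive x 1 f (df x) by rewrite in_itv /=; exact: fd.
have [c] := MVT ab H (cts_within cf).
by rewrite in_itv /=; exists c.
Qed.

Lemma is_derive1E (R : realType) (f : R -> R) (x d : R) :
  is_derive x 1 f d -> derive1 f x = d.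
Proof. by move=> df; rewrite derive1E derive_val. Qed.

Lemma derivable_is_derive1 (R : realType) (f : R -> R) (x : R) :
  derivable f x 1 -> is_derive x 1 f (derive1 f x).
Proof. by move=> /derivableP; rewrite derive1E. Qed.

Lemma is_derive_near (R : realType) (f g : R -> R) (x d h : R) :
  0 < h -> (forall r : R, `|r - x| < h -> f r = g r) ->
  is_derive x 1 g d -> is_derive x 1 f d.
Proof.
move=> h0 fg dg; apply: eps_is_derive => e e0.
have [k k0 kk] := is_derive_eps dg e0.
exists (Num.min h k); first by rewrite lt_min h0 k0.
move=> u; rewrite lt_min => /andP[uh uk]; rewrite !fg ?subrr ?normr0 //.
exact: kk.
Qed.

(** * Convex envelope *)

Lemma Wss_ge (R : realType) (W phi : R -> R) (z : R) :
  0 <= z -> convex_on_nonneg phi -> (forall y : R, 0 <= y -> phi y <= W y) ->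
  phi z <= Wss W z.
Proof.
move=> z0 cphi phiW; apply: ub_le_sup; last by exists phi.
by exists (W z) => _ [f [_ fW] <-]; exact: fW.
Qed.

Lemma convex_cst0 (R : realType) : convex_on_nonneg (fun _ : R => 0 : R).
Proof. by move=> x y t _ _ _; lra. Qed.

Lemma le_Wss (R : realType) (W : R -> R) (z b : R) :
  (forall y : R, 0 <= y -> 0 <= W y) ->
  (forall phi, convex_on_nonneg phi -> (forall y : R, 0 <= y -> phi y <= W y) -> phi z <= b) ->
  Wss W z <= b.
Proof.
move=> W0 H; apply: ge_sup; last by move=> _ [f [cf fW] <-]; exact: H.
(* The zero function keeps the set of minorants nonempty; on an empty set [sup] would take its
   default value. *)
by exists 0, (fun=> 0) => //; split=> //; exact: convex_cst0.
Qed.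

Lemma Wss_le (R : realType) (W : R -> R) (z : R) :
  (forall y : R, 0 <= y -> 0 <= W y) -> 0 <= z -> Wss W z <= W z.
Proof. by move=> W0 z0; apply: le_Wss => // phi _; exact. Qed.

Lemma Wss_ge0 (R : realType) (W : R -> R) (z : R) :
  (forall y : R, 0 <= y -> 0 <= W y) -> 0 <= z -> 0 <= Wss W z.
Proof. by move=> W0 z0; exact: (Wss_ge z0 (@convex_cst0 R)). Qed.

Lemma Wss0 (R : realType) (W : R -> R) :
  (forall y : R, 0 <= y -> 0 <= W y) -> W 0 = 0 -> Wss W 0 = 0.
Proof.
move=> W0 W00; apply/eqP; rewrite eq_le Wss_ge0 // andbT -[leRHS]W00.
exact: Wss_le.
Qed.

Lemma convex_Wss (R : realType) (W : R -> R) :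
  (forall y : R, 0 <= y -> 0 <= W y) -> convex_on_nonneg (Wss W).
Proof.
move=> W0 x y t x0 y0 /andP[t0 t1]; apply: le_Wss => // phi cphi phiW.
apply: (le_trans (cphi x y t x0 y0 _)); first by rewrite t0 t1.
by apply: lerD; rewrite ler_wpM2l ?subr_ge0 //; exact: Wss_ge.
Qed.

Lemma convex_tangent (R : realType) (f : R -> R) (z d : R) :
  convex_on_nonneg f -> 0 <= z -> is_derive z 1 f d ->
  forall r : R, 0 <= r -> f z + d * (r - z) <= f r.
Proof.
move=> cf z0 df r r0; apply/ler_addgt0Pr => e e0.
have [->|rz] := eqVneq r z; first by rewrite subrr mulr0; lra.
have rz0 : 0 < `|r - z| by rewrite normr_gt0 subr_eq0.
have [h h0 hh] := is_derive_eps df (divr_gt0 e0 rz0).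
pose t := Num.min 1 (h / (2 * `|r - z|)).
have h1 : 0 < h / (2 * `|r - z|) by rewrite divr_gt0 // mulr_gt0.
have t0 : 0 < t by rewrite /t lt_min ltr01 h1.
have t1 : t <= 1 by rewrite /t ge_min lexx.
have t2 : t * `|r - z| < h.
  apply: (@le_lt_trans _ _ (h / 2)); last by lra.
  have : t <= h / (2 * `|r - z|) by rewrite /t ge_min lexx orbT.
  rewrite -(ler_pM2r rz0) => /le_trans; apply.
  by rewrite invfM mulrA mulfVK // gt_eqF.
have := hh (z + t * (r - z)).
rewrite (_ : z + t * (r - z) - z = t * (r - z)); last by ring.
rewrite normrM (gtr0_norm t0) => /(_ t2).
rewrite (_ : e / `|r - z| * (t * `|r - z|) = t * e); last by field; rewrite gt_eqF.
move=> /ler_normlP[+ _].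
have := cf r z t r0 z0; rewrite t1 (ltW t0) => /(_ isT).
rewrite (_ : t * r + (1 - t) * z = z + t * (r - z)); last by ring.
move=> H1 H2.
have : t * (f z + d * (r - z)) <= t * (f r + e) by nra.
by rewrite ler_pM2l.
Qed.

Lemma convex_derive_le (R : realType) (f : R -> R) (x y dx dy : R) :
  convex_on_nonneg f -> 0 <= x -> x < y -> is_derive x 1 f dx -> is_derive y 1 f dy ->
  dx <= dy.
Proof.
move=> cf x0 xy fx fy; have y0 : 0 <= y by lra.
have H1 := convex_tangent cf x0 fx y0.
have H2 := convex_tangent cf y0 fy x0.
by rewrite -(ler_pM2r (_ : 0 < y - x)); nra.
Qed.

(** Differentiability of [Wss W] at [s] is not yet known, so its slope is read off [W]. The
    derivative of [W] bounds [Wss W] from above at the mirror point [s - t * (r - s)], midpoint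
    convexity at [s] turns this into a lower bound at [s + t * (r - s)], and convexity between [s]
    and [r] carries it to [r]. *)
Lemma Wss_contact_tangent (R : realType) (W : R -> R) (s d : R) :
  (forall y : R, 0 <= y -> 0 <= W y) -> 0 < s -> is_derive s 1 W d ->
  Wss W s = W s -> forall r : R, 0 <= r -> W s + d * (r - s) <= Wss W r.
Proof.
move=> W0 s0 dW Ws r r0; apply/ler_addgt0Pr => e e0.
have [->|rs] := eqVneq r s; first by rewrite Ws subrr mulr0; lra.
have rs0 : 0 < `|r - s| by rewrite normr_gt0 subr_eq0.
have [h h0 hh] := is_derive_eps dW (divr_gt0 e0 rs0).
(* The bound by [s] keeps the mirror point nonnegative. *)
pose k := Num.min h s.
have k0 : 0 < k by rewrite /k lt_min h0 s0.
have kh : k <= h by rewrite /k ge_min lexx.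
have ks : k <= s by rewrite /k ge_min lexx orbT.
pose t := Num.min 1 (k / (2 * `|r - s|)).
have h1 : 0 < k / (2 * `|r - s|) by rewrite divr_gt0 // mulr_gt0.
have t0 : 0 < t by rewrite /t lt_min ltr01 h1.
have t1 : t <= 1 by rewrite /t ge_min lexx.
have t2 : t * `|r - s| < k.
  apply: (@le_lt_trans _ _ (k / 2)); last by lra.
  have : t <= k / (2 * `|r - s|) by rewrite /t ge_min lexx orbT.
  rewrite -(ler_pM2r rs0) => /le_trans; apply.
  by rewrite invfM mulrA mulfVK // gt_eqF.
have tr : `|t * (r - s)| < k by rewrite normrM (gtr0_norm t0).
have [tr1 tr2] : - k < t * (r - s) /\ t * (r - s) < k.
  by move: tr; rewrite ltr_norml => /andP[].
have := hh (s - t * (r - s)).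
rewrite (_ : s - t * (r - s) - s = - (t * (r - s))); last by ring.
rewrite normrN normrM (gtr0_norm t0) => /(_ (lt_le_trans t2 kh)).
rewrite (_ : e / `|r - s| * (t * `|r - s|) = t * e); last by field; rewrite gt_eqF.
move=> /ler_normlP[_ H1].
have cW := convex_Wss W0.
have := cW r s t r0 (ltW s0); rewrite t1 (ltW t0) => /(_ isT).
rewrite (_ : t * r + (1 - t) * s = s + t * (r - s)); last by ring.
move=> H2.
have p0 : 0 <= s + t * (r - s) by lra.
have m0 : 0 <= s - t * (r - s) by lra.
have half : 0 <= (1 / 2 : R) <= 1 by apply/andP; split; lra.
have := cW _ _ (1/2) p0 m0 half.
rewrite (_ : 1 / 2 * (s + t * (r - s)) + (1 - 1 / 2) * (s - t * (r - s)) = s); last by field.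
move=> H3.
have H4 := Wss_le W0 m0.
have : t * (W s + d * (r - s)) <= t * (Wss W r + e) by rewrite Ws in H2 H3; nra.
by rewrite ler_pM2l.
Qed.

(** [Wss W] is squeezed between the tangent of [W] at [s] and [W] itself. *)
Lemma Wss_contact_derive (R : realType) (W : R -> R) (s d : R) :
  (forall y : R, 0 <= y -> 0 <= W y) -> 0 < s -> is_derive s 1 W d ->
  Wss W s = W s -> is_derive s 1 (Wss W) d.
Proof.
move=> W0 s0 dW Ws; apply: eps_is_derive => e e0.
have [h h0 hh] := is_derive_eps dW e0.
exists (Num.min h s); first by rewrite lt_min h0 s0.
move=> u; rewrite lt_min => /andP[uh us].
have u0 : 0 <= u by move: us; rewrite ltr_norml => /andP[]; lra.
have := hh u uh; rewrite !ler_norml => /andP[_ H1].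
have H2 := Wss_contact_tangent W0 s0 dW Ws u0.
have H3 := Wss_le W0 u0.
have H4 : 0 <= e * `|u - s| by rewrite mulr_ge0 // ltW.
by rewrite Ws; apply/andP; split; lra.
Qed.

(* Replacing [Wss W] by its chord around a point where it lies strictly below
   [W] still gives a convex minorant of [W], so [Wss W] is its own chord. *)
Lemma Wss_noncontact_affine (R : realType) (W : R -> R) (z : R) :
  (forall y : R, 0 <= y -> 0 <= W y) -> 0 < z -> {for z, continuous W} ->
  Wss W z < W z ->
  exists h a b : R, [/\ 0 < h, h < z &
    forall r : R, `|r - z| <= h -> Wss W r = a + b * r].
Proof.
move=> W0 z0 cWz Wz; have cW := convex_Wss W0.
(* A third of the gap: near [z] the chord stays below [Wss W z + k] and [W] above [W z - k], so the
   chord remains below [W]. *)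
pose k := (W z - Wss W z) / 3.
have k0 : 0 < k by rewrite divr_gt0 // subr_gt0.
have [h1 h10 hh1] := cts_eps cWz k0.
pose K := Wss W (2 * z) + Wss W 0 + 1.
have K0 : 0 < K.
  by rewrite /K; have := Wss_ge0 W0 (_ : 0 <= 2 * z); have := Wss_ge0 W0 (lexx 0); lra.
(* The three bounds keep the interval where [W] moves by at most [k], keep it to the right of 0, and
   make [h / z * K <= k], which limits the growth of [Wss W] through its values at 0 and [2 * z]. *)
pose h := Num.min (h1 / 2) (Num.min (z / 2) (z * k / K)).
have h0 : 0 < h by rewrite /h !lt_min !divr_gt0 // mulr_gt0.
have hh : h < h1.
  by apply: (@le_lt_trans _ _ (h1 / 2)); [rewrite /h ge_min lexx|lra].
have hz : h < z.
  by apply: (@le_lt_trans _ _ (z / 2)); [rewrite /h !ge_min lexx orbT|lra].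
have hk : h / z * K <= k.
  rewrite -mulrA -ler_pdivlMr ?mulr_gt0 ?invr_gt0 // invfM invrK.
  by rewrite /h !ge_min (_ : k * (z * K^-1) = z * k / K) ?lexx ?orbT //; ring.
have hz1 : 0 <= h / z <= 1 by rewrite divr_ge0 ?(ltW h0) ?(ltW z0) //= ler_pdivrMr // mul1r ltW.
have [hz10 hz11] := andP hz1.
have A1 : Wss W (z + h) <= Wss W z + k.
  have := cW (2 * z) z (h / z) _ _ hz1.
  rewrite (_ : h / z * (2 * z) + (1 - h / z) * z = z + h); last first.
    by field; rewrite gt_eqF.
  move=> H; have {}H := H ltac:(lra) ltac:(lra).
  have B1 := Wss_ge0 W0 (_ : 0 <= z).
  have B2 := Wss_ge0 W0 (_ : 0 <= 2 * z).
  have B3 := Wss_ge0 W0 (lexx 0).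
  apply: (le_trans H); apply: (le_trans _ (lerD (lexx _) hk)); rewrite /K.
  have {}B1 := B1 ltac:(lra). have {}B2 := B2 ltac:(lra).
  by nra.
have A2 : Wss W (z - h) <= Wss W z + k.
  have := cW 0 z (h / z) (lexx _) _ hz1.
  rewrite (_ : h / z * 0 + (1 - h / z) * z = z - h); last first.
    by field; rewrite gt_eqF.
  move=> H; have {}H := H ltac:(lra).
  have B1 := Wss_ge0 W0 (_ : 0 <= z).
  have B2 := Wss_ge0 W0 (_ : 0 <= 2 * z).
  have B3 := Wss_ge0 W0 (lexx 0).
  apply: (le_trans H); apply: (le_trans _ (lerD (lexx _) hk)); rewrite /K.
  have {}B1 := B1 ltac:(lra). have {}B2 := B2 ltac:(lra).
  by nra.
pose b := (Wss W (z + h) - Wss W (z - h)) / (2 * h).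
pose l r := Wss W (z - h) + b * (r - (z - h)).
have bh : b * (2 * h) = Wss W (z + h) - Wss W (z - h).
  by rewrite /b mulfVK // gt_eqF // mulr_gt0.
have zh0 : 0 <= z - h by lra.
have zh0' : 0 <= z + h by lra.
have inside r : `|r - z| <= h -> Wss W r <= l r.
  rewrite ler_norml => /andP[r1 r2].
  pose t := (z + h - r) / (2 * h).
  have h20 : 0 < 2 * h by lra.
  have tt : 0 <= t <= 1.
    by rewrite /t divr_ge0 ?(ltW h20) //= ?ler_pdivrMr ?mul1r //; lra.
  have := cW (z - h) (z + h) t zh0 zh0' tt.
  have tE : t * (2 * h) = z + h - r by rewrite /t mulfVK // gt_eqF.
  rewrite (_ : t * (z - h) + (1 - t) * (z + h) = r); last by lra.
  move=> /le_trans; apply; rewrite /l -(ler_pM2r h20).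
  rewrite (_ : (t * Wss W (z - h) + (1 - t) * Wss W (z + h)) * (2 * h) =
    (t * (2 * h)) * Wss W (z - h) + (2 * h - t * (2 * h)) * Wss W (z + h)); last by ring.
  rewrite tE (_ : (Wss W (z - h) + b * (r - (z - h))) * (2 * h) =
    Wss W (z - h) * (2 * h) + (b * (2 * h)) * (r - (z - h))); last by ring.
  by rewrite bh; lra.
have lW y : 0 <= y -> l y <= W y.
  move=> y0; have [yz|yz] := lerP `|y - z| h.
    have := hh1 y (le_lt_trans yz hh); rewrite ler_norml => /andP[H1 _].
    move: yz; rewrite ler_norml => /andP[y1 y2].
    have : l y <= Wss W z + k.
      have [b0|b0] := lerP 0 b.
        apply: (@le_trans _ _ (l (z + h))).
          by rewrite /l lerD2l ler_wpM2l //; lra.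
        by rewrite /l (_ : z + h - (z - h) = 2 * h) ?bh; lra.
      apply: (@le_trans _ _ (l (z - h))); last by rewrite /l; lra.
      by rewrite /l lerD2l ler_wnM2l ?(ltW b0) //; lra.
    by rewrite /k in H1 *; lra.
  (* Off the interval the line lies below [Wss W] itself: [t] is the weight that makes the nearer
     end point a convex combination of [y] and the farther one. *)
  apply: (le_trans _ (Wss_le W0 y0)).
  have [yz'|yz'] := lerP y z.
    have yh : y < z - h by move: yz; rewrite distrC ger0_norm; lra.
    pose t := (2 * h) / (z + h - y).
    have d0 : 0 < z + h - y by lra.
    have tt : 0 <= t <= 1.
      by clear - h0 d0 yh; rewrite /t divr_ge0 ?ler_pdivrMr //= ?mul1r; lra.
    have tE : t * (z + h - y) = 2 * h by rewrite /t mulfVK // gt_eqF.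
    have t0 : 0 < t by clear - h0 d0; rewrite divr_gt0; lra.
    have := cW y (z + h) t y0 zh0' tt.
    rewrite (_ : t * y + (1 - t) * (z + h) = z - h); last by lra.
    move=> H; rewrite -(ler_pM2l t0) /l.
    rewrite (_ : t * (Wss W (z - h) + b * (y - (z - h))) =
       t * Wss W (z - h) + b * (t * (y - (z + h)) + 2 * h * t)); last by ring.
    rewrite (_ : t * (y - (z + h)) = - (2 * h)); last by lra.
    rewrite (_ : b * (- (2 * h) + 2 * h * t) = b * (2 * h) * (t - 1)); last by ring.
    by rewrite bh; lra.
  have yh : z + h < y by move: yz; rewrite gtr0_norm; lra.
  pose t := (2 * h) / (y - (z - h)).
  have d0 : 0 < y - (z - h) by lra.
  have tt : 0 <= t <= 1.
    by clear - h0 d0 yh; rewrite /t divr_ge0 ?ler_pdivrMr //= ?mul1r; lra.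
  have tE : t * (y - (z - h)) = 2 * h by rewrite /t mulfVK // gt_eqF.
  have t0 : 0 < t by clear - h0 d0; rewrite divr_gt0; lra.
  have := cW y (z - h) t y0 zh0 tt.
  rewrite (_ : t * y + (1 - t) * (z - h) = z + h); last by lra.
  move=> H; rewrite -(ler_pM2l t0) /l.
  rewrite (_ : t * (Wss W (z - h) + b * (y - (z - h))) =
     t * Wss W (z - h) + b * (t * (y - (z - h)))); last by ring.
  by rewrite tE bh; lra.
exists h, (Wss W (z - h) - b * (z - h)), b; split=> // r rz.
have r0 : 0 <= r by move: rz; rewrite ler_norml => /andP[]; lra.
rewrite (_ : _ + b * r = l r); last by rewrite /l; ring.
apply/eqP; rewrite eq_le inside //=.
apply: (@Wss_ge _ W l r r0) => // x y t x0 y0 tt.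
by rewrite /l; lra.
Qed.

Lemma is_derive_affine (R : realType) (a b x : R) :
  is_derive x 1 (fun r : R => a + b * r) b.
Proof.
apply: eps_is_derive => e e0; exists 1 => // u _.
rewrite (_ : _ - _ - _ = 0); last by ring.
by rewrite normr0 mulr_ge0 // ltW.
Qed.

Lemma Wss_noncontact_derive (R : realType) (W : R -> R) (z : R) :
  (forall y : R, 0 <= y -> 0 <= W y) -> 0 < z -> {for z, continuous W} ->
  Wss W z < W z ->
  exists h a b : R, [/\ 0 < h, h < z &
    forall r : R, `|r - z| < h -> Wss W r = a + b * r /\ is_derive r 1 (Wss W) b].
Proof.
move=> W0 z0 cW Wz.
have [h [a [b [h0 hz H]]]] := Wss_noncontact_affine W0 z0 cW Wz.
exists h, a, b; split=> // r rz; split; first by rewrite H // ltW.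
apply: (@is_derive_near _ _ (fun r => a + b * r) _ _ (h - `|r - z|)).
- by rewrite subr_gt0.
- move=> u ur; apply: H; rewrite (_ : u - z = (u - r) + (r - z)); last by ring.
  by apply: (le_trans (ler_normD _ _)); lra.
- exact: is_derive_affine.
Qed.

(** Contact points are settled by squeezing, all others by local affinity. Hence the
    [derive1 (Wss W)] inside [Qssp] is a genuine derivative at every positive point. *)
Lemma Wss_is_derive (R : realType) (W : R -> R) (z : R) :
  (forall y : R, 0 <= y -> 0 <= W y) -> (forall x, derivable W x 1) -> 0 < z ->
  is_derive z 1 (Wss W) (derive1 (Wss W) z).
Proof.
move=> W0 dW z0; suff [d dd] : exists d, is_derive z 1 (Wss W) d.
  by rewrite (is_derive1E dd).
have dWz := derivable_is_derive1 (dW z).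
have := Wss_le W0 (ltW z0); rewrite le_eqVlt => /predU1P[E|lt].
  by exists (derive1 W z); exact: Wss_contact_derive.
have [h [a [b [h0 hz H]]]] := Wss_noncontact_derive W0 z0 (is_derive_cts dWz) lt.
by exists b; apply: (H z _).2; rewrite subrr normr0.
Qed.

(** The factor [z = 0] removes [derive1 (Wss W) 0], about which nothing is known: the minorants are
    constrained on the nonnegative half-line only. *)
Lemma Qssp0 (R : realType) (W : R -> R) :
  (forall y : R, 0 <= y -> 0 <= W y) -> W 0 = 0 -> Qssp W 0 = 0.
Proof. by move=> W0 W00; rewrite /Qssp Wss0 // mul0r subr0. Qed.

Lemma Qssp_contact (R : realType) (W : R -> R) (s : R) :
  (forall y : R, 0 <= y -> 0 <= W y) -> (forall x, derivable W x 1) -> 0 <= s ->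
  Wss W s = W s -> Qssp W s = Qp W s.
Proof.
move=> W0 dW; rewrite le_eqVlt => /predU1P[<-|s0] Ws.
  by rewrite /Qssp /Qp !mul0r Ws.
have dWs := derivable_is_derive1 (dW s).
by rewrite /Qssp /Qp (is_derive1E (Wss_contact_derive W0 s0 dWs Ws)) Ws.
Qed.

Lemma Qssp_noncontact (R : realType) (W : R -> R) (z : R) :
  (forall y : R, 0 <= y -> 0 <= W y) -> (forall x, derivable W x 1) -> 0 < z ->
  Wss W z < W z ->
  exists h : R, [/\ 0 < h, h < z &
    forall r : R, `|r - z| < h -> Qssp W r = Qssp W z].
Proof.
move=> W0 dW z0 Wz; have dWz := derivable_is_derive1 (dW z).
have [h [a [b [h0 hz H]]]] := Wss_noncontact_derive W0 z0 (is_derive_cts dWz) Wz.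
exists h; split=> // r rh; rewrite /Qssp.
have [-> /is_derive1E ->] := H _ rh.
have [|-> /is_derive1E ->] := H z; first by rewrite subrr normr0.
by ring.
Qed.

(** [- Qssp W z] is the height above 0 of the tangent to [Wss W] at [z], and this tangent lies below
    [Wss W 0 = 0]. *)
Lemma Qssp_ge0 (R : realType) (W : R -> R) (z : R) :
  (forall y : R, 0 <= y -> 0 <= W y) -> (forall x, derivable W x 1) -> W 0 = 0 ->
  0 <= z -> 0 <= Qssp W z.
Proof.
move=> W0 dW W00; rewrite le_eqVlt => /predU1P[<-|z0]; first by rewrite Qssp0.
have := convex_tangent (convex_Wss W0) (ltW z0) (Wss_is_derive W0 dW z0) (lexx 0).
by rewrite Wss0 // /Qssp; lra.
Qed.

(** The heights above 0 of the tangents to a convex function decrease as the point of tangency moves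
    right: the slope grows, and the tangent at [z] passes below the graph at [y]. *)
Lemma Qssp_homo (R : realType) (W : R -> R) (y z : R) :
  (forall y : R, 0 <= y -> 0 <= W y) -> (forall x, derivable W x 1) -> W 0 = 0 ->
  0 <= y -> y <= z -> Qssp W y <= Qssp W z.
Proof.
move=> W0 dW W00; rewrite le_eqVlt => /predU1P[<-|y0] yz.
  by rewrite Qssp0 //; exact: Qssp_ge0.
move: yz; rewrite le_eqVlt => /predU1P[->//|yz].
have z0 : 0 < z by lra.
have dy := Wss_is_derive W0 dW y0; have dz := Wss_is_derive W0 dW z0.
have := convex_tangent (convex_Wss W0) (ltW z0) dz (ltW y0).
have := convex_derive_le (convex_Wss W0) (ltW y0) yz dy dz.
by rewrite /Qssp; nra.
Qed.

(** With [k = |r - z|], the tangent at [r] evaluated at [r + k] and [r - k] is compared with the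
    first-order expansion at [z], valid up to distance [2 * k]; dividing by [k] compares the
    slopes. *)
Lemma convex_derive_cts (R : realType) (f df : R -> R) (z : R) :
  convex_on_nonneg f -> (forall y : R, 0 < y -> is_derive y 1 f (df y)) -> 0 < z ->
  {for z, continuous df}.
Proof.
move=> cf dfy z0; apply: eps_cts => e e0.
have e20 : 0 < e / 2 by lra.
have [h h0 hh] := is_derive_eps (dfy z z0) e20.
exists (Num.min (h / 2) (z / 2)); first by rewrite lt_min !divr_gt0.
move=> r; rewrite lt_min => /andP[rh rz].
have [->|neq] := eqVneq r z; first by rewrite subrr normr0 ltW.
set k := `|r - z| in rh rz *.
have k0 : 0 < k by rewrite normr_gt0 subr_eq0.
have r0 : 0 < r by move: rz; rewrite /k ltr_norml => /andP[]; lra.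
have T1 u : 0 <= u -> f z + df z * (u - z) <= f u.
  by move=> u0; exact: (convex_tangent cf (ltW z0) (dfy z z0)).
have T2 u : 0 <= u -> f r + df r * (u - r) <= f u.
  by move=> u0; exact: (convex_tangent cf (ltW r0) (dfy r r0)).
have kr : r - z <= k /\ z - r <= k.
  by rewrite /k; split; [exact: ler_norm|rewrite distrC; exact: ler_norm].
have U u : `|u - z| <= 2 * k -> f u <= f z + df z * (u - z) + e * k.
  move=> uk; have uh : `|u - z| < h by lra.
  have := hh _ uh; rewrite ler_norml => /andP[_].
  have : e / 2 * `|u - z| <= e / 2 * (2 * k) by rewrite ler_wpM2l // ltW.
  by lra.
have rpk : `|r + k - z| <= 2 * k.
  rewrite (_ : r + k - z = (r - z) + k); last by ring.
  by apply: (le_trans (ler_normD _ _)); rewrite -/k (gtr0_norm k0); lra.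
have rmk : `|r - k - z| <= 2 * k.
  rewrite (_ : r - k - z = (r - z) - k); last by ring.
  by apply: (le_trans (ler_normB _ _)); rewrite -/k (gtr0_norm k0); lra.
have m0 : 0 <= r - k by lra.
have := U _ rpk; have := U _ rmk; have := T1 r (ltW r0).
have := T2 (r - k) m0; have := T2 (r + k) ltac:(lra) => P1 P2 P3 P4 P5.
rewrite ler_norml; apply/andP; split; rewrite -(ler_pM2r k0); lra.
Qed.

Lemma Qssp_cts (R : realType) (W : R -> R) (z : R) :
  (forall y : R, 0 <= y -> 0 <= W y) -> (forall x, derivable W x 1) -> W 0 = 0 ->
  0 <= z -> forall e : R, 0 < e -> exists2 h : R, 0 < h &
    forall r : R, 0 <= r -> `|r - z| < h -> `|Qssp W r - Qssp W z| <= e.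
Proof.
move=> W0 dW W00; rewrite le_eqVlt => /predU1P[<-|z0] e e0.
  (* At 0 no derivative of the envelope is available. For [r < 1] its slope is at most the slope [D]
     at 1, hence [0 <= Qssp W r <= r * D]. *)
  have d1 := Wss_is_derive W0 dW (ltr01).
  set D := derive1 (Wss W) 1 in d1.
  pose K := `|D| + 1.
  have K0 : 0 < K by rewrite ltr_wpDl.
  exists (Num.min 1 (e / K)); first by rewrite lt_min ltr01 divr_gt0.
  move=> r r0; rewrite subr0 Qssp0 // subr0 (ger0_norm r0) lt_min => /andP[r1 re].
  rewrite ger0_norm; last exact: Qssp_ge0.
  move: r0; rewrite le_eqVlt => /predU1P[<-|r0]; first by rewrite Qssp0 // ltW.
  rewrite /Qssp.
  have := convex_derive_le (convex_Wss W0) (ltW r0) r1 (Wss_is_derive W0 dW r0) d1.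
  have := Wss_ge0 W0 (ltW r0); have := ler_norm D.
  move: re; rewrite ltr_pdivlMr // /K => *.
  by nra.
have cz := convex_derive_cts (convex_Wss W0) (fun y y0 => Wss_is_derive W0 dW y0) z0.
have cQ : {for z, continuous (Qssp W)}.
  apply: cvgB; last exact: (is_derive_cts (Wss_is_derive W0 dW z0)).
  by apply: cvgM; [exact: cvg_id|exact: cz].
have [h h0 hh] := cts_eps cQ e0.
by exists h => // r _; exact: hh.
Qed.

(* A value of [Qssp W] is attained on an interval whose end points are contact
   points, as [Qssp W] is locally constant off the contact set. *)
Lemma Qssp_contacts (R : realType) (W : R -> R) (y z : R) :
  (forall y : R, 0 <= y -> 0 <= W y) -> (forall x, derivable W x 1) -> W 0 = 0 ->
  0 <= y -> y <= z -> Qssp W y < Qssp W z ->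
  exists s t : R, [/\ y <= s <= z, y <= t <= z,
    Wss W s = W s /\ Wss W t = W t & Qssp W s = Qssp W y /\ Qssp W t = Qssp W z].
Proof.
move=> W0 dW W00 y0 yz Qyz.
have homo u v : 0 <= u -> u <= v -> Qssp W u <= Qssp W v.
  exact: Qssp_homo.
have contact u : 0 <= u -> (0 < u -> ~ exists h : R, [/\ 0 < h, h < u &
    forall r : R, `|r - u| < h -> Qssp W r = Qssp W u]) -> Wss W u = W u.
  rewrite le_eqVlt => /predU1P[<-|u0]; first by rewrite Wss0.
  have := Wss_le W0 (ltW u0); rewrite le_eqVlt => /predU1P[->//|lt] /(_ u0).
  by move=> /(_ (Qssp_noncontact W0 dW u0 lt)).
pose A := [set r : R | y <= r <= z /\ Qssp W r = Qssp W y].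
pose B := [set r : R | y <= r <= z /\ Qssp W r = Qssp W z].
have Ay : A y by split => //; rewrite lexx yz.
have Bz : B z by split => //; rewrite lexx yz.
have uA : has_ubound A by exists z => r [/andP[]].
have lB : has_lbound B by exists y => r [/andP[]].
(* [s] is the last point with the value at [y], [t] the first with the value at [z]. If one of them
   were off the contact set, local constancy would push it further. *)
pose s := sup A; pose t := inf B.
have ys : y <= s by exact: ub_le_sup.
have sz : s <= z by apply: ge_sup; [by exists y|by move=> r [/andP[]]].
have yt : y <= t by apply: lb_le_inf; [by exists z|by move=> r [/andP[]]].
have tz : t <= z by exact: ge_inf.
have Qs : Qssp W s = Qssp W y.
  apply/eqP; rewrite eq_le (homo _ _ y0 ys) andbT; apply/ler_addgt0Pr => e e0.
  have [h h0 hh] := Qssp_cts W0 dW W00 (le_trans y0 ys) e0.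
  have [a [/andP[ya az] Qa] sa] := sup_adherent h0 (conj (ex_intro _ y Ay) uA).
  have as_ : a <= s by apply: ub_le_sup => //; split=> //; rewrite ya az.
  have := hh a (le_trans y0 ya).
  rewrite distrC ger0_norm ?subr_ge0 // => /(_ ltac:(rewrite -/s in sa *; lra)).
  by rewrite Qa ler_norml => /andP[]; lra.
have Qt : Qssp W t = Qssp W z.
  apply/eqP; rewrite eq_le (homo _ _ (le_trans y0 yt) tz) /=; apply/ler_addgt0Pr => e e0.
  have [h h0 hh] := Qssp_cts W0 dW W00 (le_trans y0 yt) e0.
  have [a [/andP[ya az] Qa] sa] := inf_adherent h0 (conj (ex_intro _ z Bz) lB).
  have as_ : t <= a by apply: ge_inf => //; split=> //; rewrite ya az.
  have := hh a (le_trans y0 ya).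
  rewrite ger0_norm ?subr_ge0 // => /(_ ltac:(rewrite -/t in sa *; lra)).
  by rewrite Qa ler_norml => /andP[]; lra.
exists s, t; split; rewrite ?ys ?yt ?sz ?tz //; split.
- apply: contact => [|s0 [h [h0 hs H]]]; first exact: le_trans ys.
  have sz' : s < z.
    by rewrite lt_neqAle sz andbT; apply/eqP => E; move: Qyz; rewrite -Qs E ltxx.
  pose u := s + Num.min (h / 2) (z - s).
  have m0 : 0 < Num.min (h / 2) (z - s) by rewrite lt_min divr_gt0 // subr_gt0.
  have mh : Num.min (h / 2) (z - s) <= h / 2 by rewrite ge_min lexx.
  have mz : Num.min (h / 2) (z - s) <= z - s by rewrite ge_min lexx orbT.
  have : u <= s.
    apply: ub_le_sup => //; split; first by rewrite /u; apply/andP; split; lra.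
    rewrite H // /u (_ : s + _ - s = Num.min (h / 2) (z - s)); last by ring.
    by rewrite gtr0_norm //; lra.
  by rewrite /u; lra.
- apply: contact => [|t0 [h [h0 ht H]]]; first exact: le_trans yt.
  have yt' : y < t.
    by rewrite lt_neqAle yt andbT; apply/eqP => E; move: Qyz; rewrite -Qt -E ltxx.
  pose u := t - Num.min (h / 2) (t - y).
  have m0 : 0 < Num.min (h / 2) (t - y) by rewrite lt_min divr_gt0 // subr_gt0.
  have mh : Num.min (h / 2) (t - y) <= h / 2 by rewrite ge_min lexx.
  have mz : Num.min (h / 2) (t - y) <= t - y by rewrite ge_min lexx orbT.
  have : t <= u.
    apply: ge_inf => //; split; first by rewrite /u; apply/andP; split; lra.
    rewrite H // /u (_ : t - _ - t = - Num.min (h / 2) (t - y)); last by ring.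
    by rewrite normrN gtr0_norm //; lra.
  by rewrite /u; lra.
Qed.

(** * Profiles with an inexact flux *)

Lemma derive_at_zero_of_ge0 (R : realType) (f : R -> R) (x d : R) :
  (forall u : R, 0 <= f u) -> f x = 0 -> is_derive x 1 f d -> d = 0.
Proof.
move=> f0 fx df; apply/eqP; rewrite -normr_le0; apply/ler_addgt0Pr => e e0.
have [h h0 hh] := is_derive_eps df e0.
have h2 : 0 < h / 2 by lra.
have := hh (x + h / 2); have := hh (x - h / 2).
rewrite (_ : x - h / 2 - x = - (h / 2)); last by ring.
rewrite (_ : x + h / 2 - x = h / 2); last by ring.
rewrite normrN gtr0_norm // => /(_ ltac:(lra)) /ler_normlP[_ H1].
move=> /(_ ltac:(lra)) /ler_normlP[_ H2].
have := f0 (x + h / 2); have := f0 (x - h / 2); rewrite fx in H1 H2 => H3 H4.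
by rewrite add0r ler_norml; apply/andP; split; rewrite -(ler_pM2r h2); lra.
Qed.

(** The second-order term is the derivative of [rho * v], since [v] alone need not be differentiable
    where [rho] vanishes. *)
Definition ode_profile (R : realType) (W : R -> R) (eps : R) (rho v F : R -> R) :=
  [/\ forall x : R, is_derive x 1 rho (v x), continuous v, forall x : R, 0 <= rho x &
    forall x : R, is_derive x 1 (fun y => eps ^+ 2 * (rho y * v y))
      (Qp W (rho x) + 3 * eps ^+ 2 / 2 * (v x) ^+ 2 - F x)].

(** Reflection lets an argument running to the right of a point serve for the left as well. *)
Lemma ode_profile_opp (R : realType) (W : R -> R) (eps : R) (rho v F : R -> R) :
  ode_profile W eps rho v F ->
  ode_profile W eps (fun x => rho (- x)) (fun x => - v (- x)) (fun x => F (- x)).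
Proof.
move=> [drho cv rho0 dB]; split=> [x|x|x|x].
- apply: is_derive_eq (derive_comp_fun (drho (- x)) (deriveN_fun (is_derive_id x 1))) _.
  by rewrite mulrN1.
- apply: cvgN; apply: (@continuous_comp _ _ _ (fun y : R => - y) v).
    exact: opp_continuous.
  exact: cv.
- exact: rho0.
- have := derive_comp_fun (dB (- x)) (deriveN_fun (is_derive_id x 1)).
  move=> /deriveN_fun H; rewrite sqrrN.
  have -> : (fun y => eps ^+ 2 * (rho (- y) * - v (- y))) =
            (fun y => - (eps ^+ 2 * (rho (- y) * v (- y)))).
    by apply/funext => y; ring.
  by apply: is_derive_eq H _; rewrite mulrN1 opprK.
Qed.

(** A zero is a minimum of [rho], so [v x = 0]; then [rho * v] is o(u - x) times a bounded factor
    and has derivative 0 at [x], and every other term of the equation except [F x] vanishes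
    there. *)
Lemma ode_zero (R : realType) (W : R -> R) (eps : R) (rho v F : R -> R) (x : R) :
  ode_profile W eps rho v F -> W 0 = 0 -> rho x = 0 -> v x = 0 /\ F x = 0.
Proof.
move=> [drho cv rho0 dB] W00 rx.
have vx : v x = 0 by exact: (derive_at_zero_of_ge0 rho0 rx (drho x)).
split=> //; have := dB x; rewrite rx vx /Qp mul0r W00 => dBx.
suff dB0 : is_derive x 1 (fun y => eps ^+ 2 * (rho y * v y)) 0.
  have := is_derive1E dBx; rewrite (is_derive1E dB0) expr0n /=; lra.
apply: eps_is_derive => e e0.
pose k := e / (eps ^+ 2 + 1).
have k0 : 0 < k by rewrite divr_gt0 // ltr_wpDl // sqr_ge0.
have [h1 h10 hh1] := is_derive_eps (drho x) k0.
have [h2 h20 hh2] := cts_eps (cv x) ltr01.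
exists (Num.min h1 h2); first by rewrite lt_min h10 h20.
move=> u; rewrite lt_min => /andP[/hh1 + /hh2].
rewrite rx vx !(mul0r, mulr0, subr0) => H1 H2.
rewrite normrM (ger0_norm (sqr_ge0 eps)) normrM.
apply: (@le_trans _ _ (eps ^+ 2 * (k * `|u - x| * 1))).
  by rewrite ler_wpM2l ?sqr_ge0 // ler_pM.
rewrite mulr1 mulrA ler_wpM2r // /k mulrA ler_pdivrMr; last first.
  by rewrite ltr_wpDl // sqr_ge0.
by rewrite mulrC ler_pM2l // lerDl.
Qed.

Lemma ode_derive_v (R : realType) (W : R -> R) (eps : R) (rho v F : R -> R) (x : R) :
  ode_profile W eps rho v F -> 0 < eps -> 0 < rho x ->
  is_derive x 1 v ((Qp W (rho x) + eps ^+ 2 / 2 * (v x) ^+ 2 - F x) / (eps ^+ 2 * rho x)).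
Proof.
move=> [drho cv rho0 dB] eps0 rx.
have r2 : 0 < rho x / 2 by lra.
have [h h0 hh] := cts_eps (is_derive_cts (drho x)) r2.
apply: (@is_derive_near _ _
  (fun y => (eps ^+ 2 * (rho y * v y)) / (eps ^+ 2 * rho y)) _ _ h h0).
- move=> r /hh; rewrite ler_norml => /andP[H _].
  have rr : 0 < rho r by lra.
  by field; rewrite !gt_eqF.
- apply: is_derive_eq (derive_div_fun _ (dB x) (deriveZ_fun (eps ^+ 2) (drho x))) _.
    by rewrite mulf_neq0 // ?expf_neq0 // gt_eqF.
  by field; rewrite !gt_eqF.
Qed.

(* [Z = (eps^2 v^2 / 2 - W(rho) - F(x0)) / rho] satisfies
   [Z' = (F(x0) - F) v / rho^2], so adding [- sg delta / (2 rho)] makes it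
   monotone while [sg v >= 0]. *)
Lemma ode_energy (R : realType) (W : R -> R) (eps : R) (rho v F : R -> R)
    (sg delta x0 x : R) :
  ode_profile W eps rho v F -> (forall y : R, derivable W y 1) ->
  0 < eps -> sg * sg = 1 -> x0 < x ->
  (forall c : R, x0 <= c <= x -> 0 < rho c) ->
  (forall c : R, x0 < c < x -> 0 <= sg * v c /\ `|F c - F x0| <= delta / 2) ->
  (forall r : R, 0 <= r ->
     W (rho x0) + derive1 W (rho x0) * (r - rho x0) <= W r) ->
  delta <= sg * (Qp W (rho x0) - F x0) ->
  0 <= sg * (rho x / rho x0 - 1) /\
  delta * (sg * (rho x / rho x0 - 1)) <= eps ^+ 2 * (v x) ^+ 2.
Proof.
move=> ode dW eps0 sg2 x0x rho0 H tW dl; have [drho cv rge dB] := ode.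
set y := rho x0 in tW dl *; have y0 : 0 < y by apply: rho0; rewrite lexx ltW.
have crho u : {for u, continuous rho} by exact: is_derive_cts (drho u).
have w0 : 0 <= sg * (rho x / y - 1).
  have [c cx E] := mean_value x0x (fun u _ => crho u) (fun u _ => drho u).
  have -> : sg * (rho x / y - 1) = sg * v c * (x - x0) / y.
    have -> : rho x = y + v c * (x - x0) by rewrite /y -E addrC subrK.
    by field; rewrite gt_eqF.
  apply: divr_ge0; last exact: ltW.
  by apply: mulr_ge0; [have [] := H c cx|lra].
split=> //.
set g := F x0.
pose N u := eps ^+ 2 / 2 * (v u * v u) - W (rho u) - (g + sg * (delta / 2)).
pose N' u := v u * (Qp W (rho u) + eps ^+ 2 / 2 * (v u) ^+ 2 - F u) / rho u
             - derive1 W (rho u) * v u.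
have dN u : 0 < rho u -> is_derive u 1 N (N' u).
  move=> ru; have dv := ode_derive_v ode eps0 ru.
  have dWr := derive_comp_fun (derivable_is_derive1 (dW (rho u))) (drho u).
  apply: is_derive_eq (deriveB_fun (deriveB_fun
    (deriveZ_fun (eps ^+ 2 / 2) (deriveM_fun dv dv)) dWr) (is_derive_cst _ u 1)) _.
  by rewrite /N'; field; rewrite !gt_eqF.
pose Z' u := (N' u * rho u - N u * v u) / (rho u) ^+ 2.
have dZ u : 0 < rho u -> is_derive u 1 (fun t => N t / rho t) (Z' u).
  by move=> ru; exact: derive_div_fun (lt0r_neq0 ru) (dN u ru) (drho u).
have [c /[dup] cx /andP[c1 c2] E] : exists2 c : R, x0 < c < x &
    N x / rho x - N x0 / rho x0 = Z' c * (x - x0).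
  apply: (@mean_value _ (fun t => N t / rho t) Z' x0 x x0x) => u ux.
    by apply: is_derive_cts (dZ u _); exact: rho0.
  by apply: dZ; apply: rho0; case/andP: ux => ? ?; rewrite !ltW.
have rc : 0 < rho c by apply: rho0; rewrite !ltW.
have Z'0 : 0 <= Z' c.
  have [vc Fc] := H c cx.
  rewrite /Z' divr_ge0 ?sqr_ge0 //.
  (* Both factors are nonnegative: the first by the direction of motion, the second because the
     shift [sg * (delta / 2)] absorbs the variation of [F]. *)
  have -> : N' c * rho c - N c * v c = (sg * v c) * (sg * (g - F c) + delta / 2).
    have -> : (sg * v c) * (sg * (g - F c) + delta / 2) =
      (sg * sg) * (v c * (g - F c)) + sg * v c * (delta / 2) by ring.
    by rewrite sg2 /N' /N /Qp; field; rewrite gt_eqF.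
  rewrite mulr_ge0 //.
  have : `|sg * (g - F c)| <= delta / 2.
    rewrite normrM distrC (_ : `|sg| = 1) ?mul1r //.
    by apply/eqP; rewrite -(eqrXn2 (_ : 0 < 2)%N) // -normrX expr2 sg2 expr1n normr1.
  by rewrite ler_norml => /andP[]; lra.
have rx : 0 < rho x by apply: rho0; rewrite lexx ltW.
have : N x0 / y <= N x / rho x.
  by rewrite -subr_ge0 E mulr_ge0 // subr_ge0 ltW.
rewrite ler_pdivlMr // => HN.
(* With r = rho x / y, monotonicity and the tangent of [W] at [y] give eps^2 v^2 / 2 >= (r - 1) (Qp
   W y - g) - sg (r - 1) delta / 2 once the kinetic term at [x0] is dropped. By [dl] the first term
   is at least twice the last, which leaves sg (r - 1) delta / 2. *)
have H1 := tW (rho x) (ltW rx).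
have H2 : 0 <= eps ^+ 2 / 2 * (v x0 * v x0).
  by rewrite mulr_ge0 ?divr_ge0 ?sqr_ge0 // -expr2 sqr_ge0.
have H3 : - (W y + g + sg * (delta / 2)) * (rho x / y) <= N x0 / y * rho x.
  rewrite (_ : N x0 / y * rho x = N x0 * (rho x / y)); last by ring.
  rewrite ler_wpM2r ?divr_ge0 ?(ltW y0) ?(ltW rx) //.
  by rewrite /N -/y; lra.
set r := rho x / y in w0 H3 *.
have rE : rho x = r * y by rewrite /r divfK // gt_eqF.
have H4 : (sg * (r - 1)) * (sg * (Qp W y - g)) = (r - 1) * (Qp W y - g).
  by rewrite mulrACA sg2 mul1r.
have H5 : (sg * (r - 1)) * delta <= (sg * (r - 1)) * (sg * (Qp W y - g)).
  by rewrite ler_wpM2l.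
rewrite [N x]/N in HN.
rewrite H4 /Qp in H5.
rewrite rE in HN H1 H3.
by move: HN H1 H3 H5; rewrite expr2; lra.
Qed.

Lemma norm_of_sqr1 (R : realType) (sg : R) : sg * sg = 1 -> `|sg| = 1.
Proof.
move=> sg2; apply/eqP.
by rewrite -(eqrXn2 (_ : 0 < 2)%N) // -normrX expr2 sg2 expr1n normr1.
Qed.

(** If [v x0] is nonzero its sign persists by continuity; if it is 0, the equation makes [sg * v]
    strictly increasing to first order at [x0]. *)
Lemma ode_initial_direction (R : realType) (W : R -> R) (eps : R) (rho v F : R -> R)
    (sg delta x0 : R) :
  ode_profile W eps rho v F -> 0 < eps -> 0 < delta -> sg * sg = 1 -> 0 < rho x0 ->
  delta <= sg * (Qp W (rho x0) - F x0) -> 0 <= sg * v x0 ->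
  exists2 h : R, 0 < h & forall x : R, x0 < x < x0 + h -> 0 < sg * v x.
Proof.
move=> ode eps0 d0 sg2 y0 dl; have [drho cv rge dB] := ode.
have sg1 := norm_of_sqr1 sg2.
rewrite le_eqVlt => /predU1P[v0|v0].
  have {}v0 : v x0 = 0.
    have : sg * (sg * v x0) = 0 by rewrite -v0 mulr0.
    by rewrite mulrA sg2 mul1r.
  have := ode_derive_v ode eps0 y0; rewrite v0 expr0n /= mulr0 addr0.
  set a := _ / _ => dv.
  have p0 : 0 < eps ^+ 2 * rho x0 by rewrite mulr_gt0 // exprn_gt0.
  have a0 : 0 < sg * a by rewrite /a mulrA divr_gt0 //; lra.
  have a20 : 0 < sg * a / 2 by lra.
  have [h h0 hh] := is_derive_eps dv a20.
  exists h => // x /andP[x1 x2]; have := hh x.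
  have xx : 0 < x - x0 by lra.
  rewrite gtr0_norm // => /(_ ltac:(lra)); rewrite v0 subr0 => H.
  have : `|sg * (v x - a * (x - x0))| <= sg * a / 2 * (x - x0) by rewrite normrM sg1 mul1r.
  rewrite ler_norml => /andP[H1 _].
  have : 0 < sg * a / 2 * (x - x0) by rewrite mulr_gt0.
  by lra.
have v20 : 0 < sg * v x0 / 2 by lra.
have [h h0 hh] := cts_eps (cv x0) v20.
exists h => // x /andP[x1 x2]; have := hh x.
rewrite gtr0_norm; last by lra.
move=> /(_ ltac:(lra)) H.
have : `|sg * (v x - v x0)| <= sg * v x0 / 2 by rewrite normrM sg1 mul1r.
by rewrite ler_norml => /andP[]; lra.
Qed.

(** Let [x1] be the first point where [sg * v] fails to be positive. Before [x1] the profile moves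
    strictly away from [rho x0], and meets no zero because the slope would vanish there; so the
    energy estimate keeps [sg * v] above a fixed [k > 0] on the second half of the interval from
    [x0] to [x1], against continuity at [x1]. *)
Lemma ode_no_turn (R : realType) (W : R -> R) (eps : R) (rho v F : R -> R)
    (sg delta x0 l : R) :
  ode_profile W eps rho v F -> (forall y : R, derivable W y 1) -> W 0 = 0 ->
  0 < eps -> 0 < delta -> sg * sg = 1 -> 0 < rho x0 ->
  (forall c : R, x0 <= c <= x0 + l -> `|F c - F x0| <= delta / 2) ->
  (forall r : R, 0 <= r ->
     W (rho x0) + derive1 W (rho x0) * (r - rho x0) <= W r) ->
  delta <= sg * (Qp W (rho x0) - F x0) -> 0 <= sg * v x0 ->
  forall x : R, x0 < x <= x0 + l -> 0 < sg * v x.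
Proof.
move=> ode dW W00 eps0 d0 sg2 y0 HF tW dl v0 x /andP[x0x xl].
have [drho cv rge dB] := ode; have sg1 := norm_of_sqr1 sg2.
rewrite ltNge; apply/negP => vx.
have [h h0 hh] := ode_initial_direction ode eps0 d0 sg2 y0 dl v0.
pose P := [set u : R | x0 < u <= x /\ sg * v u <= 0].
have Px : P x by split => //; rewrite x0x lexx.
have lP : has_lbound P by exists x0 => u [/andP[/ltW]].
pose x1 := inf P.
have x1h : x0 + h <= x1.
  apply: lb_le_inf; first by exists x.
  move=> u [/andP[u1 u2]]; apply: contraTT; rewrite -!ltNge => uh.
  by apply: hh; rewrite u1.
have x1x : x1 <= x by exact: ge_inf.
have vpos u : x0 < u < x1 -> 0 < sg * v u.
  move=> /andP[u1 u2]; rewrite ltNge; apply/negP => vu.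
  suff : x1 <= u by lra.
  by apply: ge_inf => //; split=> //; rewrite u1; lra.
have vx1 : sg * v x1 <= 0.
  apply/ler_addgt0Pr => e e0; rewrite add0r.
  have [k k0 kk] := cts_eps (cv x1) e0.
  have [u /[dup] Pu' [_ Pu] ux1] := inf_adherent k0 (conj (ex_intro _ x Px) lP).
  have xu : x1 <= u by exact: ge_inf.
  have := kk u; rewrite ger0_norm ?subr_ge0 // => /(_ ltac:(rewrite -/x1 in ux1; lra)) H.
  have : `|sg * (v u - v x1)| <= e by rewrite normrM sg1 mul1r.
  by rewrite ler_norml => /andP[]; lra.
have rpos u : x0 <= u < x1 -> 0 < rho u.
  move=> /andP[]; rewrite le_eqVlt => /predU1P[<- //|u1] u2.
  rewrite lt_neqAle rge andbT; apply/eqP => /esym ru.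
  have := vpos u; rewrite u1 u2 => /(_ isT).
  by have [-> _] := ode_zero ode W00 ru; rewrite mulr0 ltxx.
have E u : x0 < u < x1 ->
  0 <= sg * (rho u / rho x0 - 1) /\
  delta * (sg * (rho u / rho x0 - 1)) <= eps ^+ 2 * (v u) ^+ 2.
  move=> /andP[u1 u2]; apply: (ode_energy ode dW eps0 sg2 u1) => // c /andP[c1 c2].
    by apply: rpos; rewrite c1; lra.
  by split; [apply/ltW/vpos; rewrite c1; lra|apply: HF; rewrite (ltW c1); lra].
pose x2 := (x0 + x1) / 2.
have x02 : x0 < x2 by rewrite /x2; lra.
have x21 : x2 < x1 by rewrite /x2; lra.
have incr a b : x0 <= a -> a < b -> b < x1 -> sg * rho a < sg * rho b.
  move=> a0 ab b1.
  have [c /andP[c1 c2] H] := mean_value ab (fun u _ => is_derive_cts (drho u)) (fun u _ => drho u).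
  rewrite -subr_gt0 -mulrBr H mulrA mulr_gt0 ?subr_gt0 //.
  by apply: vpos; apply/andP; split; lra.
have wE u : sg * (rho u / rho x0 - 1) = (sg * rho u - sg * rho x0) / rho x0.
  by field; rewrite gt_eqF.
pose w2 := sg * (rho x2 / rho x0 - 1).
have w20 : 0 < w2 by rewrite /w2 wE divr_gt0 // subr_gt0 incr.
pose k := Num.sqrt (delta * w2) / eps.
have k0 : 0 < k by rewrite divr_gt0 // sqrtr_gt0 mulr_gt0.
have kv u : x2 < u < x1 -> k <= sg * v u.
  move=> /andP[u1 u2].
  have u0 : x0 < u by lra.
  have vu : 0 < sg * v u by apply: vpos; rewrite u0.
  rewrite -(ler_pXn2r (_ : 0 < 2)%N) ?nnegrE ?(ltW k0) ?(ltW vu) //.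
  rewrite exprMn exprVn sqr_sqrtr; last by rewrite mulr_ge0 // ltW.
  rewrite exprMn [sg ^+ 2]expr2 sg2 mul1r ler_pdivrMr ?exprn_gt0 // mulrC.
  apply: le_trans (_ : delta * (sg * (rho u / rho x0 - 1)) <= _); last first.
    by rewrite [leRHS]mulrC; apply: (E u _).2; rewrite u0.
  rewrite mulrC ler_pM2l // /w2 !wE ler_pM2r ?invr_gt0 // lerD2r.
  by apply/ltW/incr => //; lra.
have k20 : 0 < k / 2 by lra.
have [m m0 mm] := cts_eps (cv x1) k20.
pose u := x1 - Num.min (m / 2) ((x1 - x2) / 2).
have mn0 : 0 < Num.min (m / 2) ((x1 - x2) / 2) by rewrite lt_min !divr_gt0 // subr_gt0.
have mn1 : Num.min (m / 2) ((x1 - x2) / 2) <= m / 2 by rewrite ge_min lexx.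
have mn2 : Num.min (m / 2) ((x1 - x2) / 2) <= (x1 - x2) / 2 by rewrite ge_min lexx orbT.
have := mm u; rewrite /u (_ : x1 - _ - x1 = - Num.min (m / 2) ((x1 - x2) / 2)); last by ring.
rewrite normrN gtr0_norm // => /(_ ltac:(lra)); rewrite -/u => H.
have : `|sg * (v u - v x1)| <= k / 2 by rewrite normrM sg1 mul1r.
have := kv u; rewrite /u => /(_ ltac:(clear - mn0 mn2 x21; apply/andP; split; lra)); rewrite -/u.
by rewrite ler_norml => ? /andP[]; lra.
Qed.

(* Along a solution that keeps moving away from the value [y = rho x0],
   [sqrt (sg * (rho / y - 1))] grows at least at rate
   [sqrt delta / (2 y eps)]. *)
Lemma ode_escape (R : realType) (W : R -> R) (eps : R) (rho v F : R -> R)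
    (sg delta x0 l M : R) :
  ode_profile W eps rho v F -> (forall y : R, derivable W y 1) -> W 0 = 0 ->
  (forall x : R, rho x <= M) ->
  0 < eps -> 0 < delta -> 0 < l -> sg * sg = 1 -> 0 < rho x0 ->
  (forall c : R, x0 <= c <= x0 + l -> `|F c - F x0| <= delta / 2) ->
  (forall r : R, 0 <= r ->
     W (rho x0) + derive1 W (rho x0) * (r - rho x0) <= W r) ->
  delta <= sg * (Qp W (rho x0) - F x0) -> 0 <= sg * v x0 ->
  l ^+ 2 * delta <= 4 * eps ^+ 2 * M ^+ 2.
Proof.
move=> ode dW W00 rM eps0 d0 l0 sg2 y0 HF tW dl v0.
have [drho cv rge dB] := ode; have sg1 := norm_of_sqr1 sg2.
have vpos := ode_no_turn ode dW W00 eps0 d0 sg2 y0 HF tW dl v0.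
have rpos u : x0 <= u <= x0 + l -> 0 < rho u.
  move=> /andP[]; rewrite le_eqVlt => /predU1P[<- //|u1] u2.
  rewrite lt_neqAle rge andbT; apply/eqP => /esym ru.
  have := vpos u; rewrite u1 u2 => /(_ isT).
  by have [-> _] := ode_zero ode W00 ru; rewrite mulr0 ltxx.
have incr a b : x0 <= a -> a < b -> b <= x0 + l -> sg * rho a < sg * rho b.
  move=> a0 ab b1.
  have [c /andP[c1 c2] H] := mean_value ab (fun u _ => is_derive_cts (drho u)) (fun u _ => drho u).
  rewrite -subr_gt0 -mulrBr H mulrA mulr_gt0 ?subr_gt0 //.
  by apply: vpos; apply/andP; split; lra.
have wE u : sg * (rho u / rho x0 - 1) = (sg * rho u - sg * rho x0) / rho x0.
  by field; rewrite gt_eqF.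
pose w u := sg * (rho u / rho x0 - 1).
have w0 u : x0 < u <= x0 + l -> 0 < w u.
  by move=> /andP[u1 u2]; rewrite /w wE divr_gt0 // subr_gt0 incr.
have dw (u : R) : is_derive u 1 w (sg * v u / rho x0).
  have -> : w = fun t => sg / rho x0 * rho t - sg.
    by apply/funext => t; rewrite /w; field; rewrite gt_eqF.
  apply: is_derive_eq (deriveB_fun (deriveZ_fun (sg / rho x0) (drho u)) (is_derive_cst sg u 1)) _.
  by field; rewrite gt_eqF.
have x0l : x0 < x0 + l by lra.
(* The square root is not differentiable at [w x0 = 0], but the mean value theorem asks for
   derivatives at interior points only. *)
have [c /[dup] cc /andP[c1 c2] H] : exists2 c : R, x0 < c < x0 + l &
    Num.sqrt (w (x0 + l)) - Num.sqrt (w x0) =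
    ((2 * Num.sqrt (w c))^-1 * (sg * v c / rho x0)) * ((x0 + l) - x0).
  apply: (@mean_value _ (fun t => Num.sqrt (w t))
    (fun c => (2 * Num.sqrt (w c))^-1 * (sg * v c / rho x0))) => // u.
    move=> _; apply: (@continuous_comp _ _ _ w Num.sqrt); last exact: sqrt_continuous.
    exact: is_derive_cts (dw u).
  move=> /andP[u1 u2]; have wu : 0 < w u by apply: w0; rewrite u1 ltW.
  exact: derive_comp_fun (is_derive1_sqrt wu) (dw u).
have wx0 : w x0 = 0 by rewrite /w divff ?gt_eqF // subrr mulr0.
have wc : 0 < w c by apply: w0; rewrite c1 ltW.
have vc : 0 < sg * v c by apply: vpos; rewrite c1 ltW.
have [_ E] := ode_energy ode dW eps0 sg2 c1
  (fun u H => rpos u ltac:(clear - H c1 c2; case/andP: H => ? ?; apply/andP; split; lra))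
  (fun u H => conj
     (ltW (vpos u ltac:(clear - H c1 c2; case/andP: H => ? ?; apply/andP; split; lra)))
     (HF u ltac:(clear - H c1 c2; case/andP: H => ? ?; apply/andP; split; lra))) tW dl.
have sE : Num.sqrt (w c) * Num.sqrt (delta) <= eps * (sg * v c).
  rewrite -sqrtrM ?(ltW wc) // -(ler_pXn2r (_ : 0 < 2)%N) ?nnegrE ?sqrtr_ge0 //; last first.
    by rewrite mulr_ge0 // ltW.
  rewrite sqr_sqrtr; last by rewrite mulr_ge0 // ltW.
  by rewrite !exprMn [sg ^+ 2]expr2 sg2 mul1r mulrC.
have sw : 0 < Num.sqrt (w c) by rewrite sqrtr_gt0.
have sd : 0 < Num.sqrt delta by rewrite sqrtr_gt0.
have wl : 0 < w (x0 + l) by apply: w0; rewrite x0l lexx.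
have L1 : l * Num.sqrt delta <= Num.sqrt (w (x0 + l)) * (2 * eps * rho x0).
  move: H; rewrite wx0 sqrtr0 subr0 (_ : x0 + l - x0 = l); last by ring.
  move=> ->.
  rewrite (_ : _ * (2 * eps * rho x0) = l * ((eps * (sg * v c)) / Num.sqrt (w c))); last first.
    by field; rewrite !gt_eqF.
  by rewrite ler_pM2l // ler_pdivlMr // mulrC.
have M0 : 0 < M by apply: lt_le_trans (rM x0).
have wM : w (x0 + l) * rho x0 <= M.
  rewrite /w wE divfK ?gt_eqF //.
  have A1 := rM (x0 + l); have A2 := rge (x0 + l); have A3 := rM x0.
  have : sg = 1 \/ sg = -1.
    have : (sg - 1) * (sg + 1) = 0.
      rewrite (_ : (sg - 1) * (sg + 1) = sg * sg - 1); last by ring.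
      by rewrite sg2 subrr.
    by move=> /eqP; rewrite mulf_eq0 => /orP[/eqP ?|/eqP ?]; [left|right]; lra.
  by case=> ->; lra.
have : (l * Num.sqrt delta) ^+ 2 <= (Num.sqrt (w (x0 + l)) * (2 * eps * rho x0)) ^+ 2.
  by rewrite ler_pXn2r // nnegrE ltW // !mulr_gt0 // sqrtr_gt0.
rewrite !exprMn !sqr_sqrtr; try exact: ltW.
move=> /le_trans; apply.
rewrite (_ : w (x0 + l) * _ = 4 * eps ^+ 2 * ((w (x0 + l) * rho x0) * rho x0)); last by ring.
apply: ler_wpM2l; first by rewrite mulr_ge0 // sqr_ge0.
by rewrite expr2; apply: ler_pM => //; apply: ltW => //; rewrite mulr_gt0.
Qed.

(** If [Qp W (rho x0) - F x0] had size [delta], the profile would run away from [rho x0], to the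
    right or to the left according to the sign of [v x0], over the whole length [l]; the smallness
    hypothesis is the negation of the bound on [l] that this implies. *)
Lemma ode_contact (R : realType) (W : R -> R) (eps : R) (rho v F : R -> R)
    (delta x0 l M : R) :
  ode_profile W eps rho v F -> (forall y : R, derivable W y 1) -> W 0 = 0 ->
  (forall x : R, rho x <= M) -> 0 < eps -> 0 < delta -> 0 < l ->
  (forall c : R, `|c - x0| <= l -> `|F c - F x0| <= delta / 2) ->
  4 * eps ^+ 2 * M ^+ 2 < l ^+ 2 * delta ->
  (0 < rho x0 -> forall r : R, 0 <= r ->
     W (rho x0) + derive1 W (rho x0) * (r - rho x0) <= W r) ->
  `|F x0 - Qp W (rho x0)| <= delta.
Proof.
move=> ode dW W00 rM eps0 d0 l0 HF small tW; have [_ _ rge _] := ode.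
have [y0|] := ltrP 0 (rho x0); last first.
  move=> r0; have rx0 : rho x0 = 0 by apply/eqP; rewrite eq_le rge r0.
  have [_ ->] := ode_zero ode W00 rx0.
  by rewrite rx0 /Qp mul0r W00 !subrr normr0 ltW.
have key sg : sg * sg = 1 -> sg * (Qp W (rho x0) - F x0) < delta.
  move=> sg2; rewrite ltNge; apply/negP => dl.
  have [v0|v0] := lerP 0 (sg * v x0).
    suff : l ^+ 2 * delta <= 4 * eps ^+ 2 * M ^+ 2 by lra.
    apply: (ode_escape ode dW W00 rM eps0 d0 l0 sg2 y0 _ (tW y0) dl v0) => c /andP[c1 c2].
    by apply: HF; rewrite ger0_norm; lra.
  (* When the profile moves in the unfavourable direction at [x0], it is followed backwards. *)
  suff : l ^+ 2 * delta <= 4 * eps ^+ 2 * M ^+ 2 by lra.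
  have ode' := ode_profile_opp ode.
  apply: (@ode_escape _ W eps _ _ _ sg delta (- x0) l M ode' dW W00 _ eps0 d0 l0 sg2);
    rewrite ?opprK //.
  - move=> c /andP[c1 c2]; apply: HF.
    by rewrite (_ : - c - x0 = - (c - - x0)); [rewrite normrN ger0_norm; lra|ring].
  - exact: tW.
  - by rewrite mulrN oppr_ge0 ltW.
have := key 1 ltac:(ring); have := key (-1) ltac:(ring) => ? ?.
by rewrite ler_norml; apply/andP; split; lra.
Qed.

(** A maximum principle: at a maximum [v] vanishes, and Q' > F there would make [rho] increase just
    to the right. *)
Lemma ode_max (R : realType) (W : R -> R) (eps : R) (rho v F : R -> R) (x0 : R) :
  ode_profile W eps rho v F -> 0 < eps -> 0 < rho x0 ->
  (forall x : R, rho x <= rho x0) -> Qp W (rho x0) <= F x0.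
Proof.
move=> ode eps0 y0 mx; have [drho cv rge dB] := ode.
have v0 : v x0 = 0.
  have : is_derive x0 1 (fun x => rho x0 - rho x) (0 - v x0).
    exact: deriveB_fun (is_derive_cst _ _ _) (drho x0).
  move=> /(@derive_at_zero_of_ge0 _ _ _ _ _ _) H.
  have : 0 - v x0 = 0 by apply: H; [move=> u; rewrite subr_ge0|rewrite subrr].
  by rewrite sub0r => /eqP; rewrite oppr_eq0 => /eqP.
rewrite leNgt; apply/negP => lt.
have d0 : 0 < Qp W (rho x0) - F x0 by rewrite subr_gt0.
have [||h h0 hh] := @ode_initial_direction _ W eps rho v F 1 _ x0 ode eps0 d0 (mulr1 1) y0.
- by rewrite mul1r.
- by rewrite v0 mulr0.
have xh : x0 < x0 + h / 2 by lra.
have [c /andP[c1 c2] H] := mean_value xh (fun u _ => is_derive_cts (drho u)) (fun u _ => drho u).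
have vc : 0 < 1 * v c by apply: hh; rewrite c1; lra.
have : 0 < v c * (x0 + h / 2 - x0) by rewrite mulr_gt0; lra.
by rewrite -H; have := mx (x0 + h / 2); lra.
Qed.

(** * Wasserstein distance and cumulative distribution functions *)

(** The marginal prescribed by [couplingT]: the half-open interval counts the seam 0 = 1 of the
    torus once. *)
Definition restricted_density (R : realType) (f : R -> R) : set R -> \bar R :=
  fun A => (\int[@lebesgue_measure R]_(x in A `&` `[0%R, 1%R[) (f x)%:E)%E.

Section DensityMeasure.
Context (R : realType) (f : R -> R) (df : densityT f).
Local Notation leb := (@lebesgue_measure R).

Let mf : measurable_fun setT f := df.2.1.
Let f0 x : 0 <= f x := df.2.2.1 x.

(** The proof of [densityT f] is an argument so that the measure and probability structures can be
    attached to this name. *)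
Definition density_measure of densityT f := restricted_density f.
Local Notation m := (density_measure df).

Let m0 : m set0 = 0%E.
Proof. by rewrite /density_measure /restricted_density set0I integral_set0. Qed.

Let m_ge0 A : (0 <= m A)%E.
Proof. by apply: integral_ge0 => x _; rewrite lee_fin. Qed.

Let m_sigma_additive : semi_sigma_additive m.
Proof.
move=> /= F mF tF mUF; apply: cvg_toP.
  apply: ereal_nondecreasing_is_cvgn => a b ab.
  by apply: lee_sum_nneg_natr => // k _ _; exact: m_ge0.
rewrite /density_measure /restricted_density setI_bigcupl ge0_integral_bigcup//=.
- by move=> i; apply: measurableI => //; exact: mF.
- by apply/measurable_EFinP; exact: measurable_funTS.
- by move=> x _; rewrite lee_fin.
- apply/trivIsetP => i j _ _ ij; move/trivIsetP : tF => /(_ i j Logic.I Logic.I ij).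
  by move=> H; rewrite setIACA H set0I.
Qed.

HB.instance Definition _ := isMeasure.Build _ _ _ m m0 m_ge0 m_sigma_additive.

Let m_setT : m [set: _] = 1%:E.
Proof.
rewrite /density_measure /restricted_density setTI -df.2.2.2 /intT.
by rewrite integral_itv_bndo_bndc //; apply/measurable_EFinP; exact: measurable_funTS.
Qed.

HB.instance Definition _ := @Measure_isProbability.Build _ _ R m m_setT.

Definition density_probability : probability R R := m.

End DensityMeasure.

(** A coupling exists, so [W2sq] is a finite infimum; otherwise [fine] would turn an infinite value
    into the distance 0. *)
Lemma product_coupling (R : realType) (mu nu : R -> R) :
  densityT mu -> densityT nu -> exists g, couplingT mu nu g.
Proof.
move=> dmu dnu.
pose P1 := density_probability dmu; pose P2 := density_probability dnu.
exists (P1 \x P2)%E; split=> A mA.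
- transitivity (P1 A * P2 setT)%E; first exact: product_measure1E.
  by rewrite probability_setT mule1.
- transitivity (P1 setT * P2 A)%E; first exact: product_measure1E.
  by rewrite probability_setT mul1e.
Qed.

Lemma distT_ge0_le1 (R : realType) (x y : R) : 0 <= distT x y <= 1.
Proof.
rewrite /distT; set d := x - y - _.
have d0 : 0 <= d by rewrite /d subr_ge0 floor_le.
have d1 : d < 1 by have := floorD1_gt (x - y); rewrite intrD1 /d; lra.
by rewrite le_min d0 subr_ge0 (ltW d1) ge_min (ltW d1).
Qed.

Section IntegralBounds.
Import HBNNSimple.

(** The integral is read as a supremum over simple functions, so that the squared torus distance can
    be integrated without a discussion of its measurability. *)
Lemma ge0_integral_ge_indic (d : measure_display) (T : measurableType d) (R : realType)
    (g : {measure set T -> \bar R}) (f : T -> R) (B : set T) (s : R) :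
  measurable B -> (forall z, 0 <= f z) -> 0 <= s -> (forall z, B z -> s <= f z) ->
  (s%:E * g B <= \int[g]_z (f z)%:E)%E.
Proof.
move=> mB f0 s0 sf; rewrite ge0_integralTE; last by move=> z; rewrite lee_fin.
apply: ereal_sup_ubound => /=.
exists (scale_nnsfun (indic_nnsfun R mB) s0).
  move=> z; rewrite lee_fin /= mindicE.
  by have [/set_mem Bz|_] := boolP (z \in B); rewrite ?mulr1 ?mulr0 //; exact: sf.
transitivity (sintegral g (cst s \* indic_nnsfun R mB)%R); first by [].
by rewrite sintegralrM; congr (_ * _)%E; exact: sintegral_indic.
Qed.

Lemma ge0_integral_le_cst (d : measure_display) (T : measurableType d) (R : realType)
    (g : probability T R) (f : T -> R) (s : R) :
  (forall z, 0 <= f z <= s) -> (\int[g]_z (f z)%:E <= s%:E)%E.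
Proof.
move=> f0; rewrite ge0_integralTE; last by move=> z; rewrite lee_fin; case/andP: (f0 z).
apply: ge_ereal_sup => _ [h hf <-].
rewrite -integralT_nnsfun.
apply: (@le_trans _ _ (\int[g]_z (cst s%:E) z)%E).
  apply: ge0_le_integral => //=.
  - by move=> z _; rewrite lee_fin; exact: fun_ge0.
  - exact/measurable_EFinP.
  - by move=> z _; apply: (le_trans (hf z)); rewrite lee_fin; case/andP: (f0 z).
by rewrite integral_cst //= probability_setT mule1.
Qed.

End IntegralBounds.

Lemma W2sq_lt_coupling (R : realType) (mu nu : R -> R) (e : R) :
  densityT mu -> densityT nu -> 0 < e -> `|d2 mu nu| < e ->
  exists g : probability (R * R)%type R, couplingT mu nu g /\
    (\int[g]_z ((distT z.1 z.2) ^+ 2)%:E < (e ^+ 2)%:E)%E.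
Proof.
move=> dmu dnu e0; rewrite /d2 ger0_norm ?sqrtr_ge0 // => H.
have W0 : (0 <= W2sq mu nu)%E.
  apply: le_ereal_inf_tmp => _ [g _ <-]; apply: integral_ge0 => z _.
  by rewrite lee_fin sqr_ge0.
have W1 : (W2sq mu nu <= 1%:E)%E.
  have [g cg] := product_coupling dmu dnu.
  apply: (@le_trans _ _ (\int[g]_z ((distT z.1 z.2) ^+ 2)%:E)%E).
    by apply: ereal_inf_lbound; exists g.
  apply: ge0_integral_le_cst => z; rewrite sqr_ge0 /=.
  by have /andP[? ?] := distT_ge0_le1 z.1 z.2; rewrite expr_le1.
have Wfin : W2sq mu nu \is a fin_num.
  by rewrite ge0_fin_numE // (le_lt_trans W1) // ltry.
have : (W2sq mu nu < (e ^+ 2)%:E)%E.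
  rewrite -(fineK Wfin) lte_fin -(sqr_sqrtr (fine_ge0 W0)).
  by rewrite ltr_pXn2r // nnegrE ?sqrtr_ge0 // ltW.
by move=> /ereal_inf_lt[_ [g cg <-] Hg]; exists g.
Qed.

Lemma distT_separated (R : realType) (a b s : R) :
  0 <= a < 1 -> 0 <= b < 1 -> s <= `|a - b| -> `|a - b| <= 1 - s -> s <= distT a b.
Proof.
move=> /andP[a0 a1] /andP[b0 b1]; rewrite /distT.
have [ab|ab] := lerP b a.
  rewrite (_ : Num.floor (a - b) = 0); last first.
    by apply: floor_def; rewrite add0r /=; apply/andP; split; lra.
  by rewrite subr0 => ? ?; rewrite le_min; apply/andP; split; lra.
rewrite (_ : Num.floor (a - b) = -1); last first.
  by apply: floor_def; rewrite addrC subrr mulrN1z mulr0z; apply/andP; split; lra.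
by rewrite mulrN1z => ? ?; rewrite le_min; apply/andP; split; lra.
Qed.

Definition cumul (R : realType) (f : R -> R) (x : R) : R :=
  \int[@lebesgue_measure R]_(t in `[0, x]) f t.

Lemma cumul0 (R : realType) (f : R -> R) : cumul f 0 = 0.
Proof. by rewrite /cumul set_itv1 Rintegral_set1. Qed.

Lemma cumulB (R : realType) (f : R -> R) (c a b : R) :
  (@lebesgue_measure R).-integrable `[0, c] (EFin \o f) ->
  0 <= a -> a <= b -> b <= c ->
  cumul f b - cumul f a = \int[@lebesgue_measure R]_(t in `]a, b]) f t.
Proof.
move=> fi a0 ab bc; rewrite /cumul.
have fi' : (@lebesgue_measure R).-integrable `[0, b] (EFin \o f).
  apply: integrableS fi => //; apply: subset_itvl; rewrite bnd_simp; lra.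
by rewrite (@Rintegral_itvB _ f (BLeft 0) (BRight b) a fi').
Qed.

Lemma density_integrable (R : realType) (f : R -> R) : densityT f ->
  (@lebesgue_measure R).-integrable `[0, 1] (EFin \o f).
Proof.
move=> [_ [mf [f0 f1]]]; apply/integrableP; split.
  by apply/measurable_EFinP; exact: measurable_funTS.
have -> : (\int[@lebesgue_measure R]_(x in `[0%R, 1%R]) `|(EFin \o f) x|)%E = intT f.
  by apply: eq_integral => x _; rewrite /= ger0_norm.
by rewrite f1 ltry.
Qed.

Lemma cumul_EFin (R : realType) (f : R -> R) (x : R) :
  (@lebesgue_measure R).-integrable `[0, x] (EFin \o f) ->
  (cumul f x)%:E = (\int[@lebesgue_measure R]_(t in `[0%R, x]) (f t)%:E)%E.
Proof. by move=> fi; rewrite /cumul /Rintegral fineK //; exact: integrable_fin_num. Qed.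

Lemma cumul_density1 (R : realType) (f : R -> R) : densityT f -> cumul f 1 = 1.
Proof. by move=> [_ [_ [_ f1]]]; rewrite /cumul /Rintegral [X in fine X]f1. Qed.

(** Mass of [nu] in [A] either comes from mass of [mu] outside [C] or is carried from [C] to [A]
    over a distance at least [s]; Chebyshev's inequality bounds the second part by [e / s ^+ 2]. *)
Lemma coupling_compare (R : realType) (mu nu : R -> R) (g : probability (R * R)%type R)
    (A C : set R) (e s : R) :
  couplingT mu nu g ->
  (\int[g]_z ((distT z.1 z.2) ^+ 2)%:E <= e%:E)%E ->
  measurable A -> measurable C -> 0 < s ->
  (forall a c, 0 <= a < 1 -> A a -> 0 <= c < 1 -> C c -> s <= distT c a) ->
  (restricted_density nu A <= restricted_density mu (~` C) + (e / s ^+ 2)%:E)%E.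
Proof.
move=> [gmu gnu] ge mA mC s0 sep.
pose I := `[0 : R, 1[%classic.
have mI : measurable I by exact: measurable_itv.
pose D := ~` (C `&` I); pose B := (C `&` I) `*` (A `&` I).
have mCI : measurable (C `&` I) by exact: measurableI.
have mAI : measurable (A `&` I) by exact: measurableI.
have mD : measurable D by exact: measurableC.
have mB : measurable B by exact: measurableX.
have -> : restricted_density nu A = g (setT `*` (A `&` I)).
  by rewrite gnu // /restricted_density -setIA setIid.
have -> : restricted_density mu (~` C) = g (D `*` setT).
  rewrite gmu // /restricted_density; congr (integral _ _ _).
  apply/seteqP; split => x /= [].
    by move=> nC xI; split => // -[].
  by move=> nCI xI; split => // Cx; apply: nCI.
have sB : ((s ^+ 2)%:E * g B <= e%:E)%E.
  apply: le_trans ge; apply: (@ge0_integral_ge_indic _ _ _ g (fun z => (distT z.1 z.2) ^+ 2)) => //.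
  - by move=> z; exact: sqr_ge0.
  - exact: sqr_ge0.
  move=> [c a] [/= [Cc Ic] [Aa Ia]]; rewrite ler_pXn2r ?nnegrE ?(ltW s0) //.
    by apply: sep.
  by have /andP[] := distT_ge0_le1 c a.
have gB : (g B <= (e / s ^+ 2)%:E)%E.
  rewrite -(@lee_pmul2l _ (s ^+ 2)%:E) ?fin_numE // ?lte_fin ?exprn_gt0 //.
  by rewrite -EFinM mulrC divfK // gt_eqF // exprn_gt0.
apply: (@le_trans _ _ (g (D `*` setT `|` B))%E).
  apply: le_measure; rewrite ?inE.
  - exact: measurableX.
  - by apply: measurableU => //; exact: measurableX.
  - move=> [c a] /= [_ Aa]; have [CIc|nCI] := pselect ((C `&` I) c); [right|left] => //.
apply: (@le_trans _ _ (g (D `*` setT) + g B)%E); last by rewrite leeD2l.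
by apply: measureU2 => //; exact: measurableX.
Qed.

Lemma restricted_densityE (R : realType) (f : R -> R) (D : set R) :
  measurable_fun setT f -> measurable D -> D `<=` `[0, 1] ->
  restricted_density f D = (\int[@lebesgue_measure R]_(t in D) (f t)%:E)%E.
Proof.
move=> mf mD D1; rewrite /restricted_density -[RHS](@integral_setD1 _ _ 1); last 2 first.
  - exact: measurableD.
  - by apply/measurable_EFinP; exact: measurable_funTS.
congr (integral _ _ _); apply/seteqP; split => t /=.
  by rewrite in_itv /= => -[Dt /andP[t0 t1]]; split => // E; move: t1; rewrite E ltxx.
move=> [Dt /eqP t1]; split => //; move/D1: Dt; rewrite /= !in_itv /= => /andP[-> tle].
by rewrite lt_neqAle t1 tle.
Qed.

Lemma integral_le_bounded (R : realType) (f : R -> R) (M a b : R) (ba bb : bool) :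
  measurable_fun setT f -> (forall x, 0 <= f x <= M) -> a <= b ->
  (\int[@lebesgue_measure R]_(x in [set` Interval (BSide ba a) (BSide bb b)]) (f x)%:E
     <= (M * (b - a))%:E)%E.
Proof.
move=> mf fM ab.
apply: (@le_trans _ _
  (\int[@lebesgue_measure R]_(x in [set` Interval (BSide ba a) (BSide bb b)]) (cst M%:E) x)%E).
  apply: ge0_le_integral => //=.
  - by move=> x _; rewrite lee_fin; case/andP: (fM x).
  - by apply/measurable_EFinP; exact: measurable_funTS.
  - by move=> x _; rewrite lee_fin; case/andP: (fM x).
rewrite integral_cst //= lebesgue_measure_itv /= lte_fin.
case: ltP => ab'; first by rewrite EFinM -EFinB.
by rewrite mule0 lee_fin mulr_ge0 ?subr_ge0 //; case/andP: (fM 0) => /le_trans; apply.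
Qed.

(** Mass that [nu] has in [0, x] comes from the mass of [mu] there, from two strips of width [s],
    one next to [x] and one next to the seam of the torus, or from a distance at least [s]. Each
    strip has [mu]-mass at most [s * M]. The same comparison on ]x, 1] gives the reverse
    inequality. *)
Lemma W2_cumul (R : realType) (mu nu : R -> R) (M e s x : R) :
  densityT mu -> densityT nu -> (forall y, mu y <= M) -> 0 < e -> 0 < s ->
  0 <= x <= 1 -> `|d2 mu nu| < e ->
  `|cumul mu x - cumul nu x| <= 2 * s * M + e ^+ 2 / s ^+ 2.
Proof.
move=> dmu dnu muM e0 s0 /andP[x0 x1] /(W2sq_lt_coupling dmu dnu e0) [g [cg /ltW ge]].
pose leb := @lebesgue_measure R.
have fmu := density_integrable dmu; have fnu := density_integrable dnu.
have [_ [mmu [mu0 mu1]]] := dmu; have [_ [mnu [nu0 nu1]]] := dnu.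
have bmu y : 0 <= mu y <= M by rewrite mu0 muM.
have emmu (D : set R) : measurable_fun D (fun y => (mu y)%:E).
  by apply/measurable_EFinP; exact: measurable_funTS.
have emnu (D : set R) : measurable_fun D (fun y => (nu y)%:E).
  by apply/measurable_EFinP; exact: measurable_funTS.
have fmux : leb.-integrable `[0, x] (EFin \o mu).
  by apply: integrableS fmu => //; apply: subset_itvl; rewrite bnd_simp.
have fnux : leb.-integrable `[0, x] (EFin \o nu).
  by apply: integrableS fnu => //; apply: subset_itvl; rewrite bnd_simp.
have fmux1 : leb.-integrable `]x, 1] (EFin \o mu).
  by apply: integrableS fmu => //; apply: subset_itvr; rewrite bnd_simp.
have fnux1 : leb.-integrable `]x, 1] (EFin \o nu).
  by apply: integrableS fnu => //; apply: subset_itvr; rewrite bnd_simp.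
pose J (a : R) := `[a, a + s]%classic.
have mJ a : measurable (J a) by exact: measurable_itv.
have split3 (C P : set R) (a b : R) : measurable C -> measurable P ->
    ~` C `&` `[0, 1[ `<=` P `|` (J a `|` J b) ->
    (restricted_density mu (~` C) <= \int[leb]_(t in P) (mu t)%:E + (2 * s * M)%:E)%E.
  move=> mC mP sub.
  apply: (@le_trans _ _ (\int[leb]_(t in P `|` (J a `|` J b)) (mu t)%:E)%E).
    apply: ge0_subset_integral => //.
    - by apply: measurableI => //; exact: measurableC.
    - exact: (measurableU _ _ mP (measurableU _ _ (mJ a) (mJ b))).
    - exact: emmu.
    - by move=> t _; rewrite lee_fin.
  have U (A B : set R) : measurable A -> measurable B ->
    (\int[leb]_(t in A `|` B) (mu t)%:E <=
     \int[leb]_(t in A) (mu t)%:E + \int[leb]_(t in B) (mu t)%:E)%E.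
    move=> mA mB; have -> : A `|` B = A `|` (B `\` A).
      apply/seteqP; split => t; last by case=> [|[]]; [left|right].
      by have [At _|nAt] := pselect (A t); [left|case=> [|Bt]; [left|right]].
    rewrite ge0_integral_setU //=; last 4 first.
    - exact: measurableD.
    - exact: emmu.
    - by move=> t _; rewrite lee_fin.
    - by apply/disj_set2P/seteqP; split=> // t [] ? [].
    apply: leeD => //; apply: ge0_subset_integral => //.
    - exact: measurableD.
    - exact: emmu.
    - by move=> t _; rewrite lee_fin.
  apply: (le_trans (U _ _ mP (measurableU _ _ (mJ a) (mJ b)))).
  apply: leeD => //; apply: (le_trans (U _ _ (mJ a) (mJ b))) => //.
  rewrite (_ : 2 * s * M = M * (a + s - a) + M * (b + s - b)); last by ring.
  by rewrite EFinD; apply: leeD; apply: integral_le_bounded => //; lra.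
have fE f D : leb.-integrable D (EFin \o f) -> measurable D ->
    (\int[leb]_(t in D) f t)%:E = (\int[leb]_(t in D) (f t)%:E)%E.
  by move=> fi mD; rewrite /Rintegral fineK //; exact: integrable_fin_num.
have U1 : cumul nu x <= cumul mu x + 2 * s * M + e ^+ 2 / s ^+ 2.
  have := coupling_compare (A := `[0, x]) (C := `[x + s, 1 - s]) cg ge.
  move=> /(_ s) H; have {}H := H ltac:(by []) ltac:(by []) s0.
  have Hsep a c : 0 <= a < 1 -> `[0, x]%classic a -> 0 <= c < 1 ->
      `[x + s, 1 - s]%classic c -> s <= distT c a.
    rewrite /= !in_itv /= => a01 /andP[a0 ax] c01 /andP[c1 c2].
    by clear - s0 a01 a0 ax c01 c1 c2; apply: distT_separated => //; rewrite ger0_norm; lra.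
  have {}H := H Hsep.
  have sub : ~` `[x + s, 1 - s] `&` `[0, 1[ `<=` `[0, x] `|` (J x `|` J (1 - s)).
    move=> t /= [/negP]; rewrite /J /= !in_itv /= negb_and -!ltNge => nt /andP[t0 t1].
    have [tx|tx] := lerP t x; [left|right]; first by rewrite t0.
    by clear - nt t0 t1 tx; case/orP: nt => nt; [left|right]; apply/andP; split; lra.
  have {}H := le_trans H (leeD (split3 _ _ _ _ (measurable_itv _) (measurable_itv _) sub)
    (lexx (e ^+ 2 / s ^+ 2)%:E)).
  have E1 : restricted_density nu `[0, x] = (cumul nu x)%:E.
    rewrite restricted_densityE //; first by rewrite cumul_EFin.
    by apply: subset_itvl; rewrite bnd_simp.
  by move: H; rewrite E1 -(fE _ _ fmux) // -!EFinD lee_fin.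
have U2 : 1 - cumul nu x <= 1 - cumul mu x + 2 * s * M + e ^+ 2 / s ^+ 2.
  have := coupling_compare (A := `]x, 1]) (C := `[s, x - s]) cg ge.
  move=> /(_ s) H; have {}H := H ltac:(by []) ltac:(by []) s0.
  have Hsep a c : 0 <= a < 1 -> `]x, 1]%classic a -> 0 <= c < 1 ->
      `[s, x - s]%classic c -> s <= distT c a.
    rewrite /= !in_itv /= => a01 /andP[a0 ax] c01 /andP[c1 c2].
    by clear - s0 a01 a0 ax c01 c1 c2; apply: distT_separated => //; rewrite ler0_norm; lra.
  have {}H := H Hsep.
  have sub : ~` `[s, x - s] `&` `[0, 1[ `<=` `]x, 1] `|` (J 0 `|` J (x - s)).
    move=> t /= [/negP]; rewrite /J /= !in_itv /= negb_and -!ltNge => nt /andP[t0 t1].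
    have [tx|tx] := lerP t x; [right|left]; last by rewrite ltW.
    by clear - nt t0 t1 tx; case/orP: nt => nt; [left|right]; apply/andP; split; lra.
  have {}H := le_trans H (leeD (split3 _ _ _ _ (measurable_itv _) (measurable_itv _) sub)
    (lexx (e ^+ 2 / s ^+ 2)%:E)).
  have E1 : restricted_density nu `]x, 1] = (1 - cumul nu x)%:E.
    rewrite restricted_densityE //; last by apply: subset_itvr; rewrite bnd_simp.
    rewrite -(fE _ _ fnux1) //; congr EFin.
    by rewrite -(cumulB fnu x0 x1 (lexx 1)) cumul_density1.
  have E2 : (\int[leb]_(t in `]x, 1%R]) (mu t)%:E)%E = (1 - cumul mu x)%:E.
    rewrite -(fE _ _ fmux1) //; congr EFin.
    by rewrite -(cumulB fmu x0 x1 (lexx 1)) cumul_density1.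
  by move: H; rewrite E1 E2 -!EFinD lee_fin.
by rewrite ler_norml; apply/andP; split; lra.
Qed.

(** * Dyadic difference quotients *)

Definition dyadic (R : realType) (n i : nat) : R := i%:R / (2 ^ n)%:R.

Lemma dyadic0 (R : realType) (n : nat) : dyadic R n 0 = 0.
Proof. by rewrite /dyadic mul0r. Qed.

Lemma pow2_gt0 (R : realType) (n : nat) : 0 < (2 ^ n)%:R :> R.
Proof. by rewrite ltr0n expn_gt0. Qed.

Lemma dyadic1 (R : realType) (n : nat) : dyadic R n (2 ^ n) = 1.
Proof. by rewrite /dyadic divff // gt_eqF // pow2_gt0. Qed.

Lemma dyadic_lt (R : realType) (n i j : nat) :
  (dyadic R n i < dyadic R n j) = (i < j)%N.
Proof. by rewrite /dyadic ltr_pM2r ?invr_gt0 ?pow2_gt0 // ltr_nat. Qed.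

Lemma dyadic_le (R : realType) (n i j : nat) :
  (dyadic R n i <= dyadic R n j) = (i <= j)%N.
Proof. by rewrite /dyadic ler_pM2r ?invr_gt0 ?pow2_gt0 // ler_nat. Qed.

Lemma dyadic_ge0 (R : realType) (n i : nat) : 0 <= dyadic R n i.
Proof. by rewrite -(dyadic0 R n) dyadic_le. Qed.

Lemma dyadic_le1 (R : realType) (n i : nat) : (i <= 2 ^ n)%N -> dyadic R n i <= 1.
Proof. by move=> H; rewrite -(dyadic1 R n) dyadic_le. Qed.

Lemma dyadic_refine (R : realType) (n k i : nat) :
  dyadic R (n + k) (i * 2 ^ k) = dyadic R n i.
Proof.
rewrite /dyadic expnD !natrM -mulf_div [X in _ * X]divff ?mulr1 //.
Qed.

Definition dyadic_incr (R : realType) (G : R -> R) (n i : nat) : R :=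
  G (dyadic R n i.+1) - G (dyadic R n i).

(** A coefficient that is constant on the blocks of length [2 ^ k] sees only the coarse increments,
    since the fine ones telescope. *)
Lemma dyadic_block (R : realType) (A : nat -> R) (G : R -> R) (n k : nat) :
  \sum_(0 <= j < 2 ^ (n + k)) A (j %/ 2 ^ k)%N * dyadic_incr G (n + k) j =
  \sum_(0 <= i < 2 ^ n) A i * dyadic_incr G n i.
Proof.
rewrite expnD big_nat_mul; apply: eq_big_nat => i _.
have k0 : (0 < 2 ^ k)%N by rewrite expn_gt0.
transitivity (A i * \sum_(i * 2 ^ k <= j < i.+1 * 2 ^ k) dyadic_incr G (n + k) j).
  rewrite big_distrr /=; apply: eq_big_nat => j /andP[j1 j2].
  by congr (A _ * _); apply/eqP; rewrite eqn_leq leq_divRL // j1 andbT -ltnS ltn_divLR.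
congr (A i * _); rewrite /dyadic_incr.
rewrite (telescope_sumr (fun j => G (dyadic R (n + k) j))); last by rewrite leq_mul2r leqnSn orbT.
by rewrite !dyadic_refine.
Qed.

(** Cells open on the left match the increments of [cumul]; they cover ]0, 1] and leave the value 0
    at 0. *)
Definition dyadic_step (R : realType) (a : nat -> R) (n : nat) (x : R) : R :=
  \sum_(0 <= i < 2 ^ n) a i * \1_(`]dyadic R n i, dyadic R n i.+1]) x.

Lemma measurable_dyadic_step (R : realType) (a : nat -> R) (n : nat) :
  measurable_fun setT (dyadic_step a n).
Proof.
apply: measurable_sum => i; apply: measurable_funM; first exact: measurable_cst.
exact: measurable_indic.
Qed.

Lemma dyadic_step_val (R : realType) (a : nat -> R) (n j : nat) (x : R) :
  (j < 2 ^ n)%N -> dyadic R n j < x <= dyadic R n j.+1 -> dyadic_step a n x = a j.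
Proof.
move=> jn /andP[x1 x2]; rewrite /dyadic_step big_mkord (bigD1 (Ordinal jn)) //=.
rewrite indicE mem_set /= ?in_itv /= ?x1 ?x2 // mulr1 big1 ?addr0 // => i ij.
rewrite indicE memNset ?mulr0 //= in_itv /= => /andP[i1 i2].
case/eqP: ij; apply/val_inj => /=; apply/eqP; rewrite eqn_leq -!(@ltnS _ j) -!(@ltnS j).
rewrite -!(dyadic_lt R n) (lt_le_trans i1 x2).
by rewrite (lt_le_trans x1 i2).
Qed.

Lemma dyadic_step0 (R : realType) (a : nat -> R) (n : nat) : dyadic_step a n 0 = 0.
Proof.
rewrite /dyadic_step big1 // => i _.
rewrite indicE memNset ?mulr0 //= in_itv /= => /andP[].
by rewrite ltNge dyadic_ge0.
Qed.

Lemma dyadic_locate (R : realType) (n : nat) (x : R) : 0 < x <= 1 ->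
  exists2 j : nat, (j < 2 ^ n)%N & dyadic R n j < x <= dyadic R n j.+1.
Proof.
move=> /andP[x0 x1].
have H : exists j, x <= dyadic R n j by exists (2 ^ n)%N; rewrite dyadic1.
have [j xj jmin] := ex_minnP H.
case: j xj jmin => [|j] xj jmin; first by move: xj; rewrite dyadic0 leNgt x0.
exists j; first by apply: jmin; rewrite dyadic1.
by rewrite xj andbT ltNge; apply/negP => /jmin; rewrite ltnn.
Qed.

Lemma integrable_sub01 (R : realType) (f : R -> R) (b : R) : b <= 1 ->
  (@lebesgue_measure R).-integrable `[0, 1] (EFin \o f) ->
  (@lebesgue_measure R).-integrable `[0, b] (EFin \o f).
Proof.
by move=> b1 fi; apply: integrableS fi => //; apply: subset_itvl; rewrite bnd_simp.
Qed.

(** One statement for three uses: the approximate derivative, its energy density, and the distance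
    of two approximations are all of the form step function times [rho]. *)
Lemma dyadic_integral (R : realType) (a : nat -> R) (n : nat) (rho phi : R -> R) :
  (@lebesgue_measure R).-integrable `[0, 1] (EFin \o rho) ->
  measurable_fun setT phi -> phi 0 = 0 ->
  (forall i x, (i < 2 ^ n)%N -> dyadic R n i < x <= dyadic R n i.+1 ->
     phi x = a i * rho x) ->
  (@lebesgue_measure R).-integrable `[0, 1] (EFin \o phi) /\
  forall j, (j <= 2 ^ n)%N ->
    cumul phi (dyadic R n j) = \sum_(0 <= i < j) a i * dyadic_incr (cumul rho) n i.
Proof.
move=> irho mphi phi0 E.
have iphi : (@lebesgue_measure R).-integrable `[0, 1] (EFin \o phi).
  pose A := \sum_(0 <= i < 2 ^ n) `|a i|.
  have iA : (@lebesgue_measure R).-integrable `[0, 1] (fun x => A%:E * (EFin \o rho) x)%E.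
    exact: integrableZl.
  apply: le_integrable iA => //; first by apply/measurable_EFinP; exact: measurable_funTS.
  move=> x; rewrite /= in_itv /= => /andP[x0 x1].
  move: x0; rewrite le_eqVlt => /predU1P[<-|x0]; first by rewrite phi0 normr0 lee_fin.
  have x01 : 0 < x <= 1 by rewrite x0.
  have [j jn xj] := dyadic_locate n x01.
  rewrite (E j x jn xj) lee_fin !normrM ler_wpM2r // [leRHS]ger0_norm; last first.
    by rewrite /A; apply: sumr_ge0.
  rewrite /A big_mkord (bigD1 (Ordinal jn)) //= lerDl.
  exact: sumr_ge0.
split=> //; elim=> [|j IH] jn; first by rewrite dyadic0 cumul0 big_nil.
rewrite big_nat_recr //= -IH ?(ltnW jn) // addrC; apply/eqP; rewrite -subr_eq; apply/eqP.
have dj := dyadic_ge0 R n j; have dd : dyadic R n j <= dyadic R n j.+1 by rewrite dyadic_le.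
have d1 := dyadic_le1 R jn.
rewrite (cumulB iphi dj dd d1) /dyadic_incr (cumulB irho dj dd d1).
rewrite -RintegralZl //; last first.
  by apply: integrableS irho => //; apply: subset_itv; rewrite bnd_simp.
by apply: eq_Rintegral => x; rewrite inE /= in_itv /=; exact: E.
Qed.

Definition dyadic_quot (R : realType) (q c : R -> R) (n i : nat) : R :=
  dyadic_incr q n i / dyadic_incr c n i.

(** The sum of (dq)^2 / dc over the cells, that is, the squared L^2(dc) norm of the step function of
    difference quotients. *)
Definition dyadic_energy (R : realType) (q c : R -> R) (n : nat) : R :=
  \sum_(0 <= i < 2 ^ n) dyadic_quot q c n i * dyadic_incr q n i.

(** Absolute continuity of dq with respect to dc, tested on dyadic cells; it makes the convention x
    / 0 = 0 in [dyadic_quot] harmless. *)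
Definition dyadic_ac (R : realType) (q c : R -> R) : Prop :=
  forall n i, (i < 2 ^ n)%N -> dyadic_incr c n i = 0 -> dyadic_incr q n i = 0.

Lemma dyadic_quotK (R : realType) (q c : R -> R) (n i : nat) :
  dyadic_ac q c -> (i < 2 ^ n)%N ->
  dyadic_quot q c n i * dyadic_incr c n i = dyadic_incr q n i.
Proof.
move=> ac iN; rewrite /dyadic_quot.
have [c0|c0] := eqVneq (dyadic_incr c n i) 0; last by rewrite divfK.
by rewrite c0 mulr0 ac.
Qed.

Lemma dyadic_energyE (R : realType) (q c : R -> R) (n : nat) :
  dyadic_ac q c ->
  dyadic_energy q c n =
  \sum_(0 <= i < 2 ^ n) (dyadic_quot q c n i) ^+ 2 * dyadic_incr c n i.
Proof.
by move=> ac; apply: eq_big_nat => i iN; rewrite expr2 -mulrA dyadic_quotK.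
Qed.

(** Pythagoras for the martingale of quotients: by [dyadic_block] the mixed term equals the coarse
    energy. *)
Lemma dyadic_energyB (R : realType) (q c : R -> R) (n k : nat) :
  dyadic_ac q c ->
  \sum_(0 <= j < 2 ^ (n + k))
    (dyadic_quot q c (n + k) j - dyadic_quot q c n (j %/ 2 ^ k)) ^+ 2 * dyadic_incr c (n + k) j
  = dyadic_energy q c (n + k) - dyadic_energy q c n.
Proof.
move=> ac.
have E1 := dyadic_block (fun i => (dyadic_quot q c n i) ^+ 2) c n k.
have E2 := dyadic_block (fun i => dyadic_quot q c n i) q n k.
rewrite -(dyadic_energyE n ac) in E1.
rewrite -[X in _ = X]/(dyadic_energy q c n) in E2.
transitivity (\sum_(0 <= j < 2 ^ (n + k))
   ((dyadic_quot q c (n + k) j) ^+ 2 * dyadic_incr c (n + k) j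
   + (dyadic_quot q c n (j %/ 2 ^ k)) ^+ 2 * dyadic_incr c (n + k) j
   - (dyadic_quot q c n (j %/ 2 ^ k) * dyadic_incr q (n + k) j
      + dyadic_quot q c n (j %/ 2 ^ k) * dyadic_incr q (n + k) j))).
  apply: eq_big_nat => j jN; rewrite -{1 2}(dyadic_quotK ac jN) //; ring.
rewrite sumrB !big_split /= E1 E2 -dyadic_energyE //; ring.
Qed.

(** The quotient dq / dc averaged over each cell, times [rho]: the approximation of q_x at level
    [n]. *)
Definition dyadic_deriv (R : realType) (q rho : R -> R) (n : nat) (x : R) : R :=
  dyadic_step (dyadic_quot q (cumul rho) n) n x * rho x.

Section DyadicDerivative.
Context (R : realType) (q rho : R -> R).
Context (mrho : measurable_fun setT rho) (rho0 : forall x, 0 <= rho x).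
Context (irho : (@lebesgue_measure R).-integrable `[0, 1] (EFin \o rho)).
Context (ac : dyadic_ac q (cumul rho)).
Local Notation leb := (@lebesgue_measure R).
Local Notation f := (dyadic_deriv q rho).
Local Notation energy := (dyadic_energy q (cumul rho)).

Lemma measurable_dyadic_deriv n : measurable_fun setT (f n).
Proof. by apply: measurable_funM => //; exact: measurable_dyadic_step. Qed.

Lemma dyadic_deriv0 n : f n 0 = 0.
Proof. by rewrite /dyadic_deriv dyadic_step0 mul0r. Qed.

Lemma dyadic_deriv_integral n : leb.-integrable `[0, 1] (EFin \o f n) /\
  forall j, (j <= 2 ^ n)%N -> cumul (f n) (dyadic R n j) = q (dyadic R n j) - q 0.
Proof.
have [||i x iN xi|H1 H2] := @dyadic_integral _ (dyadic_quot q (cumul rho) n) n rho (f n) irho.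
- exact: measurable_dyadic_deriv.
- exact: dyadic_deriv0.
- by rewrite /dyadic_deriv (dyadic_step_val _ iN xi).
split=> // j jN; rewrite H2 //.
transitivity (\sum_(0 <= i < j) dyadic_incr q n i).
  apply: eq_big_nat => i /andP[_ ij]; rewrite dyadic_quotK //.
  exact: leq_trans ij jN.
rewrite /dyadic_incr (telescope_sumr (fun j => q (dyadic R n j))) //.
by rewrite dyadic0.
Qed.

Lemma dyadic_deriv_integral_refine n k i : (i <= 2 ^ n)%N ->
  cumul (f (n + k)) (dyadic R n i) = q (dyadic R n i) - q 0.
Proof.
move=> iN; rewrite -(dyadic_refine R n k i).
apply: (dyadic_deriv_integral (n + k)).2.
by rewrite expnD leq_mul2r iN orbT.
Qed.

Lemma dyadic_deriv_energy n :
  leb.-integrable `[0, 1] (EFin \o (fun x => rho x * (f n x / rho x) ^+ 2)) /\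
  cumul (fun x => rho x * (f n x / rho x) ^+ 2) 1 = energy n.
Proof.
have E x : rho x * (f n x / rho x) ^+ 2 =
    (dyadic_step (dyadic_quot q (cumul rho) n) n x) ^+ 2 * rho x.
  rewrite /dyadic_deriv; have [->|r0] := eqVneq (rho x) 0; first by rewrite mul0r mulr0.
  by rewrite mulfK // mulrC.
have [||i x iN xi|H1 H2] := @dyadic_integral _ (fun i => (dyadic_quot q (cumul rho) n i) ^+ 2) n rho
  (fun x => rho x * (f n x / rho x) ^+ 2) irho.
- rewrite (_ : (fun x => _) =
    (fun x => (dyadic_step (dyadic_quot q (cumul rho) n) n x) ^+ 2 * rho x)); last first.
    by apply/funext.
  apply: measurable_funM => //; apply: measurable_funX.
  exact: measurable_dyadic_step.
- by rewrite dyadic_deriv0 mul0r expr0n mulr0.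
- by rewrite E (dyadic_step_val _ iN xi).
split=> //; rewrite -(dyadic1 R n) H2 //.
by rewrite dyadic_energyE.
Qed.

Lemma dyadic_deriv_dist n k (s : R) : 0 < s ->
  leb.-integrable `[0, 1] (EFin \o (fun x => `|f (n + k) x - f n x|)) /\
  cumul (fun x => `|f (n + k) x - f n x|) 1 <=
    (s^-1 * (energy (n + k) - energy n) + s * cumul rho 1) / 2.
Proof.
move=> s0.
pose a j := `|dyadic_quot q (cumul rho) (n + k) j - dyadic_quot q (cumul rho) n (j %/ 2 ^ k)|.
have [||i x iN xi|H1 H2] := @dyadic_integral _ a (n + k) rho
  (fun x => `|f (n + k) x - f n x|) irho.
- apply: measurableT_comp => //.
  by apply: measurable_funB; exact: measurable_dyadic_deriv.
- by rewrite !dyadic_deriv0 subrr normr0.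
- rewrite /dyadic_deriv (dyadic_step_val _ iN xi).
  have k0 : (0 < 2 ^ k)%N by rewrite expn_gt0.
  have iN' : (i %/ 2 ^ k < 2 ^ n)%N by rewrite ltn_divLR // -expnD.
  have xi' : dyadic R n (i %/ 2 ^ k) < x <= dyadic R n (i %/ 2 ^ k).+1.
    case/andP: xi => x1 x2; rewrite -!(dyadic_refine R n k); apply/andP; split.
      by apply: le_lt_trans x1; rewrite dyadic_le leq_divM.
    by apply: (le_trans x2); rewrite dyadic_le -ltn_divLR.
  by rewrite (dyadic_step_val _ iN' xi') -mulrBl normrM (ger0_norm (rho0 x)).
split=> //; rewrite -{1}(dyadic1 R (n + k)) H2 // -(dyadic_energyB n k ac).
have -> : cumul rho 1 = \sum_(0 <= j < 2 ^ (n + k)) dyadic_incr (cumul rho) (n + k) j.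
  rewrite /dyadic_incr (telescope_sumr (fun j => cumul rho (dyadic R (n + k) j))) //.
  by rewrite dyadic1 dyadic0 cumul0 subr0.
rewrite ler_pdivlMr // mulr_suml !mulr_sumr -big_split /=.
apply: ler_sum_nat => j /andP[_ jN].
have c0 : 0 <= dyadic_incr (cumul rho) (n + k) j.
  rewrite /dyadic_incr (cumulB irho) ?dyadic_ge0 ?dyadic_le ?leqnSn ?dyadic_le1 //.
  by apply: Rintegral_ge0 => x _; exact: rho0.
rewrite -[(_ - _) ^+ 2]real_normK ?num_real // -/(a j).
set cc := dyadic_incr _ _ _ in c0 *.
have H : 0 <= s^-1 * (a j - s) ^+ 2 * cc.
  by rewrite mulr_ge0 // mulr_ge0 ?sqr_ge0 // invr_ge0 ltW.
rewrite -subr_ge0 (_ : _ - _ = s^-1 * (a j - s) ^+ 2 * cc) //.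
by field; rewrite gt_eqF.
Qed.

End DyadicDerivative.

(** * Convergence from summable increments *)

Lemma nneseries_le_bound (R : realType) (u : nat -> \bar R) (a : nat -> R) (A : R) :
  (forall k, (0 <= u k)%E) -> (forall k, (u k <= (a k)%:E)%E) ->
  (forall n, \sum_(0 <= k < n) a k <= A) ->
  (\sum_(0 <= k <oo) u k <= A%:E)%E.
Proof.
move=> u0 ua aA; apply: lime_le; first by apply: is_cvg_nneseries.
apply: nearW => n; apply: (@le_trans _ _ (\sum_(0 <= k < n) a k)%:E); last by rewrite lee_fin.
by rewrite -sumEFin; apply: lee_sum => k _.
Qed.

Lemma cvgn_of_summable_increments (R : realType) (u : nat -> R) :
  (\sum_(0 <= k <oo) `|u k.+1 - u k|%:E < +oo)%E -> cvgn u.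
Proof.
set S := (\sum_(0 <= k <oo) _)%E => Soo.
have S0 : (0 <= S)%E by apply: nneseries_ge0 => k _ _; rewrite lee_fin.
have Sfin : S \is a fin_num by rewrite ge0_fin_numE.
pose d k := u k.+1 - u k.
have : cvgn (series d).
  apply: normed_cvg; apply: nondecreasing_is_cvgn.
    apply: nondecreasing_series => k _ _ /=; exact: normr_ge0.
  exists (fine S) => _ [n _ <-]; rewrite -lee_fin fineK //.
  rewrite /series /= -sumEFin; apply: nneseries_lim_ge => k _ _.
  by rewrite lee_fin.
have -> : series d = (fun n => u n - u 0%N).
  by apply/funext => n; rewrite /series /= /d telescope_sumr.
move=> cu; have : cvgn ((fun n => u n - u 0%N) \+ cst (u 0%N)).
  by apply: is_cvgD => //; exact: is_cvg_cst.
by congr (cvgn _); apply/funext => n /=; rewrite subrK.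
Qed.

(** The argument of Riesz and Fischer: [|F_ 0|] plus the series of absolute increments is
    integrable, hence finite almost everywhere, and dominates the whole sequence. *)
Lemma L1_cvg_of_summable_increments (d : measure_display) (T : measurableType d)
    (R : realType) (mu : {measure set T -> \bar R}) (D : set T)
    (F_ : nat -> T -> R) (a : nat -> R) (A : R) :
  measurable D -> (forall k, measurable_fun setT (F_ k)) ->
  mu.-integrable D (EFin \o F_ 0%N) ->
  (forall k, (\int[mu]_(x in D) `|F_ k.+1 x - F_ k x|%:E <= (a k)%:E)%E) ->
  (forall n, \sum_(0 <= k < n) a k <= A) ->
  exists F : T -> R, [/\ measurable_fun setT F, mu.-integrable D (EFin \o F),
    {ae mu, forall x, D x -> F_ ^~ x @ \oo --> F x} &
    forall E, measurable E -> E `<=` D ->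
      (\int[mu]_(x in E) (F_ k x)%:E)%E @[k --> \oo] --> (\int[mu]_(x in E) (F x)%:E)%E].
Proof.
move=> mD mF iF0 Fa aA.
(* The upper limit is measurable everywhere, also on the null set where the sequence may diverge. *)
pose F x := fine (limn_esup (fun k => (F_ k x)%:E)).
have mEF k : measurable_fun setT (fun x => (F_ k x)%:E) by exact/measurable_EFinP.
have mFF : measurable_fun setT F.
  by apply: measurableT_comp => //; exact: measurable_fun_limn_esup.
have md k : measurable_fun setT (fun x => `|F_ k.+1 x - F_ k x|%:E).
  apply/measurable_EFinP; apply: measurableT_comp => //; exact: measurable_funB.
pose S x := (\sum_(0 <= k <oo) `|F_ k.+1 x - F_ k x|%:E)%E.
have S0 x : (0 <= S x)%E by apply: nneseries_ge0 => k _ _; rewrite lee_fin.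
have mS : measurable_fun setT S by apply: ge0_emeasurable_sum.
have iS : mu.-integrable D S.
  apply/integrableP; split; first exact: measurable_funTS.
  under eq_integral => x _ do rewrite gee0_abs //.
  rewrite integral_nneseries //; last by move=> k; exact: measurable_funTS.
  apply: (@le_lt_trans _ _ A%:E); last exact: ltry.
  by apply: nneseries_le_bound Fa aA => k; apply: integral_ge0 => x _; rewrite lee_fin.
pose g x := (`|F_ 0%N x|%:E + S x)%E.
have ig : mu.-integrable D g.
  by apply: integrableD => //; exact: (integrable_norm iF0).
have cvgF : {ae mu, forall x, D x -> F_ ^~ x @ \oo --> F x}.
  have := integrable_ae mD iS; apply: filterS => x H Dx.
  have {H} /cvgn_of_summable_increments cF : (S x < +oo)%E by rewrite -ge0_fin_numE // H.
  have cE : (fun k => (F_ k x)%:E) @ \oo --> (limn (F_ ^~ x))%:E.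
    by apply: cvg_EFin; [exact: nearW|exact: cF].
  rewrite /F is_cvg_limn_esupE; last by apply/cvg_ex; eexists; exact: cE.
  by have /cvg_lim -> := cE.
have dom x n : (`|(F_ n x)%:E| <= g x)%E.
  rewrite /g /=.
  apply: (@le_trans _ _ (`|F_ 0%N x| + \sum_(0 <= k < n) `|F_ k.+1 x - F_ k x|)%:E).
    rewrite lee_fin -[F_ n x](subrK (F_ 0%N x)) addrC.
    apply: (le_trans (ler_normD _ _)); rewrite lerD2l.
    by rewrite -(telescope_sumr (fun k => F_ k x)) //; exact: ler_norm_sum.
  rewrite EFinD leeD2l // -sumEFin; apply: nneseries_lim_ge => k _ _.
  by rewrite lee_fin.
have DC E : measurable E -> E `<=` D ->
    mu.-integrable E (EFin \o F) /\
    (\int[mu]_(x in E) (F_ k x)%:E)%E @[k --> \oo] --> (\int[mu]_(x in E) (F x)%:E)%E.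
  move=> mE ED.
  have [||||H1 _ H2] := @dominated_convergence _ _ _ mu E mE (fun k x => (F_ k x)%:E)
     (EFin \o F) g (fun k => measurable_funTS (mEF k)).
  - by apply/measurable_EFinP; exact: measurable_funTS.
  - apply: filterS cvgF => x H /ED /H cx.
    by apply: cvg_EFin; [exact: nearW|exact: cx].
  - exact: integrableS ig.
  - by apply: aeW => x n _; exact: dom.
  - by split.
by exists F; split => //; [apply: (DC D _ _).1|move=> E mE ED; apply: (DC E mE ED).2].
Qed.

Definition cts01 (R : realType) (f : R -> R) : Prop :=
  forall x : R, 0 <= x <= 1 -> forall e : R, 0 < e -> exists2 h : R, 0 < h &
    forall y : R, 0 <= y <= 1 -> `|y - x| < h -> `|f y - f x| <= e.

Lemma cumul_cts01 (R : realType) (f : R -> R) :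
  (@lebesgue_measure R).-integrable `[0, 1] (EFin \o f) -> cts01 (cumul f).
Proof.
move=> fi x x01 e e0.
have /subspace_continuousP := parameterized_integral_continuous ler01 fi.
move=> /(_ x); rewrite /= in_itv /= x01 => /(_ isT) /cvgrPdist_le /(_ e e0).
move=> /nbhs_ballP [h /= h0 hh]; exists h => // y y01 yx.
rewrite distrC; apply: (hh y); last by rewrite /= in_itv /= y01.
by rewrite /ball /= distrC.
Qed.

Lemma pow2_small (R : realType) (h : R) : 0 < h -> exists n : nat, (2 ^ n)%:R^-1 < h :> R.
Proof.
move=> h0; exists (Num.truncn h^-1).+1.
rewrite invf_plt ?posrE ?pow2_gt0 //.
have := truncnS_gt h^-1 => /lt_trans; apply.
by rewrite ltr_nat ltn_expl.
Qed.

Lemma cts01_dyadic_eq0 (R : realType) (f : R -> R) :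
  cts01 f -> (forall n i, (i <= 2 ^ n)%N -> f (dyadic R n i) = 0) ->
  forall x : R, 0 <= x <= 1 -> f x = 0.
Proof.
move=> cf f0 x /[dup] x01 /andP[x0 x1].
apply/eqP; rewrite -normr_le0; apply/ler_addgt0Pr => e e0; rewrite add0r.
move: x0; rewrite le_eqVlt => /predU1P[<-|x0].
  by rewrite -(dyadic0 R 0) f0 // normr0 ltW.
have [h h0 hh] := cf x x01 e e0.
have [n nh] := pow2_small h0.
have x01' : 0 < x <= 1 by rewrite x0.
have [j jn /andP[j1 j2]] := dyadic_locate n x01'.
have := hh (dyadic R n j.+1); rewrite f0 // sub0r normrN; apply.
  by rewrite dyadic_ge0 dyadic_le1.
rewrite ger0_norm ?subr_ge0 //; apply: le_lt_trans nh.
have : dyadic R n j.+1 = dyadic R n j + (2 ^ n)%:R^-1.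
  by rewrite /dyadic -addn1 natrD mulrDl mul1r.
by move: j1 j2; lra.
Qed.

Lemma sum_half_le2 (R : realType) (n : nat) : \sum_(0 <= k < n) ((1 / 2 : R) ^+ k) <= 2.
Proof.
suff -> : \sum_(0 <= k < n) ((1 / 2 : R) ^+ k) = 2 - 2 * (1 / 2) ^+ n.
  by rewrite gerBl mulr_ge0 // exprn_ge0 //; lra.
elim: n => [|n IH]; first by rewrite big_nil expr0; lra.
by rewrite big_nat_recr //= IH exprS; field.
Qed.

Lemma measurable_invr (R : realType) : measurable_fun setT (fun x : R => x^-1).
Proof.
have -> : [set: R] = ~` [set 0] `|` [set 0] by rewrite setUC setUv.
have o : open (~` [set (0 : R)]) by apply: closed_openC; exact: closed_eq.
apply/measurable_funU; [exact: open_measurable|exact: measurable_set1|split].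
  apply: open_continuous_measurable_fun => // x; rewrite inE /= => /eqP x0.
  exact: inv_continuous.
exact: measurable_fun_set1.
Qed.

(* A function whose dyadic difference quotients with respect to [rho dx] are
   bounded in [L^2(rho dx)] is a primitive: the quotients form an
   [L^2]-bounded martingale, a subsequence of which converges fast. *)
Lemma dyadic_representation (R : realType) (q rho : R -> R) (L2 : R) :
  measurable_fun setT rho -> (forall x, 0 <= rho x) ->
  (@lebesgue_measure R).-integrable `[0, 1] (EFin \o rho) ->
  cumul rho 1 = 1 -> dyadic_ac q (cumul rho) ->
  (forall n, dyadic_energy q (cumul rho) n <= L2) -> cts01 q ->
  exists g : R -> R, [/\ measurable_fun setT g,
    (@lebesgue_measure R).-integrable `[0, 1] (EFin \o g),
    forall x : R, 0 <= x <= 1 -> q x = q 0 + cumul g x &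
    (intT (fun x => (rho x * (g x / rho x) ^+ 2)%R) <= L2%:E)%E].
Proof.
move=> mrho rho0 irho c1 ac eL cq.
pose E n := dyadic_energy q (cumul rho) n.
pose f n := dyadic_deriv q rho n.
have cnd n j : (j < 2 ^ n)%N -> 0 <= dyadic_incr (cumul rho) n j.
  move=> jN; rewrite /dyadic_incr (cumulB irho) ?dyadic_ge0 ?dyadic_le ?leqnSn ?dyadic_le1 //.
  by apply: Rintegral_ge0 => x _; exact: rho0.
have Emon n k : E n <= E (n + k)%N.
  rewrite -subr_ge0 /E -dyadic_energyB // big_nat sumr_ge0 // => j /andP[_ jN].
  by rewrite mulr_ge0 ?sqr_ge0 // cnd.
have EN (e : R) : 0 < e -> exists N, forall m, (N <= m)%N -> forall k, E (m + k)%N - E m <= e.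
  move=> e0; have hs : has_sup (range E).
    by split; [exists (E 0%N); exists 0%N|exists L2 => _ [n _ <-]; exact: eL].
  have [_ [N _ <-] HN] := sup_adherent e0 hs.
  exists N => m Nm k.
  have H1 : E (m + k)%N <= sup (range E) by apply: ub_le_sup; [exact: hs.2|exists (m + k)%N].
  have H2 : E N <= E m by rewrite -(subnKC Nm); exact: Emon.
  by lra.
have hk k : 0 < ((1 / 2 : R) ^+ k) ^+ 2 by rewrite exprn_gt0 // exprn_gt0 //; lra.
have /choice[N HN] := fun k => EN _ (hk k).
(* Beyond [nk k] the energy grows by at most 4^-k, so with the weight s = 2^-k consecutive
   approximations differ by at most 2^-k in L^1. Levels are written as sums because the refinement
   lemmas compare [n] with [n + k]. *)
pose nk := fix nk k := if k is k'.+1 then (nk k' + (N k'.+1).+1)%N else (N 0%N).+1.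
have nkN k : (N k <= nk k)%N by case: k => [|k] /=; [exact: leqnSn|rewrite addnS ltnW // ltnS leq_addl].
have nkk k : (k <= nk k)%N by elim: k => //= k IH; rewrite addnS ltnS (leq_trans IH) // leq_addr.
have Fa k : (\int[@lebesgue_measure R]_(x in `[0%R, 1%R]) `|f (nk k.+1) x - f (nk k) x|%:E
     <= ((1 / 2) ^+ k)%:E)%E.
  have s0 : 0 < (1 / 2 : R) ^+ k by rewrite exprn_gt0 //; lra.
  have [i1 H] := dyadic_deriv_dist mrho rho0 irho ac (nk k) (N k.+1).+1 s0.
  rewrite -cumul_EFin // lee_fin; apply: (le_trans H).
  have := HN k (nk k) (nkN k) (N k.+1).+1; rewrite /E c1 => H1.
  set s := (1 / 2 : R) ^+ k in s0 H1 *.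
  have : s^-1 * (dyadic_energy q (cumul rho) (nk k + (N k.+1).+1) -
     dyadic_energy q (cumul rho) (nk k)) <= s^-1 * s ^+ 2.
    by rewrite ler_wpM2l // invr_ge0 ltW.
  by rewrite expr2 mulrA mulVf ?gt_eqF // mul1r; lra.
have [F [mF iF cF limF]] := @L1_cvg_of_summable_increments _ _ _ (@lebesgue_measure R)
  `[0, 1]%classic _ _ _ (measurable_itv _) (fun k => measurable_dyadic_deriv q mrho (nk k))
  (dyadic_deriv_integral mrho irho ac (nk 0%N)).1 Fa (sum_half_le2 R).
exists F; split => //.
- move=> x x01; apply/eqP; rewrite -subr_eq0; apply/eqP.
  apply: (@cts01_dyadic_eq0 _ (fun x => q x - (q 0 + cumul F x))) => //.
    move=> y y01 e e0; have e2 : 0 < e / 2 by lra.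
    have [h1 h10 hh1] := cq y y01 _ e2; have [h2 h20 hh2] := cumul_cts01 iF y01 e2.
    exists (Num.min h1 h2); first by rewrite lt_min h10.
    move=> z z01; rewrite lt_min => /andP[/(hh1 _ z01) A1 /(hh2 _ z01) A2].
    move: A1 A2; rewrite !ler_norml => /andP[? ?] /andP[? ?]; apply/andP; split; lra.
  move=> n i iN; have di1 := dyadic_le1 R iN.
  have := limF `[0, dyadic R n i]%classic (measurable_itv _).
  rewrite -cumul_EFin; last exact: integrable_sub01 di1 iF.
  move=> H; have {}H := H ltac:(by apply: subset_itvl; rewrite bnd_simp).
  (* At a fixed dyadic point the integrals are eventually constant in [k], as every finer level
     interpolates [q] there. *)
  have H' : (q (dyadic R n i) - q 0)%:E = (cumul F (dyadic R n i))%:E.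
    apply: (@cvg_unique _ _ _ _ _ _ _ H) => //; apply: cvg_near_cst.
    exists n => //= k nk_.
    rewrite -cumul_EFin; last first.
      apply: integrable_sub01 di1 _.
      exact: (dyadic_deriv_integral mrho irho ac (nk k)).1.
    congr EFin; rewrite -(subnKC (leq_trans nk_ (nkk k))).
    by rewrite dyadic_deriv_integral_refine.
  by move: H' => [] <-; lra.
- pose H n x := rho x * (f n x / rho x) ^+ 2.
  have mV (u : R -> R) : measurable_fun setT u ->
      measurable_fun setT (fun x => (rho x * (u x / rho x) ^+ 2)%:E).
    move=> mu_; apply/measurable_EFinP; apply: measurable_funM => //.
    apply: measurable_funX; apply: measurable_funM => //.
    exact: (measurableT_comp (@measurable_invr R)).
  have mH n : measurable_fun setT (fun x => (H n x)%:E).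
    by apply: mV; exact: measurable_dyadic_deriv.
  have pos (u : R -> R) x : (0 <= (rho x * (u x / rho x) ^+ 2)%:E)%E.
    by rewrite lee_fin mulr_ge0 ?sqr_ge0.
  pose G k x := (H (nk k) x)%:E.
  (* The energy bound passes to the limit by Fatou's lemma. Division by the fixed number [rho x]
     preserves convergence, also where [rho x = 0] and the quotients are 0 by convention. *)
  apply: (@le_trans _ _ (\int[@lebesgue_measure R]_(x in `[0%R, 1%R]) limn_einf (G ^~ x))%E).
    apply: ae_ge0_le_integral => //.
    - by apply: measurable_funTS; exact: mV.
    - move=> x _; rewrite limn_einf_lim; apply: lime_ge; first exact: is_cvg_einfs.
      by apply: nearW => n; apply: le_ereal_inf_tmp => _ [k _ <-]; exact: pos.
    - have -> : (fun x => limn_einf (G ^~ x)) =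
          (fun x => - limn_esup ((fun k x => - G k x) ^~ x))%E.
        by apply/funext => x; rewrite -[limn_einf _]oppeK -limn_esupN.
      apply: measurable_funTS; apply: measurableT_comp => //.
      apply: measurable_fun_limn_esup => k; apply: measurableT_comp => //.
      exact: mH.
    - apply: filterS cF => x Hx /Hx cx.
      suff cG : G ^~ x @ \oo --> (rho x * (F x / rho x) ^+ 2)%:E.
        by rewrite is_cvg_limn_einfE; [rewrite (cvg_lim _ cG)|apply/cvg_ex; eexists; exact: cG].
      apply: cvg_EFin; first exact: nearW.
      apply: cvgM; first exact: cvg_cst.
      have cz : (fun k => f (nk k) x / rho x) @ \oo --> F x / rho x.
        by apply: cvgM; [exact: cx|exact: cvg_cst].
      exact: (cvgM cz cz).
  apply: (@le_trans _ _ (limn_einf (fun k => \int[@lebesgue_measure R]_(x in `[0%R, 1%R]) G k x)%E)).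
    apply: fatou => //; first by move=> k; exact: (measurable_funTS (mH (nk k))).
    by move=> k x _; exact: pos.
  rewrite limn_einf_lim; apply: lime_le; first exact: is_cvg_einfs.
  apply: nearW => k; apply: ge_ereal_inf; exists (\int[@lebesgue_measure R]_(x in `[0%R, 1%R]) G k x)%E.
    by exists k => //=.
  have [iG EG] := dyadic_deriv_energy mrho irho ac (nk k).
  by rewrite -cumul_EFin // EG lee_fin.
Qed.

(** * From the distributional identity to the profile equation *)

Lemma is_derive_derivable (R : realType) (f : R -> R) (x d : R) :
  is_derive x 1 f d -> derivable f x 1.
Proof. by case. Qed.

Definition wave (R : realType) (a : R) (k : nat) (b x : R) : R :=
  a * cos (2 * pi * k%:R * x + b).

(** Cosines with a phase suffice: a derivative shifts the phase by pi / 2, and scalars are absorbed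
    in the amplitude. *)
Inductive trigpoly (R : realType) : (R -> R) -> Prop :=
| trigpoly_wave a k b : trigpoly (wave a k b)
| trigpoly_add f g : trigpoly f -> trigpoly g -> trigpoly (fun x => f x + g x).

Lemma is_derive_wave (R : realType) (a : R) (k : nat) (b x : R) :
  is_derive x 1 (wave a k b) (wave (2 * pi * k%:R * a) k (b + pi / 2) x).
Proof.
have dl : is_derive x 1 (fun y => 2 * pi * k%:R * y + b) (2 * pi * k%:R).
  apply: is_derive_eq (deriveD_fun (deriveZ_fun (2 * pi * k%:R) (is_derive_id x 1))
    (is_derive_cst b x 1)) _.
  by rewrite mulr1 addr0.
apply: is_derive_eq (deriveZ_fun a (derive_comp_fun (is_derive_cos _) dl)) _.
by rewrite /wave addrA cosDpihalf; ring.
Qed.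

Lemma trigpoly_derive (R : realType) (f : R -> R) : trigpoly f ->
  (forall x : R, derivable f x 1) /\ trigpoly (derive1 f).
Proof.
elim => [a k b|{}f g _ [df tf] _ [dg tg]].
  split=> [x|]; first exact: is_derive_derivable (is_derive_wave a k b x).
  suff -> : derive1 (wave a k b) = wave (2 * pi * k%:R * a) k (b + pi / 2).
    exact: trigpoly_wave.
  by apply/funext => x; exact: is_derive1E (is_derive_wave a k b x).
have D x := deriveD_fun (derivable_is_derive1 (df x)) (derivable_is_derive1 (dg x)).
split=> [x|]; first exact: is_derive_derivable (D x).
suff -> : derive1 (fun x => f x + g x) = fun x => derive1 f x + derive1 g x.
  exact: trigpoly_add.
by apply/funext => x; exact: is_derive1E (D x).
Qed.

Lemma wave_periodic (R : realType) (a : R) (k : nat) (b : R) : periodic1 (wave a k b).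
Proof.
move=> x; rewrite /wave; congr (_ * _).
elim: k b => [|k IH] b; first by rewrite mulr0 !mul0r.
have -> : 2 * pi * k.+1%:R * (x + 1) + b =
    2 * pi * k%:R * (x + 1) + (2 * pi * x + b) + pi *+ 2 :> R.
  by rewrite -natr1 -[pi *+ 2]mulr_natl; ring.
rewrite cosD2pi IH; congr cos; rewrite -natr1; ring.
Qed.

Lemma trigpoly_smooth (R : realType) (f : R -> R) : trigpoly f -> smooth_testT f.
Proof.
move=> tf; split.
  by elim: tf => [a k b|{}f g _ pf _ pg x]; [exact: wave_periodic|rewrite pf pg].
move=> n x; apply: (trigpoly_derive _).1.
by elim: n => [//|n IH] /=; exact: (trigpoly_derive IH).2.
Qed.

(** This is cos^2(pi (x - a)): nonnegative, 1-periodic, and equal to its maximum 1 exactly on a +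
    Z. *)
Definition cosbump (R : realType) (a x : R) : R := (1 + cos (2 * pi * (x - a))) / 2.

Lemma trigpoly_bump (R : realType) (a : R) (f : R -> R) :
  trigpoly f -> trigpoly (fun x => f x * cosbump a x).
Proof.
elim=> [c k b|{}f g _ tf _ tg]; last first.
  have -> : (fun x => (f x + g x) * cosbump a x) = (fun x => f x * cosbump a x + g x * cosbump a x).
    by apply/funext => x; rewrite mulrDl.
  exact: trigpoly_add.
(* The product formula produces the frequencies one above and one below, so the constant wave is
   treated apart. *)
case: k => [|k].
  have -> : (fun x => wave c 0 b x * cosbump a x) =
      (fun x => wave (c / 2) 0 b x + wave (c / 2 * cos b) 1 (- (2 * pi * a)) x).
    by apply/funext => x; rewrite /wave /cosbump mulr0 mul0r add0r mulr1 -mulrBr; field.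
  exact: trigpoly_add (trigpoly_wave _ _ _) (trigpoly_wave _ _ _).
have -> : (fun x => wave c k.+1 b x * cosbump a x) =
    (fun x => (wave (c / 2) k.+1 b x + wave (c / 4) k.+2 (b - 2 * pi * a) x)
              + wave (c / 4) k (b + 2 * pi * a) x).
  apply/funext => x; rewrite /wave /cosbump.
  set t := 2 * pi * k.+1%:R * x + b; set s := 2 * pi * (x - a).
  have -> : 2 * pi * k.+2%:R * x + (b - 2 * pi * a) = t + s.
    by rewrite /t /s -[k.+2%:R]natr1; ring.
  have -> : 2 * pi * k%:R * x + (b + 2 * pi * a) = t - s.
    by rewrite /t /s -[k.+1%:R]natr1; ring.
  by rewrite !cosD cosN sinN; field.
exact: trigpoly_add (trigpoly_add (trigpoly_wave _ _ _) (trigpoly_wave _ _ _)) (trigpoly_wave _ _ _).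
Qed.

Lemma trigpoly_bumpX (R : realType) (a : R) (n : nat) : trigpoly (fun x => cosbump a x ^+ n).
Proof.
elim: n => [|n IH].
  have -> : (fun x => cosbump a x ^+ 0) = wave 1 0 0.
    by apply/funext => x; rewrite /wave mulr0 mul0r add0r cos0 mulr1.
  exact: trigpoly_wave.
have -> : (fun x => cosbump a x ^+ n.+1) = (fun x => cosbump a x ^+ n * cosbump a x).
  by apply/funext => x; rewrite exprSr.
exact: trigpoly_bump.
Qed.

(** Dividing the amplitude at frequency [w] by [- w ^+ 2] inverts the second derivative. The
    frequency 0 has no periodic antiderivative and goes into [c]. *)
Lemma trigpoly_antiderive2 (R : realType) (f : R -> R) : trigpoly f ->
  exists phi c, trigpoly phi /\ forall x, derive1 (derive1 phi) x = f x - c.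
Proof.
elim=> [a k b|{}f g _ [p [c [tp dp]]] _ [p' [c' [tp' dp']]]].
  have [->|k0] := eqVneq k 0%N.
    exists (wave 0 0 0), (a * cos b); split; first exact: trigpoly_wave.
    move=> x; have -> : wave 0 0 0 = cst (0 : R).
      by apply/funext => y; rewrite /wave mul0r.
    have E : derive1 (cst (0 : R)) = cst 0.
      by apply/funext => y; exact: is_derive1E (is_derive_cst _ _ _).
    by rewrite !E /wave mulr0 mul0r add0r subrr.
  pose w : R := 2 * pi * k%:R.
  have w0 : w != 0 by rewrite !mulf_neq0 // ?pnatr_eq0 // gt_eqF // pi_gt0.
  exists (wave (- a / w ^+ 2) k b), 0; split; first exact: trigpoly_wave.
  move=> x.
  have -> : derive1 (wave (- a / w ^+ 2) k b) = wave (w * (- a / w ^+ 2)) k (b + pi / 2).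
    by apply/funext => y; exact: is_derive1E (is_derive_wave _ _ _ _).
  rewrite (is_derive1E (is_derive_wave _ _ _ _)) subr0 /wave -/w.
  have -> : w * x + (b + pi / 2 + pi / 2) = (w * x + b) + pi by field.
  by rewrite cosDpi; field.
exists (fun x => p x + p' x), (c + c'); split; first exact: trigpoly_add.
have [d1 /trigpoly_derive[d2 _]] := trigpoly_derive tp.
have [d1' /trigpoly_derive[d2' _]] := trigpoly_derive tp'.
have -> : derive1 (fun x => p x + p' x) = (fun x => derive1 p x + derive1 p' x).
  apply/funext => x; apply: is_derive1E.
  exact: deriveD_fun (derivable_is_derive1 (d1 x)) (derivable_is_derive1 (d1' x)).
move=> x; rewrite (is_derive1E (deriveD_fun (derivable_is_derive1 (d2 x))
  (derivable_is_derive1 (d2' x)))).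
by rewrite dp dp'; ring.
Qed.

(** * Continuous functions on the unit interval and their integrals *)

Lemma within_cts01 (R : realType) (f : R -> R) :
  {within `[0, 1], continuous f} -> cts01 f.
Proof.
move=> /subspace_continuousP cf x x01 e e0; move: (cf x).
rewrite /= in_itv /= x01 => /(_ isT) /cvgrPdist_le /(_ e e0).
move=> /nbhs_ballP [h /= h0 hh]; exists h => // y y01 yx.
rewrite distrC; apply: (hh y); last by rewrite /= in_itv /= y01.
by rewrite /ball /= distrC.
Qed.

Lemma cts01_within (R : realType) (f : R -> R) :
  cts01 f -> {within `[0, 1], continuous f}.
Proof.
move=> cf; apply/subspace_continuousP => x; rewrite /= in_itv /= => x01.
apply/cvgrPdist_le => e e0; have [h h0 hh] := cf x x01 e e0.
apply/nbhs_ballP; exists h => //= y; rewrite /ball /= in_itv /= => yx y01.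
by rewrite distrC; apply: hh => //; rewrite distrC.
Qed.

Lemma cts01_integrable (R : realType) (f : R -> R) : cts01 f ->
  (@lebesgue_measure R).-integrable `[0, 1] (EFin \o f).
Proof.
move=> /cts01_within cf; apply: continuous_compact_integrable cf.
exact: segment_compact.
Qed.

Lemma cts01D (R : realType) (f g : R -> R) : cts01 f -> cts01 g -> cts01 (fun x => f x + g x).
Proof.
move=> /cts01_within cf /cts01_within cg; apply: within_cts01 => x.
by apply: cvgD; [exact: cf|exact: cg].
Qed.

Lemma cts01B (R : realType) (f g : R -> R) : cts01 f -> cts01 g -> cts01 (fun x => f x - g x).
Proof.
move=> /cts01_within cf /cts01_within cg; apply: within_cts01 => x.
by apply: cvgB; [exact: cf|exact: cg].
Qed.

Lemma cts01M (R : realType) (f g : R -> R) : cts01 f -> cts01 g -> cts01 (fun x => f x * g x).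
Proof.
move=> /cts01_within cf /cts01_within cg; apply: within_cts01 => x.
by apply: cvgM; [exact: cf|exact: cg].
Qed.

Lemma cts01_cst (R : realType) (c : R) : cts01 (fun=> c).
Proof. by move=> x _ e e0; exists 1 => // y _ _; rewrite subrr normr0 ltW. Qed.

Lemma cts01_cts (R : realType) (f : R -> R) : continuous f -> cts01 f.
Proof.
move=> cf x _ e e0; have [h h0 hh] := cts_eps (cf x) e0.
by exists h => // y _; exact: hh.
Qed.

Lemma cts01_bounded (R : realType) (f : R -> R) : cts01 f ->
  exists2 K : R, 0 < K & forall x : R, 0 <= x <= 1 -> `|f x| <= K.
Proof.
move=> cf.
have cn : cts01 (fun x => `|f x|).
  move=> x x01 e e0; have [h h0 hh] := cf x x01 e e0; exists h => // y y01 yx.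
  exact: le_trans (ler_dist_dist _ _) (hh y y01 yx).
have [c _ H] := EVT_max ler01 (cts01_within cn).
exists (`|f c| + 1); first by rewrite ltr_wpDl.
by move=> x x01; apply: (le_trans (H x _)); rewrite ?in_itv //= lerDl.
Qed.

Lemma cumul1D (R : realType) (f g : R -> R) : cts01 f -> cts01 g ->
  cumul (fun x => f x + g x) 1 = cumul f 1 + cumul g 1.
Proof. by move=> cf cg; rewrite /cumul RintegralD //; exact: cts01_integrable. Qed.

Lemma cumul1B (R : realType) (f g : R -> R) : cts01 f -> cts01 g ->
  cumul (fun x => f x - g x) 1 = cumul f 1 - cumul g 1.
Proof. by move=> cf cg; rewrite /cumul RintegralB //; exact: cts01_integrable. Qed.

Lemma cumul1Z (R : realType) (k : R) (f : R -> R) : cts01 f ->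
  cumul (fun x => k * f x) 1 = k * cumul f 1.
Proof. by move=> cf; rewrite /cumul RintegralZl //; exact: cts01_integrable. Qed.

Lemma cumul1_cst (R : realType) (k : R) : cumul (fun=> k) 1 = k.
Proof.
rewrite /cumul Rintegral_cst //.
have E : @lebesgue_measure R `[0, 1]%classic = 1%E.
  by rewrite lebesgue_measure_itv /= lte_fin ltr01 -EFinB subr0.
by rewrite (_ : fine _ = 1) ?mulr1 //; exact: (congr1 fine E).
Qed.

Lemma cumul1_FTC (R : realType) (f : R -> R) :
  (forall x : R, derivable f x 1) -> continuous (derive1 f) ->
  cumul (derive1 f) 1 = f 1 - f 0.
Proof.
move=> df cf; rewrite /cumul /Rintegral (@continuous_FTC2 _ _ f); last 4 first.
- exact: ltr01.
- exact/cts01_within/cts01_cts.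
- have cts x : {for x, continuous f} := is_derive_cts (derivable_is_derive1 (df x)).
  split; first by move=> x _.
    by apply: cvg_at_right_filter; exact: cts.
  by apply: cvg_at_left_filter; exact: cts.
- by move=> x _.
by [].
Qed.

Lemma trigpoly_cts (R : realType) (f : R -> R) : trigpoly f -> continuous f.
Proof.
by move=> /trigpoly_derive[df _] x; exact: is_derive_cts (derivable_is_derive1 (df x)).
Qed.

(** * Concentrating bumps and the lemma of du Bois-Reymond *)

Lemma ltr_cos2pi (R : realType) (s t : R) :
  0 <= s -> s < t -> t <= 1 / 2 -> cos (2 * pi * t) < cos (2 * pi * s).
Proof.
move=> s0 st t2; have p0 := pi_gt0 R.
have tp (u : R) : u <= 1 / 2 -> 2 * pi * u <= pi.
  move=> u2; have : pi * (2 * u) <= pi * 1.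
    apply: ler_wpM2l; first exact: ltW.
    by lra.
  by rewrite mulr1; lra.
have pp (u : R) : 0 <= u -> 0 <= 2 * pi * u.
  by move=> u0; apply: mulr_ge0 => //; apply: mulr_ge0 => //; exact: ltW.
have hI (u : R) : 0 <= u -> u <= 1 / 2 -> 2 * pi * u \in `[0, pi].
  by move=> u0 u2; rewrite in_itv /= pp // tp.
rewrite ltr_cos ?hI //; try lra.
by rewrite ltr_pM2l // mulr_gt0.
Qed.

Lemma bump_far (R : realType) (a d x : R) :
  0 < d -> d <= 1 / 2 -> d <= `|x - a| <= 1 - d -> cosbump a x <= cosbump 0 d.
Proof.
move=> d0 d2 /andP[ad ad'].
have p0 := pi_gt0 R.
rewrite /cosbump subr0 ler_pM2r ?invr_gt0 // lerD2l.
have -> : cos (2 * pi * (x - a)) = cos (2 * pi * `|x - a|).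
  by case: (ger0P (x - a)) => h //; rewrite mulrN cosN.
have mono s t : 0 <= s -> s <= t -> t <= 1 / 2 -> cos (2 * pi * t) <= cos (2 * pi * s).
  move=> s0; rewrite le_eqVlt => /predU1P[->//|st].
  by move=> t2; rewrite ltW // ltr_cos2pi.
have [h|h] := lerP `|x - a| (1 / 2); first exact: mono (ltW d0) ad h.
have -> : cos (2 * pi * `|x - a|) = cos (2 * pi * (1 - `|x - a|)).
  rewrite -cosN -[in LHS]cosD2pi; congr cos.
  by rewrite -[pi *+ 2]mulr_natl; ring.
by apply: mono; lra.
Qed.

Lemma bump_near (R : realType) (a d x : R) :
  d <= 1 / 2 -> `|x - a| <= d -> cosbump 0 d <= cosbump a x.
Proof.
move=> d2 ad; have p0 := pi_gt0 R.
rewrite /cosbump subr0 ler_pM2r ?invr_gt0 // lerD2l.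
have -> : cos (2 * pi * (x - a)) = cos (2 * pi * `|x - a|).
  by case: (ger0P (x - a)) => h //; rewrite mulrN cosN.
have n0 : 0 <= `|x - a| by [].
move: ad; rewrite le_eqVlt => /predU1P[->//|ad].
by rewrite ltW // ltr_cos2pi.
Qed.

Lemma bump_ge0 (R : realType) (a x : R) : 0 <= cosbump a x.
Proof. by rewrite /cosbump divr_ge0 // -lerBlDl sub0r cos_geN1. Qed.

(* The powers of [cosbump a] concentrate at [a]. *)
Lemma bump_test_le0 (R : realType) (h : R -> R) : cts01 h ->
  (forall a n, cumul (fun x => h x * cosbump a x ^+ n) 1 = 0) ->
  forall a : R, 0 < a < 1 -> h a <= 0.
Proof.
move=> ch Hb a /andP[a0 a1]; rewrite leNgt; apply/negP => ha.
have ha2 : 0 < h a / 2 by lra.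
have a01 : 0 <= a <= 1 by lra.
have [d1 d10 hd1] := ch a a01 _ ha2.
have [K K0 hK] := cts01_bounded ch.
pose d := Num.min (d1 / 2) (Num.min (a / 2) ((1 - a) / 2)).
have d0 : 0 < d by rewrite /d !lt_min !divr_gt0 // subr_gt0.
have dd1 : d <= d1 / 2 by rewrite /d ge_min lexx.
have da : d <= a / 2 by rewrite /d !ge_min lexx orbT.
have d1a : d <= (1 - a) / 2 by rewrite /d !ge_min lexx !orbT.
(* The bump is at most [t1] at distance [d] or more, and at least [t2 > t1] within [d / 2]. The
   positive part of the integral is of order [t2 ^+ n], the rest at most [K * t1 ^+ n], and the
   ratio of the powers tends to 0. *)
pose t1 := cosbump 0 d; pose t2 := cosbump 0 (d / 2).
have t12 : t1 < t2.
  rewrite /t1 /t2 /cosbump !subr0 ltr_pM2r ?invr_gt0 // ltrD2l.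
  by apply: ltr_cos2pi; lra.
have t10 : 0 <= t1 := bump_ge0 _ _.
have t20 : 0 < t2 by lra.
pose J := `[a - d / 2, a + d / 2]%classic.
have pw n x : 0 <= x <= 1 ->
    (h a / 2 * t2 ^+ n) * \1_J x - K * t1 ^+ n <= h x * cosbump a x ^+ n.
  move=> x01; have u0 := bump_ge0 a x.
  have Kt : 0 <= K * t1 ^+ n by rewrite mulr_ge0 ?exprn_ge0 // ltW.
  have [xd|xd] := lerP d `|x - a|.
    have nJ : ~ J x.
      rewrite /J /= in_itv /= => /andP[x1 x2].
      have : `|x - a| <= d / 2 by rewrite ler_norml; apply/andP; split; lra.
      by lra.
    rewrite indicE memNset // mulr0 sub0r.
    have : `|h x * cosbump a x ^+ n| <= K * t1 ^+ n.
      rewrite normrM normrX (ger0_norm u0) ler_pM ?exprn_ge0 // ?hK //.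
      apply: lerXn2r; rewrite ?nnegrE //.
      apply: bump_far => //; first by lra.
      by rewrite xd ler_norml; apply/andP; split; lra.
    by rewrite ler_norml => /andP[].
  have hx : h a / 2 <= h x.
    have := hd1 x x01 (_ : `|x - a| < d1); rewrite ler_norml => H.
    by have /andP[] := H ltac:(lra); lra.
  have hx0 : 0 <= h x * cosbump a x ^+ n by rewrite mulr_ge0 ?exprn_ge0 //; lra.
  rewrite indicE; case: (boolP (x \in J)) => [/set_mem xJ|_]; last first.
    by rewrite mulr0; lra.
  rewrite mulr1; apply: (@le_trans _ _ (h a / 2 * t2 ^+ n)); first by lra.
  rewrite ler_pM ?exprn_ge0 ?(ltW t20) ?(ltW ha2) //.
  apply: lerXn2r; rewrite ?nnegrE ?(ltW t20) //.
  apply: bump_near; first by lra.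
  by move: xJ; rewrite /J /= in_itv /= => /andP[? ?]; rewrite ler_norml; apply/andP; split; lra.
have cJ n : h a / 2 * t2 ^+ n * d <= K * t1 ^+ n.
  have iJ : (@lebesgue_measure R).-integrable `[0, 1] (EFin \o (\1_J : R -> R)).
    have := integrable_indic_itv (a - d / 2) (a + d / 2) true false.
    by apply: integrableS => //; exact: measurable_itv.
  have EJ : cumul (\1_J : R -> R) 1 = d.
    rewrite /cumul /Rintegral integral_indic //; last exact: measurable_itv.
    have E : @lebesgue_measure R J = d%:E.
      rewrite lebesgue_measure_itv /= lte_fin ifT; last by lra.
      by rewrite -EFinB; congr EFin; lra.
    rewrite (_ : J `&` _ = J); first exact: (congr1 fine E).
    apply: setIidl => x; rewrite /J /= !in_itv /= => /andP[? ?]; apply/andP; split; lra.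
  set C := h a / 2 * t2 ^+ n.
  have iCJ : (@lebesgue_measure R).-integrable `[0, 1] (EFin \o (fun x => C * (\1_J : R -> R) x)).
    exact: (integrableZl _ C iJ).
  have iK := cts01_integrable (cts01_cst (K * t1 ^+ n)).
  have : cumul (fun x => C * (\1_J : R -> R) x - K * t1 ^+ n) 1 <= 0.
    rewrite -(Hb a n); apply: le_Rintegral => //.
    - exact: (integrableB _ iCJ iK).
    - apply/cts01_integrable/cts01M => //; apply: cts01_cts.
      exact: trigpoly_cts (trigpoly_bumpX a n).
    - by move=> x; rewrite /= in_itv /=; exact: pw.
  rewrite /cumul RintegralB // RintegralZl // -/(cumul (\1_J : R -> R) 1) EJ.
  by rewrite -/(cumul (fun=> K * t1 ^+ n) 1) cumul1_cst subr_le0.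
have z1 : `|t1 / t2| < 1.
  by rewrite ger0_norm ?divr_ge0 ?(ltW t20) // ltr_pdivrMr // mul1r.
have := cvg_expr z1; have e0 : 0 < (h a / 2 * d) / (2 * K) by rewrite !divr_gt0 ?mulr_gt0.
move=> /cvgrPdist_le /(_ _ e0) [n _ /(_ n (leqnn n))] /=.
rewrite sub0r normrN ger0_norm; last by rewrite exprn_ge0 // divr_ge0 // ltW.
rewrite expr_div_n ler_pdivrMr ?exprn_gt0 //.
move: (cJ n) => H1 H2.
have : K * t1 ^+ n <= K * (h a / 2 * d / (2 * K) * t2 ^+ n) by rewrite ler_pM2l.
have -> : K * (h a / 2 * d / (2 * K) * t2 ^+ n) = (h a / 2 * t2 ^+ n * d) / 2.
  by field; rewrite gt_eqF.
have : 0 < h a / 2 * t2 ^+ n * d by rewrite !mulr_gt0 ?exprn_gt0.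
by lra.
Qed.

Lemma trigpoly_periodic (R : realType) (f : R -> R) : trigpoly f -> f 1 = f 0.
Proof. by move=> /trigpoly_smooth[pf _]; rewrite -[1]add0r pf. Qed.

Lemma cumul_derive_trigpoly (R : realType) (f : R -> R) :
  trigpoly f -> cumul (derive1 f) 1 = 0.
Proof.
move=> tf; have [df tdf] := trigpoly_derive tf.
by rewrite (cumul1_FTC df (trigpoly_cts tdf)) trigpoly_periodic // subrr.
Qed.

(** A bump power minus its mean is the second derivative of a trigonometric polynomial, so [h] minus
    its mean is orthogonal to every bump power. Concentration then excludes a positive value, both
    of [h - m] and of [m - h]. *)
Lemma du_bois_reymond (R : realType) (h : R -> R) : cts01 h ->
  (forall phi, trigpoly phi -> cumul (fun x => h x * derive1 (derive1 phi) x) 1 = 0) ->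
  forall x : R, 0 < x < 1 -> h x = cumul h 1.
Proof.
move=> ch H.
pose m := cumul h 1.
have key a n : cumul (fun x => (h x - m) * cosbump a x ^+ n) 1 = 0.
  have tu := trigpoly_bumpX a n; have cu := cts01_cts (trigpoly_cts tu).
  have [phi [c [tphi E]]] := trigpoly_antiderive2 tu.
  have := H phi tphi.
  have -> : (fun x => h x * derive1 (derive1 phi) x) =
      (fun x => h x * cosbump a x ^+ n - c * h x).
    by apply/funext => x; rewrite E; ring.
  rewrite cumul1B; [|exact: cts01M|exact: cts01M (cts01_cst c) ch].
  rewrite cumul1Z // -/m => H1.
  have := cumul_derive_trigpoly (trigpoly_derive tphi).2.
  have -> : derive1 (derive1 phi) = (fun x => cosbump a x ^+ n - c) by apply/funext.
  rewrite cumul1B //; last exact: cts01_cst.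
  rewrite cumul1_cst => H2.
  have -> : (fun x => (h x - m) * cosbump a x ^+ n) =
     (fun x => h x * cosbump a x ^+ n - m * cosbump a x ^+ n).
    by apply/funext => x; ring.
  rewrite cumul1B; [|exact: cts01M|exact: cts01M (cts01_cst m) cu].
  by rewrite cumul1Z //; nra.
have cm : cts01 (fun x => h x - m) by exact: cts01B ch (cts01_cst m).
have cm' : cts01 (fun x => m - h x) by exact: cts01B (cts01_cst m) ch.
move=> x x01.
have H1 := bump_test_le0 cm key x01.
have key' a n : cumul (fun x => (m - h x) * cosbump a x ^+ n) 1 = 0.
  have cu := cts01_cts (trigpoly_cts (trigpoly_bumpX a n)).
  have -> : (fun x => (m - h x) * cosbump a x ^+ n) =
     (fun x => (-1) * ((h x - m) * cosbump a x ^+ n)).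
    by apply/funext => y; ring.
  by rewrite cumul1Z ?key ?mulr0 //; exact: cts01M.
have H2 := bump_test_le0 cm' key' x01.
by rewrite -/m; lra.
Qed.

(** * Integration by parts with an integrable factor *)

Lemma integrableM01 (R : realType) (p f : R -> R) :
  (@lebesgue_measure R).-integrable `[0, 1] (EFin \o p) -> cts01 f ->
  (@lebesgue_measure R).-integrable `[0, 1] (EFin \o (fun x => p x * f x)).
Proof.
move=> ip cf; have [K K0 HK] := cts01_bounded cf.
have mf := measurable_int _ (cts01_integrable cf).
have mp := measurable_int _ ip.
have iK : (@lebesgue_measure R).-integrable `[0, 1] (fun x => K%:E * (EFin \o p) x)%E.
  exact: integrableZl.
apply: le_integrable iK => //.
  apply/measurable_EFinP; apply: measurable_funM; exact/measurable_EFinP.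
move=> x; rewrite /= in_itv /= => x01; rewrite lee_fin !normrM mulrC (gtr0_norm K0).
by rewrite ler_wpM2r // HK.
Qed.

Lemma cumul_absB (R : realType) (p g : R -> R) (x e : R) :
  (@lebesgue_measure R).-integrable `[0, 1] (EFin \o p) ->
  (@lebesgue_measure R).-integrable `[0, 1] (EFin \o g) -> 0 <= x <= 1 ->
  (\int[@lebesgue_measure R]_(t in `[0%R, 1%R]) `|p t - g t|%:E <= e%:E)%E ->
  `|cumul p x - cumul g x| <= e.
Proof.
move=> ip ig /andP[x0 x1] H.
have ip' := integrable_sub01 x1 ip; have ig' := integrable_sub01 x1 ig.
have ipg : (@lebesgue_measure R).-integrable `[0, 1] (EFin \o (fun t => p t - g t)).
  exact: (integrableB _ ip ig).
have ipg' := integrable_sub01 x1 ipg.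
rewrite /cumul -RintegralB //.
apply: (le_trans (le_normr_Rintegral _ ipg')) => //.
rewrite -lee_fin /Rintegral fineK; last first.
  by apply: integrable_fin_num => //; exact: (integrable_norm ipg').
apply: le_trans H; apply: ge0_subset_integral => //.
- exact: (measurable_int _ (integrable_norm ipg)).
- by apply: subset_itvl; rewrite bnd_simp.
Qed.

Lemma integration_by_parts_cts (R : realType) (g phi : R -> R) :
  continuous g -> (forall x : R, derivable phi x 1) -> continuous (derive1 phi) ->
  cumul (fun x => g x * phi x) 1 =
  cumul g 1 * phi 1 - cumul (fun x => cumul g x * derive1 phi x) 1.
Proof.
move=> cg dphi cdphi.
have ig := cts01_integrable (cts01_cts cg).
have cG := cts01_within (cumul_cts01 ig).
have dG x : x \in `]0, 1[ -> derivable (cumul g) x 1 /\ derive1 (cumul g) x = g x.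
  rewrite in_itv /= => /andP[x0 x1].
  exact: (continuous_FTC1_closed x1 ig x0 (cg x)).
have cphi x : {for x, continuous phi} := is_derive_cts (derivable_is_derive1 (dphi x)).
have := @Rintegration_by_parts _ (cumul g) phi g (derive1 phi) 0 1 ltr01 _ _ _ _ _ _.
rewrite -!/(cumul _ 1) => H.
rewrite H.
- by rewrite cumul0 mul0r subr0; ring.
- exact/cts01_within/cts01_cts.
- split; first by move=> x xx; exact: (dG x xx).1.
    by have /(continuous_within_itvP _ ltr01)[] := cG.
  by have /(continuous_within_itvP _ ltr01)[] := cG.
- by move=> x xx; exact: (dG x xx).2.
- exact/cts01_within/cts01_cts.
- split; first by move=> x _.
    by apply: cvg_at_right_filter; exact: cphi.
  by apply: cvg_at_left_filter; exact: cphi.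
- by move=> x _.
Qed.

(* By density of the continuous functions in [L^1]. *)
Lemma integration_by_parts_L1 (R : realType) (p phi : R -> R) :
  (@lebesgue_measure R).-integrable `[0, 1] (EFin \o p) ->
  (forall x : R, derivable phi x 1) -> continuous (derive1 phi) ->
  cumul (fun x => p x * phi x) 1 =
  cumul p 1 * phi 1 - cumul (fun x => cumul p x * derive1 phi x) 1.
Proof.
move=> ip dphi cdphi.
have cphi : cts01 phi.
  by apply: cts01_cts => x; exact: is_derive_cts (derivable_is_derive1 (dphi x)).
have cd := cts01_cts cdphi.
have [K1 K10 HK1] := cts01_bounded cphi; have [K2 K20 HK2] := cts01_bounded cd.
apply/eqP; rewrite -subr_eq0 -normr_le0; apply/ler_addgt0Pr => e e0; rewrite add0r.
pose d := e / (2 * K1 + K2).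
have d0 : 0 < d by rewrite divr_gt0 // addr_gt0 // mulr_gt0.
have [|g_ [cg ig lim]] := approximation_continuous_integrable (measurable_itv _) _ ip.
  by rewrite [X in (X < _)%E]lebesgue_measure_itv /= lte_fin ltr01 -EFinB ltry.
have [g [cg' ig' Hg]] : exists g : R -> R, [/\ continuous g,
   (@lebesgue_measure R).-integrable `[0, 1] (EFin \o g) &
   (\int[@lebesgue_measure R]_(t in `[0%R, 1%R]) `|p t - g t|%:E <= d%:E)%E].
  have /fine_cvgP[fn] := lim.
  move=> /cvgrPdist_le /(_ d d0) H.
  near \oo => n; exists (g_ n); split; [exact: cg|exact: ig|].
  have F : (\int[@lebesgue_measure R]_(z in `[0%R, 1%R]) `|(p z - g_ n z)%:E|)%E \is a fin_num.
    by near: n.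
  have : `|0 - fine (\int[@lebesgue_measure R]_(z in `[0%R, 1%R]) `|(p z - g_ n z)%:E|)%E| <= d.
    by near: n.
  rewrite sub0r normrN => H'; rewrite -(fineK F) lee_fin.
  exact: le_trans (ler_norm _) H'.
have E := integration_by_parts_cts cg' dphi cdphi.
have i1 := integrableM01 ip cphi; have i2 := integrableM01 ig' cphi.
have cp := cumul_cts01 ip; have cgg := cumul_cts01 ig'.
have i3 := cts01_integrable (cts01M cp cd); have i4 := cts01_integrable (cts01M cgg cd).
have B1 : `|cumul (fun x => p x * phi x) 1 - cumul (fun x => g x * phi x) 1| <= K1 * d.
  apply: cumul_absB => //; first by rewrite ler01 lexx.
  apply: (@le_trans _ _ (\int[@lebesgue_measure R]_(t in `[0%R, 1%R]) (K1%:E * `|p t - g t|%:E))%E).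
    apply: ge0_le_integral => //.
    - exact: (measurable_int _ (integrable_norm (integrableB _ i1 i2))).
    - exact: (measurable_int _ (integrableZl _ K1 (integrable_norm (integrableB _ ip ig')))).
    - move=> x; rewrite /= in_itv /= => x01.
      by rewrite lee_fin -mulrBl normrM mulrC ler_wpM2r // HK1.
  rewrite ge0_integralZl_EFin ?(ltW K10) //.
    by rewrite EFinM lee_pmul2l // lte_fin.
  exact: (measurable_int _ (integrable_norm (integrableB _ ip ig'))).
have B2 : `|cumul p 1 * phi 1 - cumul g 1 * phi 1| <= K1 * d.
  rewrite -mulrBl normrM mulrC ler_pM // ?HK1 ?ler01 ?lexx //.
  by apply: cumul_absB => //; rewrite ler01 lexx.
have B3 : `|cumul (fun x => cumul p x * derive1 phi x) 1
            - cumul (fun x => cumul g x * derive1 phi x) 1| <= K2 * d.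
  apply: cumul_absB => //; first by rewrite ler01 lexx.
  apply: (@le_trans _ _ (\int[@lebesgue_measure R]_(t in `[0%R, 1%R]) (cst (K2 * d)%:E t))%E).
    apply: ge0_le_integral => //.
    - exact: (measurable_int _ (integrable_norm (integrableB _ i3 i4))).
    - move=> x; rewrite /= in_itv /= => x01.
      rewrite lee_fin -mulrBl normrM mulrC ler_pM // ?HK2 //.
      exact: cumul_absB.
  by rewrite -(cumul_EFin (cts01_integrable (cts01_cst (K2 * d)))) cumul1_cst.
have arith (a a' b b' c c' k1 k2 : R) : a' = b' - c' -> `|a - a'| <= k1 ->
    `|b - b'| <= k1 -> `|c - c'| <= k2 -> `|a - (b - c)| <= k1 + k1 + k2.
  by move=> ->; rewrite !ler_norml => /andP[? ?] /andP[? ?] /andP[? ?]; apply/andP; split; lra.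
apply: le_trans (arith _ _ _ _ _ _ _ _ E B1 B2 B3) _.
by rewrite -!mulrDl -mulr2n -[X in (X + _) * _]mulr_natl mulrC divfK // gt_eqF //
   addr_gt0 // mulr_gt0.
Unshelve. all: by end_near.
Qed.

(** * Periodic extension from the unit interval *)

Definition fracpart (R : realType) (x : R) : R := x - (Num.floor x)%:~R.

Lemma fracpart_itv (R : realType) (x : R) : 0 <= fracpart x < 1.
Proof.
by have := floor_le x; have := floorD1_gt x; rewrite intrD1 /fracpart => *; apply/andP; split; lra.
Qed.

Lemma fracpart_id (R : realType) (x : R) : 0 <= x < 1 -> fracpart x = x.
Proof.
move=> /andP[x0 x1]; rewrite /fracpart (_ : Num.floor x = 0) ?subr0 //.
by apply: floor_def; rewrite add0r /= x0.
Qed.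

Lemma fracpart1 (R : realType) : fracpart (1 : R) = 0.
Proof. by rewrite /fracpart floor1 subrr. Qed.

Lemma periodic1_int (R : realType) (f : R -> R) (k : int) (x : R) :
  periodic1 f -> f (x + k%:~R) = f x.
Proof.
move=> pf; have pn (n : nat) y : f (y + n%:R) = f y.
  by elim: n => [|n IH]; rewrite ?addr0 // -natr1 addrA pf.
case: k => n; first exact: pn.
by rewrite NegzE mulrNz -(pn n.+1 (x - _)) subrK.
Qed.

Lemma periodic1_frac (R : realType) (f : R -> R) (x : R) : periodic1 f -> f (fracpart x) = f x.
Proof. by move=> pf; rewrite /fracpart -mulrNz periodic1_int. Qed.

(** As [h <= 1], the floors of two points at distance [h] differ by at most 1. If they differ, the
    comparison passes through the common value [f 0 = f 1], whence the factor 2. *)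
Lemma fracpart_modulus (R : realType) (f : R -> R) (h w : R) : f 0 = f 1 -> h <= 1 ->
  (forall a b : R, 0 <= a <= 1 -> 0 <= b <= 1 -> `|a - b| <= h -> `|f a - f b| <= w) ->
  forall x y : R, `|x - y| <= h -> `|f (fracpart x) - f (fracpart y)| <= 2 * w.
Proof.
move=> f01 h1 H.
have [h0|h0] := ltrP h 0.
  by move=> x y xy; have := normr_ge0 (x - y); lra.
have w0 : 0 <= w by have := H 0 0; rewrite !subrr !normr0 lexx ler01 /=; exact.
suff main x y : x <= y -> y - x <= h -> `|f (fracpart x) - f (fracpart y)| <= 2 * w.
  move=> x y xy; have [xley|/ltW yltx] := lerP x y; last first.
    by rewrite distrC; apply: main => //; apply: le_trans xy; exact: ler_norm.
  by apply: main => //; rewrite -opprB; apply: le_trans xy; rewrite -normrN; exact: ler_norm.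
move=> xy yx.
have /andP[x0 x1] := fracpart_itv x; have /andP[y0 y1] := fracpart_itv y.
have fx : x = fracpart x + (Num.floor x)%:~R by rewrite /fracpart subrK.
have fy : y = fracpart y + (Num.floor y)%:~R by rewrite /fracpart subrK.
have fl : (Num.floor x <= Num.floor y)%R by exact: le_floor.
have fl2 : (Num.floor y <= Num.floor x + 1)%R.
  rewrite -ltzD1 -(ltr_int R) !intrD1; lra.
have [E|E] : Num.floor y = Num.floor x \/ Num.floor y = Num.floor x + 1.
  move: fl fl2; rewrite le_eqVlt => /predU1P[->|fl fl2]; first by left.
  by right; apply/eqP; rewrite eq_le fl2 -ltzD1 ltrD2r.
- have A : `|fracpart x - fracpart y| <= h.
    by rewrite distrC ger0_norm; move: fx fy; rewrite E; lra.
  have := H (fracpart x) (fracpart y) ltac:(apply/andP; split; lra) ltac:(apply/andP; split; lra) A.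
  by lra.
- rewrite E intrD1 in fy.
  have A1 : `|fracpart x - 1| <= h by rewrite distrC ger0_norm; lra.
  have A2 : `|0 - fracpart y| <= h by rewrite distrC ger0_norm subr0; lra.
  have B1 := H (fracpart x) 1 ltac:(apply/andP; split; lra) ltac:(apply/andP; split; lra) A1.
  have B2 := H 0 (fracpart y) ltac:(apply/andP; split; lra) ltac:(apply/andP; split; lra) A2.
  rewrite (_ : f (fracpart x) - f (fracpart y) = (f (fracpart x) - f 1) + (f 0 - f (fracpart y))).
    by apply: (le_trans (ler_normD _ _)); lra.
  by rewrite f01; ring.
Qed.

(** By the mean value theorem a continuous candidate for the derivative extends over one exceptional
    point. It carries the profile equation across the integers. *)
Lemma is_derive_of_cts_derive (R : realType) (f df : R -> R) (x h : R) :
  0 < h -> {for x, continuous f} -> {for x, continuous df} ->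
  (forall y : R, 0 < `|y - x| < h -> is_derive y 1 f (df y)) ->
  is_derive x 1 f (df x).
Proof.
move=> h0 cf cdf dfy; apply: eps_is_derive => e e0.
have [k k0 kk] := cts_eps cdf e0.
have cfy y : `|y - x| < h -> {for y, continuous f}.
  have [->//|yx] := eqVneq y x; move=> yh; apply: is_derive_cts (dfy y _).
  by rewrite normr_gt0 subr_eq0 yx.
exists (Num.min h k); first by rewrite lt_min h0.
move=> u; rewrite lt_min => /andP[uh uk].
have [ux|xu|->] := ltgtP u x; last by rewrite !subrr mulr0 subr0 normr0 mulr0.
- have xu0 : `|u - x| = x - u by rewrite ltr0_norm ?subr_lt0 // opprB.
  rewrite xu0 in uh uk *.
  have H1 y : u <= y <= x -> {for y, continuous f}.
    by move=> /andP[y1 y2]; apply: cfy; rewrite ler0_norm; lra.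
  have H2 y : u < y < x -> is_derive y 1 f (df y).
    by move=> /andP[y1 y2]; apply: dfy; rewrite ltr0_norm; [apply/andP; split; lra|lra].
  have [c /andP[c1 c2] E] := mean_value ux H1 H2.
  have -> : f u - f x - df x * (u - x) = (df c - df x) * (u - x) by lra.
  rewrite normrM xu0 ler_wpM2r //; first by lra.
  by apply: kk; rewrite ltr0_norm; lra.
- have xu0 : `|u - x| = u - x by rewrite gtr0_norm ?subr_gt0.
  rewrite xu0 in uh uk *.
  have H1 y : x <= y <= u -> {for y, continuous f}.
    by move=> /andP[y1 y2]; apply: cfy; rewrite ger0_norm; lra.
  have H2 y : x < y < u -> is_derive y 1 f (df y).
    by move=> /andP[y1 y2]; apply: dfy; rewrite gtr0_norm; [apply/andP; split; lra|lra].
  have [c /andP[c1 c2] E] := mean_value xu H1 H2.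
  have -> : f u - f x - df x * (u - x) = (df c - df x) * (u - x) by lra.
  rewrite normrM xu0 ler_wpM2r //; first by lra.
  by apply: kk; rewrite gtr0_norm; lra.
Qed.

(** * The flux and its increments *)

Definition bulk_flux (R : realType) (W : R -> R) (eps : R) (rho : R -> R) (x : R) : R :=
  Qp W (rho x) + 3 * eps ^+ 2 / 2 * (derive1 rho x) ^+ 2.

Lemma intT_EFin (R : realType) (f : R -> R) :
  (@lebesgue_measure R).-integrable `[0, 1] (EFin \o f) -> intT f = (cumul f 1)%:E.
Proof. by move=> fi; rewrite cumul_EFin. Qed.

Lemma sqr_integrable (R : realType) (g : R -> R) :
  measurable_fun setT g -> (intT (fun x => (g x ^+ 2)%R) < +oo)%E ->
  (@lebesgue_measure R).-integrable `[0, 1] (EFin \o (fun x => g x ^+ 2)).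
Proof.
move=> mg fing; apply/integrableP; split.
  by apply/measurable_EFinP/measurable_funTS; exact: measurable_funX.
suff -> : (\int[@lebesgue_measure R]_(x in `[0%R, 1%R]) `|(EFin \o (fun x => (g x ^+ 2)%R)) x|)%E
    = intT (fun x => (g x ^+ 2)%R) by [].
by apply: eq_integral => x _; rewrite /= ger0_norm // sqr_ge0.
Qed.

Lemma sqrt_mul_le (R : realType) (r g t : R) : 0 <= r -> 0 < t ->
  t * `|Num.sqrt r * g| <= (t ^+ 2 * r + g ^+ 2) / 2.
Proof.
move=> r0 t0; rewrite normrM (ger0_norm (sqrtr_ge0 r)).
have := sqr_ge0 (t * Num.sqrt r - `|g|).
have -> : (t * Num.sqrt r - `|g|) ^+ 2 =
   t ^+ 2 * (Num.sqrt r ^+ 2) + `|g| ^+ 2 - 2 * (t * (Num.sqrt r * `|g|)) by ring.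
by rewrite sqr_sqrtr // real_normK ?num_real //; lra.
Qed.

Lemma continuous_bulk_flux (R : realType) (W : R -> R) (eps : R) (rho : R -> R) :
  (forall x : R, derivable W x 1) -> continuous (derive1 W) -> C1T rho ->
  continuous (bulk_flux W eps rho).
Proof.
move=> dW cW [_ [drho cv]] x.
have crho : {for x, continuous rho} := is_derive_cts (derivable_is_derive1 (drho x)).
have cWr : {for x, continuous (W \o rho)}.
  by apply: continuous_comp => //; exact: is_derive_cts (derivable_is_derive1 (dW _)).
have cW'r : {for x, continuous (derive1 W \o rho)}.
  by apply: continuous_comp => //; exact: cW.
apply: cvgD; first by apply: cvgB => //; apply: cvgM.
apply: cvgM; first exact: cvg_cst.
by rewrite expr2; apply: cvgM; exact: cv.
Qed.

Lemma cumul_cst (R : realType) (K x : R) : 0 <= x -> x <= 1 -> cumul (fun=> K) x = K * x.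
Proof.
move=> x0 x1; rewrite /cumul Rintegral_cst //.
have E : @lebesgue_measure R `[0, x]%classic = x%:E.
  rewrite lebesgue_measure_itv /= lte_fin; case: ltP => h.
    by rewrite -EFinB subr0.
  by congr EFin; apply/eqP; rewrite eq_le h x0.
by congr (_ * _); exact: (congr1 fine E).
Qed.

Lemma cumul_lipschitz (R : realType) (f : R -> R) (K a b : R) :
  (@lebesgue_measure R).-integrable `[0, 1] (EFin \o f) ->
  (forall x : R, 0 <= x <= 1 -> f x <= K) -> 0 <= a -> a <= b -> b <= 1 ->
  cumul f b - cumul f a <= K * (b - a).
Proof.
move=> fi fK a0 ab b1.
have iK := cts01_integrable (cts01_cst K).
rewrite mulrBr -(cumul_cst K (le_trans a0 ab) b1) -(cumul_cst K a0 (le_trans ab b1)).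
rewrite (cumulB fi a0 ab b1) (cumulB iK a0 ab b1).
have iS (h : R -> R) : (@lebesgue_measure R).-integrable `[0, 1] (EFin \o h) ->
    (@lebesgue_measure R).-integrable `]a, b] (EFin \o h).
  move=> hi; apply: integrableS hi => //.
  by apply: subset_itv; rewrite bnd_simp.
apply: le_Rintegral => //; [exact: iS|exact: iS|].
by move=> x; rewrite /= in_itv /= => /andP[x1 x2]; apply: fK; apply/andP; split; lra.
Qed.

Lemma cumul_homo (R : realType) (f : R -> R) (a b : R) :
  (@lebesgue_measure R).-integrable `[0, 1] (EFin \o f) ->
  (forall x, 0 <= f x) -> 0 <= a -> a <= b -> b <= 1 -> cumul f a <= cumul f b.
Proof.
move=> fi f0 a0 ab b1; rewrite -subr_ge0 (cumulB fi a0 ab b1).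
by apply: Rintegral_ge0 => x _; exact: f0.
Qed.

Lemma cumul1_abs_le (R : realType) (f : R -> R) (K : R) : cts01 f ->
  (forall x : R, 0 <= x <= 1 -> `|f x| <= K) -> `|cumul f 1| <= K.
Proof.
move=> cf fK; have fi := cts01_integrable cf.
apply: (le_trans (le_normr_Rintegral _ fi)) => //.
rewrite -[leRHS](cumul1_cst K); apply: le_Rintegral => //.
- exact: (integrable_norm fi).
- exact: (cts01_integrable (cts01_cst K)).
Qed.

(* Cauchy-Schwarz in the form of AM-GM: an increment of [F] is at most
   [(t dc + dm / t) / 2], so choosing [t] large makes it small. *)
Lemma modulus_of_increments (R : realType) (K L e : R) : 0 <= K -> 0 <= L -> 0 < e ->
  exists h : R, [/\ 0 < h, h <= 1 & forall F c m : R -> R,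
    (forall a b t : R, 0 <= a -> a <= b -> b <= 1 -> 0 < t ->
      t * `|F b - F a| <= (t ^+ 2 * (c b - c a) + (m b - m a)) / 2) ->
    (forall a b : R, 0 <= a -> a <= b -> b <= 1 -> c b - c a <= K * (b - a)) ->
    (forall a b : R, 0 <= a -> a <= b -> b <= 1 -> m b - m a <= L) ->
    forall a b : R, 0 <= a <= 1 -> 0 <= b <= 1 -> `|a - b| <= h -> `|F a - F b| <= e].
Proof.
move=> K0 L0 e0.
(* [t] is chosen so that the [m] term is at most [t * e], and [k] so that [t ^+ 2] times the [c]
   term is too; half their sum is [t * e]. Adding 1 keeps [t] and [k] meaningful when [L] or [K] is
   0. *)
pose t := (L + 1) / e; have t0 : 0 < t by rewrite divr_gt0 // ltr_wpDl.
have te : t * e = L + 1 by rewrite /t divfK // gt_eqF.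
pose k := e / (t * (K + 1)).
have tK0 : 0 < t * (K + 1) by rewrite mulr_gt0 // ltr_wpDl.
have k0 : 0 < k by rewrite divr_gt0.
have kE : k * (t * (K + 1)) = e by rewrite /k divfK // gt_eqF.
exists (Num.min 1 k); split; [by rewrite lt_min ltr01|by rewrite ge_min lexx|].
move=> F c m HF Hc Hm.
have key a b : 0 <= a -> a <= b -> b <= 1 -> b - a <= k -> `|F b - F a| <= e.
  move=> a0 ab b1 bak.
  have H1 := HF a b t a0 ab b1 t0; have H2 := Hc a b a0 ab b1; have H3 := Hm a b a0 ab b1.
  have H4 : K * (b - a) <= (K + 1) * k.
    by apply: ler_pM => //; [rewrite subr_ge0|rewrite lerDl].
  have H5 : t ^+ 2 * (c b - c a) <= t ^+ 2 * ((K + 1) * k).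
    by rewrite ler_pM2l ?exprn_gt0 //; exact: le_trans H2 H4.
  have H6 : t ^+ 2 * ((K + 1) * k) = t * e by rewrite -[in RHS]kE; ring.
  by rewrite -(ler_pM2l t0); lra.
move=> a b /andP[a0 a1] /andP[b0 b1]; rewrite le_min => /andP[_ abk].
have [ab|ba] := leP a b.
  rewrite distrC; apply: key => //; rewrite -opprB; apply: le_trans abk.
  by rewrite -normrN; exact: ler_norm.
by apply: key => //; [exact: ltW|apply: le_trans abk; exact: ler_norm].
Qed.

(** The identity is integrated twice against trigonometric polynomials: with [P] a primitive of
    [sqrt rho * g] and [H] a primitive of [A - F0], everything falls on the second derivative of the
    test function, so [B - H] is constant. *)
Lemma ode_of_Teps (R : realType) (W : R -> R) (eps : R) (rho g : R -> R) :
  (forall x : R, derivable W x 1) -> continuous (derive1 W) ->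
  densityT rho -> C1T rho -> Teps W eps rho g ->
  exists F : R -> R, [/\ ode_profile W eps rho (derive1 rho) F,
    F 0 = F 1, forall x, F (fracpart x) = F x,
    forall x : R, `|F x| <= `|cumul (bulk_flux W eps rho) 1| + 1 +
                            cumul (fun y => g y ^+ 2) 1 &
    forall a b t : R, 0 <= a -> a <= b -> b <= 1 -> 0 < t ->
      t * `|F b - F a| <= (t ^+ 2 * (cumul rho b - cumul rho a) +
        (cumul (fun y => g y ^+ 2) b - cumul (fun y => g y ^+ 2) a)) / 2].
Proof.
move=> dW cW drho C1 [mg [fing pairing]].
have [prho [derho cv]] := C1; have [_ [mrho [rho0 rho1]]] := drho.
set v := derive1 rho in cv *.
set A := bulk_flux W eps rho.
have cA : continuous A by exact: continuous_bulk_flux.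
have crho x : {for x, continuous rho} := is_derive_cts (derivable_is_derive1 (derho x)).
pose p x := Num.sqrt (rho x) * g x.
pose B x := eps ^+ 2 * (rho x * v x).
have cB : continuous B.
  by move=> x; apply: cvgM; [exact: cvg_cst|apply: cvgM; [exact: crho|exact: cv]].
have pv : periodic1 v.
  move=> x; rewrite /v.
  have E : (fun y => rho (y + 1)) = rho by apply/funext => y; rewrite prho.
  have d1 : is_derive x 1 (fun y : R => y + 1) (1 + 0).
    exact: deriveD_fun (is_derive_id x 1) (is_derive_cst (1 : R) x 1).
  have := @derive_comp_fun _ rho (fun y => y + 1) x _ _
    (derivable_is_derive1 (derho (x + 1))) d1.
  by rewrite E addr0 mulr1 => /is_derive1E ->.
have pA : periodic1 A by move=> x; rewrite /A /bulk_flux -/v prho pv.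
have pB : periodic1 B by move=> x; rewrite /B prho pv.
have irho := density_integrable drho.
have ig2 := sqr_integrable mg fing.
set g2 := fun y => g y ^+ 2 in ig2 *.
have mp : measurable_fun setT p.
  apply: measurable_funM => //.
  exact: (measurableT_comp (continuous_measurable_fun (@sqrt_continuous R)) mrho).
have is_ t : (@lebesgue_measure R).-integrable `[0, 1] (EFin \o (fun x => (t ^+ 2 * rho x + g2 x) / 2)).
  have -> : EFin \o (fun x => (t ^+ 2 * rho x + g2 x) / 2) =
    (fun x => (2^-1)%:E * (((t ^+ 2)%:E * (EFin \o rho) x) + (EFin \o g2) x))%E.
    by apply/funext => x /=; rewrite -!EFinM mulrC.
  by apply: integrableZl => //; apply: integrableD => //; exact: integrableZl.
have ip : (@lebesgue_measure R).-integrable `[0, 1] (EFin \o p).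
  apply: le_integrable (is_ 1) => //; first by apply/measurable_EFinP; exact: measurable_funTS.
  move=> x _; rewrite lee_fin -[leLHS]mul1r.
  exact: le_trans (sqrt_mul_le _ (rho0 x) ltr01) (ler_norm _).
pose P := cumul p.
have cP : cts01 P := cumul_cts01 ip.
have cA1 := cts01_cts cA; have cB1 := cts01_cts cB.
have pair phi : trigpoly phi ->
    cumul (fun x => A x * derive1 phi x) 1 + cumul (fun x => B x * derive1 (derive1 phi) x) 1
    = - cumul (fun x => p x * phi x) 1.
  move=> tphi; have [d1 t1] := trigpoly_derive tphi; have [d2 t2] := trigpoly_derive t1.
  have := pairing phi (trigpoly_smooth tphi).
  have c1 := cts01_cts (trigpoly_cts tphi).
  have c2 := cts01_cts (trigpoly_cts t1); have c3 := cts01_cts (trigpoly_cts t2).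
  rewrite [RHS]intT_EFin; last exact: integrableM01.
  rewrite /Gpair.
  rewrite (intT_EFin (cts01_integrable (cts01M cA1 c2))).
  rewrite (intT_EFin (cts01_integrable (cts01M cB1 c3))).
  by rewrite -EFinD -EFinN => -[] <-; rewrite opprK.
(* Testing with the constant 1 shows that [sqrt rho * g] has mean zero, so its primitive is
   periodic. *)
have P1 : P 1 = 0.
  have := pair _ (trigpoly_wave 1 0 0).
  have W1 : wave (1 : R) 0 0 = cst 1.
    by apply/funext => x; rewrite /wave mulr0 mul0r add0r cos0 mulr1.
  have E c : derive1 (cst c : R -> R) = cst 0.
    by apply/funext => y; exact: is_derive1E (is_derive_cst _ _ _).
  rewrite W1 !E.
  have -> : (fun x => A x * cst 0 x) = cst 0 by apply/funext => x; rewrite mulr0.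
  have -> : (fun x => B x * cst 0 x) = cst 0 by apply/funext => x; rewrite mulr0.
  have -> : (fun x => p x * cst 1 x) = p by apply/funext => x; rewrite mulr1.
  by rewrite cumul1_cst /P; lra.
(* The free constant of the flux is fixed so that [A - F0] has mean zero; then the boundary term of
   the second integration by parts vanishes. *)
pose m := cumul (fun x => A x - P x) 1.
pose F0 x := P x + m.
have cF0 : cts01 F0 by exact: cts01D cP (cts01_cst m).
have cAF := cts01B cA1 cF0.
have iAF := cts01_integrable cAF.
pose H := cumul (fun x => A x - F0 x).
have H1 : H 1 = 0.
  rewrite /H (_ : (fun x => A x - F0 x) = (fun x => (A x - P x) - m)); last first.
    by apply/funext => x; rewrite /F0; ring.
  rewrite cumul1B; [by rewrite cumul1_cst -/m subrr|exact: cts01B|exact: cts01_cst].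
have cH : cts01 H := cumul_cts01 iAF.
have cBH := cts01B cB1 cH.
have const : forall x : R, 0 < x < 1 -> B x - H x = cumul (fun x => B x - H x) 1.
  apply: du_bois_reymond => // phi tphi.
  have [d1 t1] := trigpoly_derive tphi; have [d2 t2] := trigpoly_derive t1.
  have c1 := cts01_cts (trigpoly_cts tphi).
  have c2 := cts01_cts (trigpoly_cts t1); have c3 := cts01_cts (trigpoly_cts t2).
  have E1 := pair phi tphi.
  rewrite (integration_by_parts_L1 ip d1 (trigpoly_cts t1)) -/P P1 mul0r sub0r opprK in E1.
  have E2 := integration_by_parts_L1 iAF d2 (trigpoly_cts t2).
  rewrite -/H H1 mul0r sub0r in E2.
  have -> : (fun x => (B x - H x) * derive1 (derive1 phi) x) =
     (fun x => B x * derive1 (derive1 phi) x - H x * derive1 (derive1 phi) x).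
    by apply/funext => x; ring.
  rewrite cumul1B; [|exact: cts01M|exact: cts01M].
  have E3 : cumul (fun x => (A x - F0 x) * derive1 phi x) 1 =
     cumul (fun x => A x * derive1 phi x) 1 - cumul (fun x => P x * derive1 phi x) 1.
    have -> : (fun x => (A x - F0 x) * derive1 phi x) =
      (fun x => (A x * derive1 phi x - P x * derive1 phi x) - m * derive1 phi x).
      by apply/funext => x; rewrite /F0; ring.
    rewrite cumul1B; [|by apply: cts01B; exact: cts01M|exact: cts01M (cts01_cst m) c2].
    rewrite cumul1B; [|exact: cts01M|exact: cts01M].
    by rewrite cumul1Z // cumul_derive_trigpoly // mulr0 subr0.
  move: E1 E2; rewrite {}E3.
  have arith (X1 X2 X3 X4 : R) : X1 + X2 = X3 -> X1 - X3 = - X4 -> X2 - X4 = 0 by lra.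
  exact: arith.
pose F x := F0 (fracpart x).
have F01 : F0 0 = F0 1 by rewrite /F0 /P cumul0 -/P P1.
have FF0 x : 0 <= x <= 1 -> F x = F0 x.
  move=> /andP[x0]; rewrite le_eqVlt => /predU1P[->|x1]; first by rewrite /F fracpart1.
  by rewrite /F fracpart_id // x0.
have incr a b t : 0 <= a -> a <= b -> b <= 1 -> 0 < t ->
    t * `|F0 b - F0 a| <= (t ^+ 2 * (cumul rho b - cumul rho a) + (cumul g2 b - cumul g2 a)) / 2.
  move=> a0 ab b1 t0.
  have sub : `]a, b] `<=` `[0, 1 : R].
    by apply: subset_itv; rewrite bnd_simp.
  have iS (f : R -> R) : (@lebesgue_measure R).-integrable `[0, 1] (EFin \o f) ->
      (@lebesgue_measure R).-integrable `]a, b] (EFin \o f).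
    by move=> fi; apply: integrableS fi => //; exact: measurable_itv.
  have -> : F0 b - F0 a = P b - P a by rewrite /F0; ring.
  rewrite /P (cumulB ip a0 ab b1) (cumulB irho a0 ab b1) (cumulB ig2 a0 ab b1).
  have ipab := iS _ ip.
  apply: (@le_trans _ _ (t * \int[@lebesgue_measure R]_(x in `]a, b]) `|p x|)).
    by rewrite ler_pM2l //; exact: le_normr_Rintegral.
  rewrite -RintegralZl //; last exact: (integrable_norm ipab).
  apply: (@le_trans _ _ (\int[@lebesgue_measure R]_(x in `]a, b]) ((t ^+ 2 * rho x + g2 x) / 2))).
    apply: le_Rintegral => //.
    - exact: (integrableZl _ t (integrable_norm ipab)).
    - exact: iS (is_ t).
    - by move=> x _; exact: sqrt_mul_le.
  have i1 := iS _ irho; have i2 := iS _ ig2.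
  rewrite le_eqVlt; apply/orP; left; apply/eqP.
  rewrite RintegralZr //; last first.
    exact: (integrableD _ (integrableZl _ (t ^+ 2) i1) i2).
  rewrite RintegralD //; last exact: (integrableZl _ (t ^+ 2) i1).
  by rewrite RintegralZl.
have g20 x : 0 <= g2 x by exact: sqr_ge0.
have L0 : 0 <= cumul g2 1 by apply: Rintegral_ge0 => x _; exact: g20.
have [K K0 rK] := cts01_bounded (cts01_cts crho).
have pF x : F (fracpart x) = F x by rewrite /F fracpart_id // fracpart_itv.
have cF : continuous F.
  move=> x; apply: eps_cts => e e0; have e2 : 0 < e / 2 by lra.
  have [h [h0 h1 Hh]] := modulus_of_increments (ltW K0) L0 e2.
  exists h => // u /ltW ux; rewrite (_ : e = 2 * (e / 2)); last by lra.
  apply: (fracpart_modulus F01 h1) ux; apply: (Hh F0 (cumul rho) (cumul g2)) => //.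
    move=> a b a0 ab b1; apply: cumul_lipschitz => // y y01.
    exact: le_trans (ler_norm _) (rK y y01).
  move=> a b a0 ab b1.
  have := cumul_homo ig2 g20 (le_trans a0 ab) b1 (lexx 1).
  by have := cumul_homo ig2 g20 (lexx 0) a0 (le_trans ab b1); rewrite cumul0; lra.
have dB01 (x : R) : 0 < x < 1 -> is_derive x 1 B (A x - F x).
  move=> /andP[x0 x1]; pose f x := A x - F x.
  have cf : continuous f by move=> y; apply: cvgB; [exact: cA|exact: cF].
  have [d1 d2] := continuous_FTC1_closed x1 (cts01_integrable (cts01_cts cf)) x0 (cf x).
  have dH : is_derive x 1 (cumul f) (f x) by rewrite -d2; exact: derivable_is_derive1.
  pose cst0 := cumul (fun x => B x - H x) 1.
  have dH' := deriveD_fun dH (is_derive_cst cst0 x 1).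
  rewrite addr0 in dH'.
  have h0 : 0 < Num.min x (1 - x) by rewrite lt_min x0 subr_gt0.
  apply: (is_derive_near h0 _ dH') => r; rewrite lt_min ltr_norml => /andP[/andP[r1 r2]].
  rewrite ltr_norml => /andP[r3 r4].
  have r01 : 0 < r < 1 by apply/andP; split; lra.
  have -> : cumul f r = H r.
    apply: eq_Rintegral => z; rewrite inE /= in_itv /= => /andP[z0 zr].
    by rewrite /f FF0 // z0; lra.
  by have := const r r01; rewrite /cst0 /=; lra.
have dBn (x : R) : 0 < fracpart x -> is_derive x 1 B (A x - F x).
  move=> y0; have /andP[_ y1] := fracpart_itv x.
  have y01 : 0 < fracpart x < 1 by rewrite y0.
  have := dB01 _ y01; rewrite pF (periodic1_frac _ pA) => dy.
  have d1 : is_derive x 1 (fun y : R => y + (- (Num.floor x))%:~R) (1 + 0).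
    exact: deriveD_fun (is_derive_id x 1) (is_derive_cst _ x 1).
  have E : fracpart x = x + (- (Num.floor x))%:~R by rewrite /fracpart mulrNz.
  rewrite E in dy.
  have := @derive_comp_fun _ B (fun y => y + (- (Num.floor x))%:~R) x _ _ dy d1.
  have -> : (fun y => B (y + (- Num.floor x)%:~R)) = B.
    by apply/funext => y; rewrite periodic1_int.
  by rewrite addr0 mulr1.
(* The test functions give the equation inside each period. At the integers it follows from the
   continuity of [A - F]. *)
have dB (x : R) : is_derive x 1 B (A x - F x).
  have /andP[] := fracpart_itv x; rewrite le_eqVlt => /predU1P[x0 _|x0 _]; last exact: dBn.
  apply: (@is_derive_of_cts_derive _ B (fun x => A x - F x) x 1 ltr01 (cB x)).
    by apply: cvgB; [exact: cA|exact: cF].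
  move=> y /andP[yx1 yx2]; apply: dBn.
  have /andP[] := fracpart_itv y; rewrite le_eqVlt => /predU1P[y0 _|//].
  have Ex : x = (Num.floor x)%:~R by apply/eqP; rewrite -subr_eq0; apply/eqP.
  have Ey : y = (Num.floor y)%:~R by apply/eqP; rewrite -subr_eq0; apply/eqP.
  move: yx1 yx2; rewrite Ex Ey -intrB -intr_norm ltr0z ltrz1 => n0 n1.
  by move: n0; rewrite gtz0_ge1 leNgt n1.
have ode : ode_profile W eps rho v F.
  split; [move=> x; exact: derivable_is_derive1|exact: cv|exact: rho0|exact: dB].
have F01' : F 0 = F 1 by rewrite !FF0 ?F01 ?lexx ?ler01.
have Fbound x : `|F x| <= `|cumul A 1| + 1 + cumul g2 1.
  rewrite -pF; have /andP[y0 /ltW y1] := fracpart_itv x.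
  set y := fracpart x in y0 y1 *.
  have Pb z : 0 <= z <= 1 -> `|P z| <= (1 + cumul g2 1) / 2.
    move=> /andP[z0 z1]; have := incr 0 z 1 (lexx 0) z0 z1 ltr01.
    have -> : F0 z - F0 0 = P z by rewrite /F0 /P cumul0; ring.
    rewrite !cumul0 !subr0 mul1r expr1n mul1r.
    have := cumul_homo irho rho0 z0 z1 (lexx 1); rewrite (cumul_density1 drho).
    have := cumul_homo ig2 g20 z0 z1 (lexx 1).
    have arith (a b c d : R) : b <= d -> a <= 1 -> c <= (a + b) / 2 -> c <= (1 + d) / 2 by lra.
    exact: arith.
  have Py : `|P y| <= (1 + cumul g2 1) / 2 by apply: Pb; rewrite y0.
  have P1b := cumul1_abs_le cP Pb.
  rewrite FF0 ?y0 // /F0 /m cumul1B //.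
  apply: (le_trans (ler_normD _ _)); have := ler_normB (cumul A 1) (cumul P 1).
  move: Py P1b; rewrite -/P.
  have arith (a b c d e : R) : a <= (1 + e) / 2 -> b <= (1 + e) / 2 -> c <= d + b ->
    a + c <= d + 1 + e by lra.
  exact: arith.
exists F; split; [exact: ode|exact: F01'|exact: pF|exact: Fbound|].
move=> a b t a0 ab b1 t0; rewrite !FF0 ?a0 ?b1 ?(le_trans a0 ab) ?(le_trans ab b1) //.
exact: incr.
Qed.

(** * Estimates uniform in the small parameter *)

Definition potential (R : realType) (W : R -> R) : Prop :=
  [/\ forall x : R, derivable W x 1, continuous (derive1 W),
      forall y : R, 0 <= y -> 0 <= W y & W 0 = 0].

Lemma Eeps_cumul (R : realType) (W : R -> R) (eps M0 : R) (rho : R -> R) :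
  potential W -> C1T rho -> (Eeps W eps rho <= M0%:E)%E ->
  cts01 (fun x => eps ^+ 2 / 2 * (derive1 rho x) ^+ 2 + W (rho x)) /\
  cumul (fun x => eps ^+ 2 / 2 * (derive1 rho x) ^+ 2 + W (rho x)) 1 <= M0.
Proof.
move=> [dW _ _ _] [_ [drho cv]]; rewrite /Eeps; case: asboolP => // _ H.
have ce : cts01 (fun x => eps ^+ 2 / 2 * (derive1 rho x) ^+ 2 + W (rho x)).
  apply: cts01_cts => x; apply: cvgD.
    by apply: cvgM; [exact: cvg_cst|rewrite expr2; apply: cvgM; exact: cv].
  apply: (@continuous_comp _ _ _ rho W).
    exact: is_derive_cts (derivable_is_derive1 (drho x)).
  exact: is_derive_cts (derivable_is_derive1 (dW _)).
by split=> //; move: H; rewrite intT_EFin ?lee_fin //; exact: cts01_integrable.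
Qed.

(** Pointwise the flux is at most [C] plus [C + 3] times the energy density: [C] pays for the
    potential and 3 for the kinetic term. *)
Lemma bulk_flux_bound (R : realType) (W : R -> R) (eps M0 C : R) (rho : R -> R) :
  potential W -> (forall y : R, 0 <= y -> `|Qp W y| <= C * (1 + W y)) -> 0 < C ->
  densityT rho -> C1T rho -> (Eeps W eps rho <= M0%:E)%E ->
  `|cumul (bulk_flux W eps rho) 1| <= C + (C + 3) * M0.
Proof.
move=> pW HC C0 drho C1 HE; have [dW cW W0 _] := pW; have [_ [_ [rho0 _]]] := drho.
have [ce He] := Eeps_cumul pW C1 HE.
set e := (fun x => _) in ce He.
have cA := cts01_cts (@continuous_bulk_flux _ W eps rho dW cW C1).
have iA := cts01_integrable cA.
apply: (le_trans (le_normr_Rintegral _ iA)) => //.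
have cD : cts01 (fun x => C + (C + 3) * e x).
  by apply: cts01D; [exact: cts01_cst|apply: cts01M => //; exact: cts01_cst].
apply: (@le_trans _ _ (cumul (fun x => C + (C + 3) * e x) 1)).
  apply: le_Rintegral => //; [exact: (integrable_norm iA)|exact: cts01_integrable|].
  move=> x _; rewrite /bulk_flux /e.
  apply: (le_trans (ler_normD _ _)).
  have Hx := HC _ (rho0 x); have Wx := W0 _ (rho0 x).
  have v0 : 0 <= eps ^+ 2 * (derive1 rho x) ^+ 2 by rewrite mulr_ge0 // sqr_ge0.
  rewrite [X in _ + X]ger0_norm; last by lra.
  by nra.
rewrite cumul1D; [|exact: cts01_cst|by apply: cts01M => //; exact: cts01_cst].
rewrite cumul1_cst cumul1Z // lerD2l ler_wpM2l //.
by rewrite addr_ge0 // ltW.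
Qed.

(** At a maximum above [M] the value of Q' would exceed [CF], against Q' <= F. Periodicity provides
    the maximum. *)
Lemma ode_bounded (R : realType) (W : R -> R) (eps CF M : R) (rho v F : R -> R) :
  ode_profile W eps rho v F -> 0 < eps -> periodic1 rho -> 0 <= M ->
  (forall y, M < y -> CF < Qp W y) -> (forall x, F x <= CF) -> forall x, rho x <= M.
Proof.
move=> ode eps0 prho M0 HQ HF; have [drho cv rge dB] := ode.
have cr : cts01 rho by apply: cts01_cts => x; exact: is_derive_cts (drho x).
have [c _ Hc] := EVT_max ler01 (cts01_within cr).
have Hmax x : rho x <= rho c.
  rewrite -(periodic1_frac x prho); apply: Hc; rewrite in_itv /=.
  by have /andP[-> /ltW ->] := fracpart_itv x.
move=> x; apply: (le_trans (Hmax x)); rewrite leNgt; apply/negP => cM.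
have c0 : 0 < rho c by lra.
have := ode_max ode eps0 c0 Hmax; have := HQ _ cM; have := HF c.
by lra.
Qed.

Lemma ode_contact_flux (R : realType) (W : R -> R) (eps M L2 delta h : R)
    (rho v F m : R -> R) :
  potential W -> ode_profile W eps rho v F -> 0 < eps -> 0 < delta ->
  0 < h -> (forall x : R, rho x <= M) ->
  (forall x y : R, `|x - y| <= h -> `|F x - F y| <= delta / 2) ->
  4 * eps ^+ 2 * M ^+ 2 < h ^+ 2 * delta ->
  forall x : R, Wss W (rho x) = W (rho x) -> `|F x - Qp W (rho x)| <= delta.
Proof.
move=> [dW cW W0 W00] ode eps0 d0 h0 rM HF small x contact; have [_ _ rge _] := ode.
apply: (ode_contact ode dW W00 rM eps0 d0 h0) => //.
  by move=> c; exact: HF.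
move=> r0 r rr.
apply: (@le_trans _ _ (Wss W r)); last exact: Wss_le.
exact: (Wss_contact_tangent W0 r0 (derivable_is_derive1 (dW _)) contact).
Qed.

(* Between two points the value of [Qssp W \o rho] can only change across
   contact points, where it follows the flux [F]. *)
Lemma Qssp_increments (R : realType) (W : R -> R) (delta : R) (rho F c m : R -> R) :
  potential W -> continuous rho -> (forall x, 0 <= rho x) -> 0 <= delta ->
  (forall x : R, Wss W (rho x) = W (rho x) -> `|F x - Qp W (rho x)| <= delta) ->
  (forall a b : R, 0 <= a -> a <= b -> b <= 1 -> c a <= c b) ->
  (forall a b : R, 0 <= a -> a <= b -> b <= 1 -> m a <= m b) ->
  (forall a b t : R, 0 <= a -> a <= b -> b <= 1 -> 0 < t ->
      t * `|F b - F a| <= (t ^+ 2 * (c b - c a) + (m b - m a)) / 2) ->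
  forall a b t : R, 0 <= a -> a <= b -> b <= 1 -> 0 < t ->
    t * `|Qssp W (rho b) - Qssp W (rho a)| <=
      (t ^+ 2 * (c b - c a) + (m b - m a)) / 2 + 2 * t * delta.
Proof.
move=> [dW cW W0 W00] crho rho0 d0 HK cmono mmono HF a b t a0 ab b1 t0.
have rhs0 : 0 <= (t ^+ 2 * (c b - c a) + (m b - m a)) / 2.
  apply: divr_ge0 => //; apply: addr_ge0; last by rewrite subr_ge0; exact: mmono.
  by apply: mulr_ge0; [exact: sqr_ge0|rewrite subr_ge0; exact: cmono].
have td : 0 <= 2 * t * delta.
  by apply: mulr_ge0 => //; apply: mulr_ge0 => //; exact: ltW.
(* The contact values found between [rho a] and [rho b] are attained inside [a, b], so the flux can
   be read at points there. *)
have ivt s : Num.min (rho a) (rho b) <= s <= Num.max (rho a) (rho b) ->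
    exists2 x : R, a <= x <= b & rho x = s.
  move=> Hs; have [x] := IVT ab (cts_within (fun x _ => crho x)) Hs.
  by rewrite in_itv /=; exists x.
have inner x1 x2 : a <= x1 <= b -> a <= x2 <= b ->
    t * `|F x2 - F x1| <= (t ^+ 2 * (c b - c a) + (m b - m a)) / 2.
  have main u w : a <= u -> u <= w -> w <= b ->
      t * `|F w - F u| <= (t ^+ 2 * (c b - c a) + (m b - m a)) / 2.
    move=> au uw wb.
    apply: (le_trans (HF u w t (le_trans a0 au) uw (le_trans wb b1) t0)).
    have c1 := cmono a u a0 au (le_trans uw (le_trans wb b1)).
    have c2 := cmono w b (le_trans a0 (le_trans au uw)) wb b1.
    have m1 := mmono a u a0 au (le_trans uw (le_trans wb b1)).
    have m2 := mmono w b (le_trans a0 (le_trans au uw)) wb b1.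
    have : t ^+ 2 * (c w - c u) <= t ^+ 2 * (c b - c a).
      by rewrite ler_wpM2l ?sqr_ge0 //; lra.
    by lra.
  move=> /andP[ax1 x1b] /andP[ax2 x2b]; have [x12|/ltW x21] := leP x1 x2.
    exact: main.
  by rewrite distrC; exact: main.
have key y z : 0 <= y -> (y = rho a /\ z = rho b \/ y = rho b /\ z = rho a) ->
    Qssp W y < Qssp W z ->
    t * (Qssp W z - Qssp W y) <= (t ^+ 2 * (c b - c a) + (m b - m a)) / 2 + 2 * t * delta.
  move=> y0 yz Qyz.
  have z0 : 0 <= z by case: yz => [[_ ->]|[_ ->]].
  have yltz : y <= z.
    rewrite leNgt; apply/negP => /ltW zy; have := Qssp_homo W0 dW W00 z0 zy.
    by rewrite leNgt Qyz.
  have mm : Num.min (rho a) (rho b) = y /\ Num.max (rho a) (rho b) = z.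
    by case: yz => [[<- <-]|[<- <-]]; [rewrite min_l ?max_r|rewrite min_r ?max_l].
  have [s [s' [ys ys' [cs cs'] [Qs Qs']]]] := Qssp_contacts W0 dW W00 y0 yltz Qyz.
  move: ivt; rewrite mm.1 mm.2 => ivt.
  have [x1 x1ab r1] := ivt s ys; have [x2 x2ab r2] := ivt s' ys'.
  have s0 : 0 <= s by rewrite -r1.
  have s0' : 0 <= s' by rewrite -r2.
  have H1 := HK x1; rewrite r1 in H1; have {}H1 := H1 cs.
  have H2 := HK x2; rewrite r2 in H2; have {}H2 := H2 cs'.
  rewrite -Qs -Qs' (Qssp_contact W0 dW s0 cs) (Qssp_contact W0 dW s0' cs').
  apply: (le_trans _ (lerD (inner x1 x2 x1ab x2ab) (lexx _))).
  (* Replacing Q' by [F] costs [delta] at each of the two contact points. *)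
  rewrite (_ : 2 * t * delta = t * (2 * delta)); last by ring.
  rewrite -mulrDr ler_pM2l //.
  have := ler_norm (F x2 - F x1).
  by move: H1 H2; rewrite !ler_norml => /andP[? ?] /andP[? ?]; lra.
have [Qab|Qba|->] := ltgtP (Qssp W (rho a)) (Qssp W (rho b)); last first.
- by rewrite subrr normr0 mulr0 addr_ge0.
- rewrite ltr0_norm ?subr_lt0 // opprB.
  by apply: key => //; right.
- rewrite gtr0_norm ?subr_gt0 //.
  by apply: key => //; left.
Qed.

(** [M] is fixed before [delta], since the precision later asked of the transport distance depends
    on it. The function [m] is the primitive of [g ^+ 2], of which only monotonicity and total mass
    are kept. *)
Lemma uniform_estimates (R : realType) (W : R -> R) (C M0 L2 : R) :
  potential W -> (forall y : R, 0 <= y -> `|Qp W y| <= C * (1 + W y)) -> 0 < C ->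
  (Qp W y @[y --> +oo] --> +oo%R) -> 0 <= L2 ->
  exists M : R, 0 <= M /\ forall delta : R, 0 < delta -> exists eps0 : R, 0 < eps0 /\
    forall (eps : R) (rho g : R -> R), 0 < eps -> eps < eps0 ->
      densityT rho -> C1T rho -> (Eeps W eps rho <= M0%:E)%E ->
      Teps W eps rho g -> (intT (fun x => (g x ^+ 2)%R) <= L2%:E)%E ->
      (forall x, rho x <= M) /\
      exists m : R -> R, [/\
        forall a b : R, 0 <= a -> a <= b -> b <= 1 -> m a <= m b,
        m 1 - m 0 <= L2 &
        forall a b t : R, 0 <= a -> a <= b -> b <= 1 -> 0 < t ->
          t * `|Qssp W (rho b) - Qssp W (rho a)| <=
          (t ^+ 2 * (cumul rho b - cumul rho a) + (m b - m a)) / 2 + 2 * t * delta].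
Proof.
move=> pW HC C0 HQ L20; have [dW cW W0 W00] := pW.
pose CF := `|C + (C + 3) * M0| + 1 + L2.
have [M1 [_ HM1]] : \forall y \near +oo, CF < Qp W y.
  by move/cvgryPgt : HQ => /(_ CF).
pose M := Num.max M1 0.
have M10 : M1 <= M by rewrite /M le_max lexx.
have M00 : 0 <= M by rewrite /M le_max lexx orbT.
exists M; split => // delta d0.
have d4 : 0 < delta / 4 by lra.
(* The modulus is taken at [delta / 4]: periodic extension doubles it to the [delta / 2] allowed
   near a contact point. *)
have [h [h0 h1 Hh]] := modulus_of_increments M00 L20 d4.
(* For [eps < 1] one has [eps ^+ 2 <= eps], so a bound linear in [eps] gives the required smallness
   of [4 * eps ^+ 2 * M ^+ 2]. *)
pose eps0 := Num.min 1 (h ^+ 2 * delta / (4 * M ^+ 2 + 1)).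
have MM : 0 < 4 * M ^+ 2 + 1 by rewrite ltr_wpDl // mulr_ge0 // sqr_ge0.
have e00 : 0 < eps0 by rewrite lt_min ltr01 divr_gt0 // mulr_gt0 // exprn_gt0.
exists eps0; split=> // eps rho g ep elt drho C1 HE HT Hg.
have [F [ode F01 pF Fb Finc]] := ode_of_Teps dW cW drho C1 HT.
have [mg [fing _]] := HT.
have ig2 := sqr_integrable mg fing.
have g20 x : 0 <= g x ^+ 2 by exact: sqr_ge0.
have [prho [_ [rho0 _]]] := drho.
have irho := density_integrable drho.
have crho : continuous rho.
  by move=> x; have [_ [d _]] := C1; exact: is_derive_cts (derivable_is_derive1 (d x)).
have gL2 : cumul (fun y => g y ^+ 2) 1 <= L2.
  by move: Hg; rewrite intT_EFin // lee_fin.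
have rM : forall x, rho x <= M.
  apply: (@ode_bounded _ W eps CF M rho _ F ode ep prho M00).
    by move=> y My; apply: HM1; exact: le_lt_trans My.
  move=> x; apply: (le_trans (ler_norm _)); apply: (le_trans (Fb x)).
  have := bulk_flux_bound pW HC C0 drho C1 HE.
  have := ler_norm (C + (C + 3) * M0); rewrite /CF.
  have arith (a b c d : R) : b <= c -> a <= b -> d <= L2 -> a + 1 + d <= c + 1 + L2 by lra.
  by move=> H1 H2; exact: arith H1 H2 gL2.
split=> //; exists (cumul (fun y => g y ^+ 2)).
have mono a b : 0 <= a -> a <= b -> b <= 1 ->
    cumul (fun y => g y ^+ 2) a <= cumul (fun y => g y ^+ 2) b.
  by move=> a0 ab b1; exact: cumul_homo.
split=> //; first by rewrite cumul0 subr0.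
apply: (Qssp_increments (F := F)) => //; first exact: ltW.
  apply: (@ode_contact_flux _ W eps M L2 delta h rho _ F (fun x => x) pW ode) => //.
    move=> x y xy; rewrite -(pF x) -(pF y) (_ : delta / 2 = 2 * (delta / 4)); last by field.
    apply: (fracpart_modulus F01 h1) xy.
    apply: (Hh F (cumul rho) (cumul (fun y => g y ^+ 2)) Finc) => a b a0 ab b1.
      by apply: cumul_lipschitz => // z _; exact: rM.
    have := mono b 1 (le_trans a0 ab) b1 (lexx 1).
    have := mono 0 a (lexx 0) a0 (le_trans ab b1); rewrite cumul0.
    by move: gL2; set c1 := cumul _ 1; lra.
  have e1 : eps < 1 by apply: lt_le_trans elt _; rewrite ge_min lexx.
  have e2 : eps * (4 * M ^+ 2 + 1) < h ^+ 2 * delta.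
    by rewrite -ltr_pdivlMr //; apply: lt_le_trans elt _; rewrite ge_min lexx orbT.
  apply: le_lt_trans e2.
  have M2 : 0 <= M ^+ 2 by exact: sqr_ge0.
  have : eps ^+ 2 * M ^+ 2 <= eps * M ^+ 2.
    by rewrite ler_wpM2r // expr2 ger_pMr // ltW.
  by lra.
by move=> a b a0 ab b1; exact: cumul_homo.
Qed.

(** * Limit along a sequence *)

Lemma cauchy_cvgn (R : realType) (u : nat -> R) :
  (forall e : R, 0 < e -> exists N, forall n k, (N <= n)%N -> (N <= k)%N -> `|u n - u k| <= e) ->
  cvgn u.
Proof.
move=> H; apply: cauchy_cvg; apply: cauchy_exP => e e0.
have e2 : 0 < e / 2 by lra.
have [N HN] := H _ e2; exists (u N); exists N => // n /= Nn.
by rewrite /ball /=; apply: le_lt_trans (HN N n (leqnn N) Nn) _; lra.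
Qed.

Lemma cvgn_dist (R : realType) (u : nat -> R) : cvgn u ->
  forall e : R, 0 < e -> exists N, forall n, (N <= n)%N -> `|u n - limn u| <= e.
Proof.
move=> cu e e0; have /cvgrPdist_le /(_ e e0) [N _ HN] := cu.
by exists N => n Nn; rewrite distrC; exact: HN.
Qed.

Lemma interval_around (R : realType) (x h : R) : 0 <= x <= 1 -> 0 < h ->
  exists a b : R, [/\ 0 <= a, a < b, b <= 1, b - a <= h & a <= x <= b].
Proof.
move=> /andP[x0 x1] h0.
have m0 : 0 < Num.min h (1 / 2) by rewrite lt_min h0 /=; lra.
have mh : Num.min h (1 / 2) <= h by rewrite ge_min lexx.
have m2 : Num.min h (1 / 2) <= 1 / 2 by rewrite ge_min lexx orbT.
have [xh|xh] := leP x (1 / 2).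
  by exists x, (x + Num.min h (1 / 2)); split; try apply/andP; try split; lra.
by exists (x - Num.min h (1 / 2)), x; split; try apply/andP; try split; lra.
Qed.

Lemma cumul_mean_value (R : realType) (f : R -> R) (a b : R) : continuous f ->
  0 <= a -> a < b -> b <= 1 ->
  exists2 c : R, a <= c <= b & cumul f b - cumul f a = f c * (b - a).
Proof.
move=> cf a0 ab b1.
have fi := cts01_integrable (cts01_cts cf).
have cw : {within `[a, b], continuous (cumul f)}.
  apply: continuous_subspaceW (cts01_within (cumul_cts01 fi)).
  by apply: subset_itv; rewrite bnd_simp.
have dc x : x \in `]a, b[ -> is_derive x 1 (cumul f) (f x).
  rewrite in_itv /= => /andP[x1 x2].
  have x0 : 0 < x by lra.
  have x11 : x < 1 by lra.
  have [d1 d2] := continuous_FTC1_closed x11 fi x0 (cf x).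
  by rewrite -d2; exact: derivable_is_derive1.
have [c] := MVT ab dc cw.
by rewrite in_itv /= => /andP[c1 c2] E; exists c => //; rewrite !ltW.
Qed.

Lemma cvg_sum_nat (R : realType) (N : nat) (u : nat -> nat -> R) (l : nat -> R) :
  (forall i, (i < N)%N -> (fun k => u k i) @ \oo --> l i) ->
  (fun k => \sum_(0 <= i < N) u k i) @ \oo --> \sum_(0 <= i < N) l i.
Proof.
elim: N => [|N IH] H.
  by rewrite big_nil; under eq_fun do rewrite big_nil; exact: cvg_cst.
rewrite big_nat_recr //=; under eq_fun do rewrite big_nat_recr //=.
by apply: cvgD; [apply: IH => i iN; apply: H; exact: ltnW|exact: H].
Qed.

Section Limit.
Context (R : realType) (W : R -> R) (rho0 : R -> R) (M L2 : R).
Context (r_ m_ : nat -> R -> R) (err : nat -> R).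
Context (pW : potential W) (drho0 : densityT rho0) (M0 : 0 <= M) (L20 : 0 <= L2).
Local Notation q n x := (Qssp W (r_ n x)).
Local Notation c n := (cumul (r_ n)).
Local Notation c0 := (cumul rho0).
Context (rden : forall n, densityT (r_ n)) (rcts : forall n, continuous (r_ n)).
Context (rM : forall n x, r_ n x <= M).
Context (mhomo : forall n (a b : R), 0 <= a -> a <= b -> b <= 1 -> m_ n a <= m_ n b).
Context (mL2 : forall n, m_ n 1 - m_ n 0 <= L2).
Context (incr : forall n (a b t : R), 0 <= a -> a <= b -> b <= 1 -> 0 < t ->
  t * `|q n b - q n a| <= (t ^+ 2 * (c n b - c n a) + (m_ n b - m_ n a)) / 2 + 2 * t * err n).
Context (ccvg : forall n (x : R), 0 <= x <= 1 -> `|c n x - c0 x| <= err n).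

Context (err_ge0 : forall n, 0 <= err n)
  (err_small : forall e : R, 0 < e -> exists N, forall n, (N <= n)%N -> err n <= e).

Lemma mincr n a b : 0 <= a -> a <= b -> b <= 1 -> m_ n b - m_ n a <= L2.
Proof.
move=> a0 ab b1; have := mhomo n (lexx 0) a0 (le_trans ab b1).
by have := mhomo n (le_trans a0 ab) b1 (lexx 1); have := mL2 n; lra.
Qed.

Lemma cincr n a b : 0 <= a -> a <= b -> b <= 1 -> c n b - c n a <= M * (b - a).
Proof.
move=> a0 ab b1; by apply: cumul_lipschitz => //; exact: density_integrable.
Qed.

(** The same choice of [t] and [k] as for the flux. The defect [2 * t * err n] is divided by [t], so
    the functions are equicontinuous up to [2 * err n]. *)
Lemma q_oscillation (e : R) : 0 < e -> exists2 h : R, 0 < h &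
  forall n (x y : R), 0 <= x <= 1 -> 0 <= y <= 1 -> `|x - y| <= h ->
  `|q n x - q n y| <= e + 2 * err n.
Proof.
move=> e0.
pose t := (L2 + 1) / e; have t0 : 0 < t by rewrite divr_gt0 // ltr_wpDl.
have te : t * e = L2 + 1 by rewrite /t divfK // gt_eqF.
pose k := e / (t * (M + 1)).
have tK0 : 0 < t * (M + 1) by rewrite mulr_gt0 // ltr_wpDl.
have k0 : 0 < k by rewrite divr_gt0.
have kE : k * (t * (M + 1)) = e by rewrite /k divfK // gt_eqF.
exists k => // n.
have key a b : 0 <= a -> a <= b -> b <= 1 -> b - a <= k -> `|q n b - q n a| <= e + 2 * err n.
  move=> a0 ab b1 bak.
  have H1 := incr n a0 ab b1 t0; have H2 := cincr n a0 ab b1; have H3 := mincr n a0 ab b1.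
  have H4 : M * (b - a) <= (M + 1) * k.
    by apply: ler_pM => //; [rewrite subr_ge0|rewrite lerDl].
  have H5 : t ^+ 2 * (c n b - c n a) <= t ^+ 2 * ((M + 1) * k).
    by rewrite ler_pM2l ?exprn_gt0 //; exact: le_trans H2 H4.
  have H6 : t ^+ 2 * ((M + 1) * k) = t * e by rewrite -[in RHS]kE; ring.
  rewrite -(ler_pM2l t0); apply: (le_trans H1); move: H3 H5; rewrite H6.
  have arith (u v w z : R) : v <= L2 -> u <= t * e ->
    (u + v) / 2 + 2 * t * w <= t * (e + 2 * w) by move=> *; lra.
  by move=> H3 H5; exact: arith.
move=> x y /andP[x0 x1] /andP[y0 y1] xy; have [xley|yltx] := leP x y.
  rewrite distrC; apply: key => //; rewrite -opprB; apply: le_trans xy.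
  by rewrite -normrN; exact: ler_norm.
by apply: key => //; [exact: ltW|apply: le_trans xy; exact: ler_norm].
Qed.

(** The average of [r_ n] over a short interval is one of its values there, so applying [Qssp W] to
    it changes [q n] only by an oscillation. This is what makes convergence of the primitives
    sufficient although [Qssp W] is nonlinear. *)
Lemma q_near_average (e : R) : 0 < e -> exists2 h : R, 0 < h &
  forall n (a b x : R), 0 <= a -> a < b -> b <= 1 -> b - a <= h -> a <= x <= b ->
  `|q n x - Qssp W ((c n b - c n a) / (b - a))| <= e + 2 * err n.
Proof.
move=> /q_oscillation[h h0 H]; exists h => // n a b x a0 ab b1 bah /andP[ax xb].
have [y /andP[ay yb] ->] := cumul_mean_value (@rcts n) a0 ab b1.
rewrite mulfK ?subr_eq0 ?gt_eqF //; apply: H.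
- by apply/andP; split; lra.
- by apply/andP; split; lra.
- by rewrite ler_norml; apply/andP; split; lra.
Qed.

Lemma average_ge0 (f : R -> R) (a b : R) : densityT f ->
  0 <= a -> a < b -> b <= 1 -> 0 <= (cumul f b - cumul f a) / (b - a).
Proof.
move=> df a0 ab b1; rewrite divr_ge0 ?subr_ge0 ?(ltW ab) //.
apply: cumul_homo => //; [exact: density_integrable|by case: df => _ [_ []]|exact: ltW].
Qed.

Lemma Qssp_average_cvg (a b e : R) : 0 <= a -> a < b -> b <= 1 -> 0 < e ->
  exists N, forall n, (N <= n)%N ->
  `|Qssp W ((c n b - c n a) / (b - a)) - Qssp W ((c0 b - c0 a) / (b - a))| <= e.
Proof.
move=> a0 ab b1 e0; have [dW cW W0 W00] := pW.
have ba : 0 < b - a by lra.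
have [h h0 H] := Qssp_cts W0 dW W00 (average_ge0 drho0 a0 ab b1) e0.
have h4 : 0 < h * (b - a) / 4 by rewrite divr_gt0 // mulr_gt0.
have [N HN] := err_small h4; exists N => n Nn; apply: H; first exact: average_ge0.
rewrite -mulrBl normrM [X in _ * X]gtr0_norm ?invr_gt0 // ltr_pdivrMr //.
have Ha := @ccvg n a; have Hb := @ccvg n b; have En := HN n Nn.
have -> : c n b - c n a - (c0 b - c0 a) = (c n b - c0 b) - (c n a - c0 a) by ring.
apply: (le_lt_trans (ler_normB _ _)).
have {}Ha := Ha ltac:(apply/andP; split; lra).
have {}Hb := Hb ltac:(apply/andP; split; lra).
have hb : 0 < h * (b - a) by rewrite mulr_gt0.
apply: le_lt_trans (lerD (le_trans Hb En) (le_trans Ha En)) _.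
by lra.
Qed.

Lemma q_cvg (x : R) : 0 <= x <= 1 -> cvgn (fun n => q n x).
Proof.
move=> x01; apply: cauchy_cvgn => e e0.
have e8 : 0 < e / 8 by lra.
have [h h0 H] := q_near_average e8.
have [a [b [a0 ab b1 bah xab]]] := interval_around x01 h0.
have [N1 H1] := Qssp_average_cvg a0 ab b1 e8.
have [N2 H2] := err_small e8.
exists (maxn N1 N2) => n k; rewrite !geq_max => /andP[n1 n2] /andP[k1 k2].
have A1 := H n a b x a0 ab b1 bah xab; have A2 := H k a b x a0 ab b1 bah xab.
have A3 := H1 n n1; have A4 := H1 k k1; have A5 := H2 n n2; have A6 := H2 k k2.
move: A1 A2 A3 A4; rewrite !ler_norml => /andP[? ?] /andP[? ?] /andP[? ?] /andP[? ?].
by apply/andP; split; lra.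
Qed.

Definition qlim (x : R) : R := limn (fun n => q n x).

Lemma qlim_near_average (e : R) : 0 < e -> exists2 h : R, 0 < h &
  forall (a b x : R), 0 <= a -> a < b -> b <= 1 -> b - a <= h -> a <= x <= b ->
  `|qlim x - Qssp W ((c0 b - c0 a) / (b - a))| <= e.
Proof.
move=> e0; have e8 : 0 < e / 8 by lra.
have [h h0 H] := q_near_average e8; exists h => // a b x a0 ab b1 bah xab.
have x01 : 0 <= x <= 1 by case/andP: xab => *; apply/andP; split; lra.
have [N1 H1] := Qssp_average_cvg a0 ab b1 e8.
have [N2 H2] := err_small e8.
have [N3 H3] := cvgn_dist (q_cvg x01) e8.
pose n := maxn N1 (maxn N2 N3).
have n1 : (N1 <= n)%N by rewrite leq_max leqnn.
have n2 : (N2 <= n)%N by rewrite !leq_max leqnn orbT.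
have n3 : (N3 <= n)%N by rewrite !leq_max leqnn !orbT.
have A1 := H n a b x a0 ab b1 bah xab; have A2 := H1 n n1.
have A3 := H2 n n2; have A4 := H3 n n3; rewrite -/(qlim x) in A4.
move: A1 A2 A4; rewrite !ler_norml => /andP[? ?] /andP[? ?] /andP[? ?].
by apply/andP; split; lra.
Qed.

Lemma qlim_cts01 : cts01 qlim.
Proof.
move=> x x01 e e0; have e8 : 0 < e / 8 by lra.
have [h h0 H] := q_oscillation e8; exists h => // y y01 /ltW yx.
have [N2 H2] := err_small e8.
have [N3 H3] := cvgn_dist (q_cvg x01) e8; have [N4 H4] := cvgn_dist (q_cvg y01) e8.
pose n := maxn N4 (maxn N2 N3).
have n1 : (N4 <= n)%N by rewrite leq_max leqnn.
have n2 : (N2 <= n)%N by rewrite !leq_max leqnn orbT.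
have n3 : (N3 <= n)%N by rewrite !leq_max leqnn !orbT.
have A1 := H n y x y01 x01 yx; have A2 := H4 n n1; have A3 := H2 n n2; have A4 := H3 n n3.
rewrite -/(qlim x) in A4; rewrite -/(qlim y) in A2.
move: A1 A2 A4; rewrite !ler_norml => /andP[? ?] /andP[? ?] /andP[? ?].
by apply/andP; split; lra.
Qed.

Lemma qlim_periodic : qlim 0 = qlim 1.
Proof.
rewrite /qlim; congr (limn _); apply/funext => n.
by have [pr _] := rden n; rewrite -[1]add0r pr.
Qed.

Lemma err_cvg0 : err @ \oo --> (0 : R).
Proof.
apply/cvgrPdist_le => e e0; have [N HN] := err_small e0.
by exists N => // n /= Nn; rewrite sub0r normrN ger0_norm //; exact: HN.
Qed.

Lemma c_cvg (x : R) : 0 <= x <= 1 -> (fun n => c n x) @ \oo --> c0 x.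
Proof.
move=> x01; apply/cvgrPdist_le => e e0; have [N HN] := err_small e0.
exists N => // n /= Nn; rewrite distrC.
by apply: le_trans (HN n Nn); exact: ccvg.
Qed.

Lemma cvg_cumul_incr (a b : R) : 0 <= a <= 1 -> 0 <= b <= 1 ->
  (fun n => c n b - c n a) @ \oo --> c0 b - c0 a.
Proof. by move=> a01 b01; apply: cvgB; exact: c_cvg. Qed.

Lemma cvg_q_incr (a b : R) : 0 <= a <= 1 -> 0 <= b <= 1 ->
  (fun n => q n b - q n a) @ \oo --> qlim b - qlim a.
Proof. by move=> a01 b01; apply: cvgB; exact: q_cvg. Qed.

Lemma qlim_incr (a b t : R) : 0 <= a -> a <= b -> b <= 1 -> 0 < t ->
  t * `|qlim b - qlim a| <= (t ^+ 2 * (c0 b - c0 a) + L2) / 2.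
Proof.
move=> a0 ab b1 t0.
have a01 : 0 <= a <= 1 by rewrite a0 (le_trans ab).
have b01 : 0 <= b <= 1 by rewrite b1 (le_trans a0).
have H1 : (fun n => t * `|q n b - q n a|) @ \oo --> t * `|qlim b - qlim a|.
  by apply: cvgM; [exact: cvg_cst|apply: cvg_norm; exact: cvg_q_incr].
have H2 : (fun n => (t ^+ 2 * (c n b - c n a) + L2) / 2 + 2 * t * err n) @ \oo -->
    (t ^+ 2 * (c0 b - c0 a) + L2) / 2 + 2 * t * 0.
  apply: cvgD; last by apply: cvgM; [exact: cvg_cst|exact: err_cvg0].
  apply: cvgM; last exact: cvg_cst.
  apply: cvgD; last exact: cvg_cst.
  by apply: cvgM; [exact: cvg_cst|exact: cvg_cumul_incr].
rewrite mulr0 addr0 in H2; apply: (ler_cvg_to H1 H2); apply: nearW => n.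
apply: (le_trans (incr n a0 ab b1 t0)).
by rewrite lerD2r ler_pM2r ?invr_gt0 // lerD2l; exact: mincr.
Qed.

Lemma qlim_ac : dyadic_ac qlim c0.
Proof.
move=> n i iN ci; apply/eqP; rewrite -normr_eq0; apply/eqP/le_anti; rewrite normr_ge0 andbT.
rewrite leNgt; apply/negP => d0.
(* If dc vanished and dq did not, this [t] would make the left side of the increment inequality
   [L2 + 1] and the right side [L2 / 2]. *)
have t0 : 0 < (L2 + 1) / `|dyadic_incr qlim n i| by rewrite divr_gt0 // ltr_wpDl.
have := qlim_incr (dyadic_ge0 R n i) _ (dyadic_le1 R iN) t0.
rewrite dyadic_le leqnSn => /(_ isT); rewrite -/(dyadic_incr c0 n i) ci mulr0 add0r.
rewrite -/(dyadic_incr qlim n i) divfK ?gt_eqF //.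
by move=> H; clear t0 d0; have := L20; lra.
Qed.

(** The increment inequality is used on each cell with its own [t = |r i|]; the increments of [m_ k]
    then add up to at most [L2]. Cells with [r i = 0] are apart because [t] must be positive. *)
Lemma q_sum_le (n k : nat) (r : nat -> R) :
  \sum_(0 <= i < 2 ^ n) r i * dyadic_incr (fun x => q k x) n i <=
  (\sum_(0 <= i < 2 ^ n) r i ^+ 2 * dyadic_incr (c k) n i + L2) / 2
    + 2 * (\sum_(0 <= i < 2 ^ n) `|r i|) * err k.
Proof.
have mS : \sum_(0 <= i < 2 ^ n) dyadic_incr (m_ k) n i <= L2.
  rewrite /dyadic_incr (telescope_sumr (fun j => m_ k (dyadic R n j))) //.
  by rewrite dyadic0 dyadic1; exact: mL2.
apply: (@le_trans _ _ (\sum_(0 <= i < 2 ^ n)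
   ((r i ^+ 2 * dyadic_incr (c k) n i + dyadic_incr (m_ k) n i) / 2 + 2 * `|r i| * err k))).
  rewrite big_nat [leRHS]big_nat; apply: ler_sum => i /andP[_ iN].
  have d0 := dyadic_ge0 R n i; have d1 := dyadic_le1 R iN.
  have dd : dyadic R n i <= dyadic R n i.+1 by rewrite dyadic_le.
  have [->|r0] := eqVneq (r i) 0.
    rewrite normr0 !mulr0 mul0r addr0 expr2 !mul0r add0r divr_ge0 // subr_ge0.
    exact: mhomo.
  apply: (le_trans (ler_norm _)); rewrite normrM -[r i ^+ 2]real_normK ?num_real //.
  by apply: incr => //; rewrite normr_gt0.
rewrite big_split /= -mulr_suml big_split /= -mulr_suml -mulr_sumr.
by rewrite lerD2r ler_pM2r ?invr_gt0 // lerD2l.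
Qed.

(** With the limit quotients as weights both sums become the energy E, and the limit reads E <= (E +
    L2) / 2. *)
Lemma qlim_energy n : dyadic_energy qlim c0 n <= L2.
Proof.
pose r i := dyadic_quot qlim c0 n i.
have d01 i : (i < 2 ^ n)%N -> 0 <= dyadic R n i <= 1 /\ 0 <= dyadic R n i.+1 <= 1.
  by move=> iN; rewrite !dyadic_ge0 !dyadic_le1 // ltnW.
have H1 : (fun k => \sum_(0 <= i < 2 ^ n) r i * dyadic_incr (fun x => q k x) n i) @ \oo -->
    \sum_(0 <= i < 2 ^ n) r i * dyadic_incr qlim n i.
  apply: cvg_sum_nat => i iN; have [i0 i1] := d01 i iN.
  by apply: cvgM; [exact: cvg_cst|exact: cvg_q_incr].
have H2 : (fun k => (\sum_(0 <= i < 2 ^ n) r i ^+ 2 * dyadic_incr (c k) n i + L2) / 2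
    + 2 * (\sum_(0 <= i < 2 ^ n) `|r i|) * err k) @ \oo -->
    (\sum_(0 <= i < 2 ^ n) r i ^+ 2 * dyadic_incr c0 n i + L2) / 2
    + 2 * (\sum_(0 <= i < 2 ^ n) `|r i|) * 0.
  apply: cvgD; last by apply: cvgM; [exact: cvg_cst|exact: err_cvg0].
  apply: cvgM; last exact: cvg_cst.
  apply: cvgD; last exact: cvg_cst.
  apply: cvg_sum_nat => i iN; have [i0 i1] := d01 i iN.
  by apply: cvgM; [exact: cvg_cst|exact: cvg_cumul_incr].
have := ler_cvg_to H1 H2 ltac:(by apply: nearW => k; exact: q_sum_le).
rewrite -(dyadic_energyE n qlim_ac) -[X in X <= _]/(dyadic_energy qlim c0 n) mulr0 addr0.
have arith (u : R) : u <= (u + L2) / 2 -> u <= L2 by lra.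
by move=> H; apply: arith; exact: H.
Qed.

(** [qlim x] is close to [Qssp W] of the averages of [rho0] over [x, x + k], and these tend to
    [rho0 x]. *)
Lemma qlim_derive (x : R) : 0 <= x -> x < 1 -> is_derive x 1 c0 (rho0 x) ->
  qlim x = Qssp W (rho0 x).
Proof.
move=> x0 x1 dx; have [dW cW W0 W00] := pW; have [_ [_ [rho00 _]]] := drho0.
apply/eqP; rewrite -subr_eq0 -normr_le0; apply/ler_addgt0Pr => e e0; rewrite add0r.
have e2 : 0 < e / 2 by lra.
have [h1 h10 H1] := qlim_near_average e2.
have [h2 h20 H2] := Qssp_cts W0 dW W00 (rho00 x) e2.
have h22 : 0 < h2 / 2 by lra.
have [h3 h30 H3] := is_derive_eps dx h22.
pose k := Num.min (1 - x) (Num.min h1 (h3 / 2)).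
have k0 : 0 < k by rewrite !lt_min subr_gt0 x1 h10 divr_gt0.
have kx : k <= 1 - x by rewrite ge_min lexx.
have k1 : k <= h1 by rewrite !ge_min lexx orbT.
have k3 : k <= h3 / 2 by rewrite !ge_min lexx !orbT.
have xk : x < x + k by lra.
have xk1 : x + k <= 1 by lra.
have kE : x + k - x = k by ring.
have A1 := H1 x (x + k) x x0 xk xk1 ltac:(by rewrite kE) ltac:(by rewrite lexx ltW).
rewrite kE in A1; have a0 := average_ge0 drho0 x0 xk xk1; rewrite kE in a0.
have A3 := H3 (x + k) ltac:(by rewrite kE gtr0_norm //; lra).
rewrite kE (gtr0_norm k0) in A3.
have A4 : `|(c0 (x + k) - c0 x) / k - rho0 x| < h2.
  have -> : (c0 (x + k) - c0 x) / k - rho0 x = (c0 (x + k) - c0 x - rho0 x * k) / k.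
    by rewrite [RHS]mulrBl mulfK // gt_eqF.
  rewrite normrM normfV (gtr0_norm k0) ltr_pdivrMr //.
  by apply: (le_lt_trans A3); rewrite ltr_pM2r //; lra.
have A2 := H2 _ a0 A4.
by move: A1 A2; rewrite !ler_norml => /andP[? ?] /andP[? ?]; apply/andP; split; lra.
Qed.

Lemma qlim_ae : {ae @lebesgue_measure R, forall x, (`[0%R, 1%R]%classic : set R) x ->
  Qssp W (rho0 x) = qlim x}.
Proof.
have irho := density_integrable drho0.
have loc := integrable_locally_restrict (measurable_itv `[0, 1]) irho.
have ae1 := lebesgue_differentiation loc.
have ae2 (z : R) : {ae @lebesgue_measure R, forall x, x <> z}.
  exists [set z]; split => //; first by rewrite lebesgue_measure_set1.
  by move=> x /= /contrapT.
suff key (x : R) : x <> 0 -> x <> 1 -> lebesgue_pt (rho0 \_ `[0, 1]) x ->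
    (`[0%R, 1%R]%classic : set R) x -> Qssp W (rho0 x) = qlim x.
  move: (ae2 0) (ae2 1) ae1; apply: (@filterS3 _ (almost_everywhere (@lebesgue_measure R))
    (ae_filter_ringOfSetsType _) (fun x : R => x <> 0) (fun x : R => x <> 1)
    (fun x : R => lebesgue_pt (rho0 \_ `[0, 1]) x)).
  by move=> x p q r; exact: key.
move=> xn0 xn1 lx; rewrite /= in_itv /= => /andP[]; rewrite le_eqVlt => /predU1P[/esym//|x0].
rewrite le_eqVlt => /predU1P[//|x1].
apply/esym/qlim_derive => //; first exact: ltW.
pose f := rho0 \_ `[0, 1].
have fi : (@lebesgue_measure R).-integrable `[0, 1] (EFin \o f).
  by apply: eq_integrable irho => // y yI; rewrite /f /= patchE yI.
have [d1 d2] := @FTC1_lebesgue_pt _ f (BLeft 0) x 1 x1 fi ltac:(exact: x0) lx.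
have dF := derivable_is_derive1 d1; rewrite d2 in dF.
have fx : f x = rho0 x by rewrite /f patchE mem_set //= in_itv /= !ltW.
rewrite fx in dF; apply: (@is_derive_near _ _ _ _ _ (1 - x) _ _ dF); first by rewrite subr_gt0.
move=> y /(le_lt_trans (ler_norm _)); rewrite ltrD2r => /ltW y1.
apply: eq_Rintegral => z; rewrite inE /= in_itv /= => /andP[z0 zy].
by rewrite /f patchE mem_set //= in_itv /= z0 (le_trans zy).
Qed.

Lemma limit_W11 : exists2 g : R -> R,
  W11T_deriv (fun x => Qssp W (rho0 x)) g &
  (intT (fun x => (rho0 x * (g x / rho0 x) ^+ 2)%R) <= L2%:E)%E.
Proof.
have [_ [mrho [rho00 _]]] := drho0.
have [g [mg ig qg Eg]] := dyadic_representation mrho rho00 (density_integrable drho0)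
  (cumul_density1 drho0) qlim_ac qlim_energy qlim_cts01.
exists g => //; split=> //; split=> //; split.
  rewrite /intT -cumul_EFin //; congr EFin.
  have := qg 1; rewrite ler01 lexx -qlim_periodic => /(_ isT).
  by move=> H; apply: (addrI (qlim 0)); rewrite -H addr0.
exists (qlim 0); move: qlim_ae; apply: (@filterS _ (almost_everywhere (@lebesgue_measure R))
  (ae_filter_ringOfSetsType _)) => x Hx xI.
rewrite Hx //; have := xI; rewrite /= in_itv /= => x01; have /andP[_ x1] := x01.
by rewrite qg // -cumul_EFin //; exact: integrable_sub01.
Qed.

End Limit.

(** * From the lower limit to a sequence *)

Lemma limf_einf_lt_exists (R : realType) (T : choiceType) (X : filteredType T)
    (f : X -> \bar R) (F : set (set X)) (V : set X) (y : \bar R) :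
  (limf_einf f F < y)%E -> F V -> exists2 x, V x & (f x < y)%E.
Proof.
rewrite limf_einfE => H FV.
have : (ereal_inf (f @` V) < y)%E.
  by apply: le_lt_trans H; apply: ereal_sup_ubound; exists V.
by move=> /ereal_inf_lt[_ [x Vx <-] xy]; exists x.
Qed.

Lemma lee_real_above (R : realType) (x y : \bar R) :
  (forall r : R, (y < r%:E)%E -> (x <= r%:E)%E) -> (x <= y)%E.
Proof.
case: y => [y| |] H; last 2 first.
- exact: leey.
- by rewrite (@eq_ninfty _ x) // => r; apply: H; exact: ltNyr.
by apply/lee_addgt0Pr => e e0; rewrite -EFinD; apply: H; rewrite lte_fin ltrDl.
Qed.

Lemma poweR_half_sqr (R : realType) (r : R) : 0 <= r -> poweR (r ^+ 2)%:E (2^-1) = r%:E.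
Proof. by move=> r0; rewrite poweR_EFin powR12_sqrt ?sqr_ge0 // sqrtr_sqr ger0_norm. Qed.

Lemma poweR_half_lt (R : realType) (a : \bar R) (r : R) :
  (0 <= a)%E -> (poweR a (2^-1) < r%:E)%E -> 0 < r /\ (a <= (r ^+ 2)%:E)%E.
Proof.
move=> a0 ar; have r0 : 0 < r by rewrite -lte_fin; exact: le_lt_trans (poweR_ge0 _ _) ar.
split=> //; rewrite leNgt; apply/negP => ra.
move: ar; rewrite ltNge => /negP; apply.
rewrite -[leLHS](poweR_half_sqr (ltW r0)); apply: gt0_ler_poweR.
- by rewrite invr_ge0.
- by rewrite in_itv /= leey andbT lee_fin sqr_ge0.
- by rewrite in_itv /= leey andbT.
- exact: ltW.
Qed.

Lemma slopeEss_le (R : realType) (W mu g : R -> R) (L : R) : 0 <= L ->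
  (forall x, 0 <= mu x) ->
  W11T_deriv (fun x => Qssp W (mu x)) g ->
  (intT (fun x => (mu x * (g x / mu x) ^+ 2)%R) <= (L ^+ 2)%:E)%E ->
  (slopeEss W mu <= L%:E)%E.
Proof.
move=> L0 mu0 Hg gL.
apply: (@le_trans _ _ (poweR (intT (fun x => (mu x * (g x / mu x) ^+ 2)%R)) (2^-1))).
  by apply: ereal_inf_lbound; exists g.
rewrite -[leRHS]poweR_half_sqr //; apply: gt0_ler_poweR => //.
- rewrite in_itv /= leey andbT; apply: integral_ge0 => x _.
  by rewrite lee_fin mulr_ge0 ?sqr_ge0.
- by rewrite in_itv /= leey andbT lee_fin sqr_ge0.
Qed.

Lemma standing_potential (R : realType) (W : R -> R) : standing_W W -> potential W.
Proof.
move=> [dW [ddW [_ [W0 [W00 _]]]]]; split; [exact: dW| |exact: W0|exact: W00].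
move=> x; exact: is_derive_cts (derivable_is_derive1 (ddW x)).
Qed.

Lemma inv_succ_small (R : realType) (e : R) : 0 < e ->
  exists N, forall n, (N <= n)%N -> (n.+1%:R)^-1 <= e.
Proof.
move=> e0; exists (Num.truncn e^-1) => n Nn.
rewrite invf_ple ?posrE ?ltr0n //; apply/ltW/(lt_le_trans (truncnS_gt e^-1)).
by rewrite ler_nat.
Qed.

Lemma slope_le_of_recovery (R : realType) (W : R -> R) (rho : R -> R -> R)
  (rho0 : R -> R) (M0 L : R) :
  standing_W W -> densityT rho0 ->
  (forall eps, 0 < eps -> densityT (rho eps)) ->
  (forall eps, 0 < eps -> C1T (rho eps)) ->
  d2 (rho eps) rho0 @[eps --> 0^'+] --> 0 ->
  (forall eps, 0 < eps -> (Eeps W eps (rho eps) <= M0%:E)%E) ->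
  (limf_einf (fun eps => calG W eps (rho eps)) 0^'+ < L%:E)%E ->
  (slopeEss W rho0 <= L%:E)%E.
Proof.
move=> sW drho0 drho C1 dcv HE HL.
have pW := standing_potential sW.
have [_ [_ [_ [_ [_ [_ [[C [C0 HC]] [HQ _]]]]]]]] := sW.
have HC1 (y : R) : 0 <= y -> `|Qp W y| <= C * (1 + W y) by move=> /HC[].
(* A lower limit below [L] provides, in every right neighbourhood of 0, some [eps] with an
   admissible [g] of norm below [L]. *)
have freq (V : set R) : 0^'+ V -> exists eps, V eps /\ exists2 g, Teps W eps (rho eps) g &
    0 < L /\ (intT (fun x => (g x ^+ 2)%R) <= (L ^+ 2)%:E)%E.
  move=> HV; have [eps Ve] := limf_einf_lt_exists HL HV.
  move=> /ereal_inf_lt[_ [g Tg <-] gL]; exists eps; split=> //; exists g => //.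
  apply: poweR_half_lt gL; apply: integral_ge0 => x _.
  by rewrite lee_fin sqr_ge0.
have [_ [_ [_ _ [L0 _]]]] := freq setT filterT.
have [M [M00 HM]] := uniform_estimates M0 pW HC1 C0 HQ (sqr_ge0 L).
pose err n : R := (n.+1%:R)^-1.
have err0 n : 0 < err n by rewrite invr_gt0.
have err1 n : err n <= 1 by rewrite invf_le1 // ler1n.
pose good n (p : (R -> R) * (R -> R)) := [/\ densityT p.1, continuous p.1,
  forall x, p.1 x <= M,
  forall x, 0 <= x <= 1 -> `|cumul p.1 x - cumul rho0 x| <= err n &
  [/\ forall a b : R, 0 <= a -> a <= b -> b <= 1 -> p.2 a <= p.2 b,
      p.2 1 - p.2 0 <= L ^+ 2 &
      forall a b t : R, 0 <= a -> a <= b -> b <= 1 -> 0 < t ->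
        t * `|Qssp W (p.1 b) - Qssp W (p.1 a)| <=
        (t ^+ 2 * (cumul p.1 b - cumul p.1 a) + (p.2 b - p.2 a)) / 2 + 2 * t * err n]].
have ex n : exists p, good n p.
  have [eps0 [eps00 Heps]] := HM _ (err0 n).
  have M1 : 0 < 4 * (M + 1) by rewrite mulr_gt0 // ltr_wpDl.
  (* With this width the two strips weigh at most [err n / 2], and [e = s * err n / 2] leaves
     [err n ^+ 2 / 4] for the mass carried further than [s]. *)
  pose s := err n / (4 * (M + 1)).
  have s0 : 0 < s by rewrite divr_gt0.
  have sE : s * (4 * (M + 1)) = err n by rewrite divfK // gt_eqF.
  pose e := s * err n / 2.
  have e0 : 0 < e by rewrite divr_gt0 // mulr_gt0.
  have eE : e ^+ 2 / s ^+ 2 = err n ^+ 2 / 4 by rewrite /e; field; rewrite gt_eqF.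
  have small : 2 * s * M + e ^+ 2 / s ^+ 2 <= err n.
    rewrite eE; have H1 : err n ^+ 2 <= err n by rewrite expr2 ler_piMl // ltW.
    have H2 : 0 <= s * M by rewrite mulr_ge0 // ltW.
    have arith (a b c d : R) : 0 <= b -> 0 < d -> a <= c ->
      d * (4 * (M + 1)) = c -> b = d * M -> 0 < c ->
      2 * b + a / 4 <= c by move=> *; lra.
    by rewrite -mulrA; exact: arith sE _ _.
  have V : 0^'+ [set eps | [/\ 0 < eps, eps < eps0 & `|d2 (rho eps) rho0| < e]].
    near=> eps; split; [near: eps; exact: nbhs_right_gt|near: eps; exact: nbhs_right_lt|].
    rewrite -[X in `|X|]subr0 distrC; near: eps.
    by move/cvgrPdist_lt : dcv; exact.
  have [eps [[ep elt ed] [g Tg [_ gL]]]] := freq _ V.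
  have [rM [m [mh mL mi]]] := Heps eps _ g ep elt (drho _ ep) (C1 _ ep) (HE _ ep) Tg gL.
  exists (rho eps, m); split => //=.
  - exact: drho.
  - by move=> x; have [_ [d _]] := C1 _ ep; exact: is_derive_cts (derivable_is_derive1 (d x)).
  - move=> x x01; apply: le_trans small.
    exact: W2_cumul (drho _ ep) drho0 rM e0 s0 x01 ed.
have [p Hp] := choice ex.
have [g Hg gL] := @limit_W11 R W rho0 M (L ^+ 2) (fun n => (p n).1) (fun n => (p n).2) err
  pW drho0 M00 (sqr_ge0 L) (fun n => let: And5 h _ _ _ _ := Hp n in h)
  (fun n => let: And5 _ h _ _ _ := Hp n in h) (fun n => let: And5 _ _ h _ _ := Hp n in h)
  (fun n => let: And5 _ _ _ _ (And3 h _ _) := Hp n in h)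
  (fun n => let: And5 _ _ _ _ (And3 _ h _) := Hp n in h)
  (fun n => let: And5 _ _ _ _ (And3 _ _ h) := Hp n in h)
  (fun n => let: And5 _ _ _ h _ := Hp n in h) (fun n => ltW (err0 n)) (@inv_succ_small R).
by apply: slopeEss_le (ltW L0) _ Hg gL; case: drho0 => _ [_ []].
Unshelve. all: by end_near. Qed.

Theorem theorem3p2 (R : realType) (W : R -> R) (rho : R -> R -> R)
  (rho0 : R -> R) :
  standing_W W ->
  densityT rho0 ->
  (forall eps, 0 < eps -> densityT (rho eps)) ->
  (forall eps, 0 < eps -> C1T (rho eps) /\ C4loc_pos (rho eps)) ->
  d2 (rho eps) rho0 @[eps --> 0^'+] --> 0 ->
  (exists M : R, forall eps, 0 < eps -> (Eeps W eps (rho eps) <= M%:E)%E) ->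
  (slopeEss W rho0 <= limf_einf (fun eps => calG W eps (rho eps)) 0^'+)%E.
Proof.
move=> sW drho0 drho C1 dcv [M0 HE]; apply: lee_real_above => L HL.
apply: slope_le_of_recovery sW drho0 drho _ dcv HE HL.
by move=> eps /C1[].
Qed.
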